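(* Let $\alpha\geq 2$, let $\Gamma=\mathbf{R}/((b-a)\mathbf{Z})$ be a circle, let $f\in\mathrm{Emb}^{\alpha}(\Gamma,\mathbf{R}^3)$ be a knot, and let $\tilde\kappa\colon\Gamma\to\mathbf{R}$ be a positive $\mathcal{C}^{\alpha-2}$ function. Then $f$ is isotopic in $\mathrm{Emb}^\alpha(\Gamma,\mathbf{R}^3)$ to a constant-speed knot of curvature $\tilde\kappa$.
   Context: $a<b$ are real numbers; $\alpha$ is an integer $\geq 2$ or $\infty$ (with $\infty-2=\infty$). $\mathcal{C}^\alpha(\Gamma,\mathbf{R}^3)$ carries the topology induced by the $\mathcal{C}^\alpha$-norm (the usual $\mathcal{C}^\infty$ topology if $\alpha=\infty$). $\mathrm{Imm}^\alpha(\Gamma,\mathbf{R}^3)\subset\mathcal{C}^\alpha(\Gamma,\mathbf{R}^3)$ is the subspace of maps with nowhere vanishing derivative, and $\mathrm{Emb}^\alpha(\Gamma,\mathbf{R}^3)\subset\mathrm{Imm}^\alpha(\Gamma,\mathbf{R}^3)$ is the subspace of injective ones; since $\Gamma$ is a circle its elements are called knots. Two knots are isotopic in $\mathrm{Emb}^\alpha(\Gamma,\mathbf{R}^3)$ if they are joined by a continuous path $[0,1]\to\mathrm{Emb}^\alpha(\Gamma,\mathbf{R}^3)$. The curvature of a curve $g$ is the function $\lvert T'\rvert/\lvert g'\rvert$ on $\Gamma$, where $T:=g'/\lvert g'\rvert$. Constant speed means $\lvert g'\rvert$ is constant on $\Gamma$. *)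

(* Defs.v *)
(* Classical reals of the standard library, with Coquelicot for derivatives,
   filters and norms. *)
From Stdlib Require Import Reals Lra ZArith.
From Coquelicot Require Import Coquelicot.
Open Scope R_scope.

(* [Order n] is the class C^n and [Smooth] is the class C^infinity. *)
Inductive regularity : Set :=
| Order (n : nat)
| Smooth.

Definition reg_le (k : nat) (alpha : regularity) : Prop :=
  match alpha with
  | Order n => (k <= n)%nat
  | Smooth => True
  end.

Definition reg_minus2 (alpha : regularity) : regularity :=
  match alpha with
  | Order n => Order (n - 2)
  | Smooth => Smooth
  end.

(* Coquelicot's norm on a product is the l^2 norm, so [norm] is the Euclidean
   norm of R^3: see [norm_R3]. *)
Definition R3 : NormedModule R_AbsRing :=
  prod_NormedModule R_AbsRing
    (prod_NormedModule R_AbsRing R_NormedModule R_NormedModule) R_NormedModule.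

Definition vec3 (x y z : R) : R3 := (x, y, z).

Lemma norm_R3 (x y z : R) :
  norm (vec3 x y z) = sqrt (x ^ 2 + y ^ 2 + z ^ 2).
Proof.
  change (norm (vec3 x y z))
    with (sqrt (sqrt (Rabs x ^ 2 + Rabs y ^ 2) ^ 2 + Rabs z ^ 2)).
  f_equal. rewrite pow2_sqrt.
  - now rewrite !pow2_abs.
  - apply Rplus_le_le_0_compat; apply pow2_ge_0.
Qed.

(* A map on the circle R/pZ is a p-periodic map on R, and its derivatives are
   those of the periodic map. *)
Definition periodic {X : Type} (p : R) (g : R -> X) : Prop :=
  forall x, g (x + p) = g x.

Definition injective_mod (p : R) {X : Type} (g : R -> X) : Prop :=
  forall x y, g x = g y -> exists k : Z, x - y = IZR k * p.

Definition coord1 (g : R -> R3) (x : R) : R := fst (fst (g x)).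
Definition coord2 (g : R -> R3) (x : R) : R := snd (fst (g x)).
Definition coord3 (g : R -> R3) (x : R) : R := snd (g x).

Definition deriv_n (n : nat) (g : R -> R3) (x : R) : R3 :=
  vec3 (Derive_n (coord1 g) n x) (Derive_n (coord2 g) n x)
       (Derive_n (coord3 g) n x).

Definition deriv (g : R -> R3) : R -> R3 := deriv_n 1 g.

Definition C_real (alpha : regularity) (h : R -> R) : Prop :=
  forall k, reg_le k alpha ->
  forall x, ex_derive_n h k x /\ continuous (Derive_n h k) x.

Definition C_circle_R (alpha : regularity) (p : R) (h : R -> R) : Prop :=
  periodic p h /\ C_real alpha h.

Definition C_circle (alpha : regularity) (p : R) (g : R -> R3) : Prop :=
  periodic p g /\
  C_real alpha (coord1 g) /\ C_real alpha (coord2 g) /\ C_real alpha (coord3 g).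

Definition Imm (alpha : regularity) (p : R) (g : R -> R3) : Prop :=
  C_circle alpha p g /\ forall x, deriv g x <> zero.

Definition Emb (alpha : regularity) (p : R) (g : R -> R3) : Prop :=
  Imm alpha p g /\ injective_mod p g.

(* The supremum is taken in [Rbar], so that no default value can make the norm
   of an unbounded map small. *)
Definition Cnorm (n : nat) (g : R -> R3) : Rbar :=
  Lub_Rbar (fun r => exists k x, (k <= n)%nat /\ r = norm (deriv_n k g x)).

(* Neighbourhoods of [g] in C^alpha(R/pZ, R^3). If [alpha = Order m] then the
   case [n = m] already gives all of them, as [Cnorm n] increases with [n];
   if [alpha = Smooth] this is the topology defined by all the C^n norms. *)
Definition C_nbhs (alpha : regularity) (p : R) (g : R -> R3)
    (U : (R -> R3) -> Prop) : Prop :=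
  exists n, reg_le n alpha /\
  exists eps : posreal, forall h, C_circle alpha p h ->
    Rbar_lt (Cnorm n (fun x => minus (h x) (g x))) eps -> U h.

(* The path is only constrained on [0,1]. *)
Definition isotopic (alpha : regularity) (p : R) (f g : R -> R3) : Prop :=
  exists H : R -> R -> R3,
    (forall t, 0 <= t <= 1 -> Emb alpha p (H t)) /\
    (forall t0, 0 <= t0 <= 1 ->
       filterlim H (within (fun t => 0 <= t <= 1) (locally t0))
                 (C_nbhs alpha p (H t0))) /\
    (forall x, H 0 x = f x) /\
    (forall x, H 1 x = g x).

Definition constant_speed (g : R -> R3) : Prop :=
  exists c : R, forall x, norm (deriv g x) = c.

Definition unit_tangent (g : R -> R3) (x : R) : R3 :=
  scal (/ norm (deriv g x)) (deriv g x).

Definition curvature (g : R -> R3) (x : R) : R :=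
  norm (deriv (unit_tangent g) x) / norm (deriv g x).

(* Main.v *)
(* After scaling [f] so that [|f'| <= 1/2], wind the unit tangent around the
   small circles of the sphere centred at [v = f' + xi], where [xi] is a small
   constant vector, with [N] turns in all and with a phase whose rate makes the
   speed of this spherical curve nearly proportional to [kappa]. Reparametrized
   so that its speed is exactly [c kappa], it stays close to its initial
   parametrization, and its integral is uniformly close to that of [v] for large
   [N]. By the Poincare-Miranda theorem some [xi] makes the integral over the
   period vanish, and [c] times the primitive of the curve is then a closed curve
   of speed [c] and curvature [kappa]. As the tangent keeps a positive component
   along [f'] and the primitive is uniformly close to [f], every positive
   combination of the two is embedded, so that a linear isotopy will do. Only
   the continuity of [kappa] is available when [alpha = 2], whence a topological
   argument for [xi] rather than an implicit function theorem. *)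
Require Import Defs.
From Stdlib Require Import Reals Lra Lia ZArith FunctionalExtensionality ClassicalEpsilon.
From Coquelicot Require Import Coquelicot.
Open Scope R_scope.

(** * Functions of class C^n *)

(** The obstacle is uniformity: the number of turns $N$ has to be fixed before $\xi$ is found. So
    the closeness estimates hold over a whole box of values of $\xi$, with constants independent of
    $N$ and $\xi$, and Poincare-Miranda is applied to the integral of the tangent as a Lipschitz
    function of $\xi$, whence the bookkeeping of functions that are bounded and Lipschitz in $\xi$.
    The constant $c$ is not free: it is the length of the spherical curve divided by the integral of
    $\kappa$ over a period. Reparametrizing is harmless because the motion of the centre and of the
    frame of the circles contributes a bounded velocity, while the winding contributes $\beta\kappa$
    with $\beta$ at least a constant times $N$. As $\kappa$ need not be differentiable, the
    integration by parts behind the averaging uses a $C^1$ approximation of $1/\kappa$. The circles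
    need a periodic frame orthogonal to $v$. It is built from a constant vector that is nowhere
    parallel to $f'$, which exists because the directions of a Lipschitz closed curve cannot fill
    the projective plane. *)

Fixpoint Ck (n : nat) (h : R -> R) : Prop :=
  match n with
  | O => forall x, continuous h x
  | S m => (forall x, ex_derive h x) /\ Ck m (Derive h)
  end.

Lemma Ck_continuous n h : Ck n h -> forall x, continuous h x.
Proof.
  destruct n as [|n]; simpl; [easy|].
  intros [H _] x. apply (ex_derive_continuous (K := R_AbsRing) (V := R_NormedModule)), H.
Qed.

Lemma Ck_le n m h : (m <= n)%nat -> Ck n h -> Ck m h.
Proof.
  revert m h. induction n as [|n IH]; intros m h Hm H.
  - now replace m with 0%nat by lia.
  - destruct m as [|m].
    + exact (Ck_continuous (S n) h H).
    + destruct H as [H1 H2]. split; [easy|]. apply IH; [lia|easy].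
Qed.

Lemma Ck_S n h h' : (forall x, is_derive h x (h' x)) -> Ck n h' -> Ck (S n) h.
Proof.
  intros H H'. split.
  - intros x. now exists (h' x).
  - replace (Derive h) with h'; [easy|].
    apply functional_extensionality. intros x. symmetry. now apply is_derive_unique.
Qed.

Lemma Ck_S_inv n h : Ck (S n) h ->
  exists h', (forall x, is_derive h x (h' x)) /\ Ck n h'.
Proof.
  intros [H1 H2]. exists (Derive h). split; [|easy].
  intros x. now apply Derive_correct.
Qed.

Lemma Ck_const n c : Ck n (fun _ => c).
Proof.
  revert c. induction n as [|n IH]; intros c.
  - intros x. apply continuous_const.
  - apply (Ck_S n _ (fun _ => 0)); [|apply IH].
    intros x. auto_derive; [easy|ring].
Qed.

Lemma Ck_plus n h k : Ck n h -> Ck n k -> Ck n (fun x => h x + k x).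
Proof.
  revert h k. induction n as [|n IH]; intros h k Hh Hk.
  - intros x. now apply (continuous_plus (V := R_NormedModule)).
  - apply Ck_S_inv in Hh. apply Ck_S_inv in Hk.
    destruct Hh as [h' [Hh Hh']], Hk as [k' [Hk Hk']].
    apply (Ck_S n _ (fun x => h' x + k' x)); [|now apply IH].
    intros x. now apply @is_derive_plus.
Qed.

Lemma Ck_mult n h k : Ck n h -> Ck n k -> Ck n (fun x => h x * k x).
Proof.
  revert h k. induction n as [|n IH]; intros h k Hh Hk.
  - intros x. now apply (continuous_mult (K := R_AbsRing)).
  - pose proof (Ck_le (S n) n h (Nat.le_succ_diag_r n) Hh) as Hh0.
    pose proof (Ck_le (S n) n k (Nat.le_succ_diag_r n) Hk) as Hk0.
    apply Ck_S_inv in Hh. apply Ck_S_inv in Hk.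
    destruct Hh as [h' [Hh Hh']], Hk as [k' [Hk Hk']].
    apply (Ck_S n _ (fun x => h' x * k x + h x * k' x)).
    + intros x. apply @is_derive_mult; auto. intros; apply Rmult_comm.
    + apply Ck_plus; now apply IH.
Qed.

Lemma Ck_scal n c h : Ck n h -> Ck n (fun x => c * h x).
Proof. intros H. apply Ck_mult; [apply Ck_const|easy]. Qed.

Lemma Ck_opp n h : Ck n h -> Ck n (fun x => - h x).
Proof.
  intros H. replace (fun x => - h x) with (fun x => -1 * h x).
  - now apply Ck_scal.
  - apply functional_extensionality. intros x. ring.
Qed.

Lemma Ck_minus n h k : Ck n h -> Ck n k -> Ck n (fun x => h x - k x).
Proof. intros Hh Hk. apply Ck_plus; [easy|now apply Ck_opp]. Qed.

Lemma Ck_comp n h k : Ck n h -> Ck n k -> Ck n (fun x => h (k x)).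
Proof.
  revert h k. induction n as [|n IH]; intros h k Hh Hk.
  - intros x. apply (continuous_comp k h); [apply Hk|apply Hh].
  - pose proof (Ck_le (S n) n k (Nat.le_succ_diag_r n) Hk) as Hk0.
    apply Ck_S_inv in Hh. apply Ck_S_inv in Hk.
    destruct Hh as [h' [Hh Hh']], Hk as [k' [Hk Hk']].
    apply (Ck_S n _ (fun x => k' x * h' (k x))).
    + intros x. apply (is_derive_comp h k); auto.
    + apply Ck_mult; [easy|]. now apply IH.
Qed.

Lemma Ck_inv n h : (forall x, h x <> 0) -> Ck n h -> Ck n (fun x => / h x).
Proof.
  intros Hne. induction n as [|n IH]; intros Hh.
  - intros x. apply (continuous_comp h Rinv); [apply Hh|].
    apply continuous_Rinv, Hne.
  - pose proof (Ck_le (S n) n h (Nat.le_succ_diag_r n) Hh) as Hh0.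
    apply Ck_S_inv in Hh. destruct Hh as [h' [Hh Hh']].
    apply (Ck_S n _ (fun x => - h' x * (/ h x * / h x))).
    + intros x. replace (- h' x * (/ h x * / h x)) with (- h' x / h x ^ 2)
        by (field; apply Hne).
      now apply is_derive_inv.
    + apply Ck_mult; [now apply Ck_opp|]. apply Ck_mult; now apply IH.
Qed.

Lemma Ck_div n h k : (forall x, k x <> 0) -> Ck n h -> Ck n k ->
  Ck n (fun x => h x / k x).
Proof. intros H Hh Hk. apply Ck_mult; [easy|now apply Ck_inv]. Qed.

Lemma Ck_sqrt n h : (forall x, 0 < h x) -> Ck n h -> Ck n (fun x => sqrt (h x)).
Proof.
  intros Hpos. induction n as [|n IH]; intros Hh.
  - intros x. apply (continuous_comp h sqrt); [apply Hh|apply continuous_sqrt].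
  - pose proof (Ck_le (S n) n h (Nat.le_succ_diag_r n) Hh) as Hh0.
    apply Ck_S_inv in Hh. destruct Hh as [h' [Hh Hh']].
    apply (Ck_S n _ (fun x => h' x * / (2 * sqrt (h x)))).
    + intros x. now apply is_derive_sqrt.
    + apply Ck_mult; [easy|]. apply Ck_inv.
      * intros x. pose proof (sqrt_lt_R0 _ (Hpos x)). lra.
      * now apply Ck_scal, IH.
Qed.

Lemma Ck_sin_cos n : Ck n sin /\ Ck n cos.
Proof.
  induction n as [|n [IHs IHc]].
  - split; intros x; [apply continuous_sin|apply continuous_cos].
  - split.
    + apply (Ck_S n _ cos); [|easy]. intros x. apply is_derive_sin.
    + apply (Ck_S n _ (fun x => - sin x)); [|now apply Ck_opp].
      intros x. apply is_derive_cos.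
Qed.

Lemma Derive_n_S h k : Derive_n h (S k) = Derive_n (Derive h) k.
Proof.
  apply functional_extensionality. intros x.
  rewrite <- (Nat.add_1_r k). symmetry. apply (Derive_n_comp h k 1 x).
Qed.

Lemma ex_derive_n_S h k x :
  (forall y, ex_derive h y) -> ex_derive_n (Derive h) k x -> ex_derive_n h (S k) x.
Proof.
  intros H. destruct k as [|k]; intros Hk; [apply H|].
  change (ex_derive (Derive_n h (S k)) x).
  now rewrite Derive_n_S.
Qed.

(** Links [Ck] to the iterated derivatives of [C_real]. The recursive form is the one in which the
    product and chain rules go through by induction. *)
Lemma Ck_Derive_n n h : Ck n h <->
  (forall k, (k <= n)%nat -> forall x, ex_derive_n h k x /\ continuous (Derive_n h k) x).
Proof.
  split.
  - revert h. induction n as [|n IH]; intros h H k Hk x.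
    + replace k with 0%nat by lia. split; [easy|]. apply H.
    + destruct k as [|k].
      * split; [easy|]. exact (Ck_continuous (S n) h H x).
      * destruct H as [H1 H2]. destruct (IH _ H2 k ltac:(lia) x) as [H3 H4].
        split; [now apply ex_derive_n_S|]. now rewrite Derive_n_S.
  - revert h. induction n as [|n IH]; intros h H.
    + intros x. apply (H 0%nat); lia.
    + split.
      * intros x. apply (H 1%nat). lia.
      * apply IH. intros k Hk x. destruct (H (S k) ltac:(lia) x) as [H1 H2].
        rewrite Derive_n_S in H2. split; [|easy].
        destruct k as [|k]; [easy|].
        change (ex_derive (Derive_n h (S k)) x) in H1.
        now rewrite Derive_n_S in H1.
Qed.

Lemma C_real_Ck alpha h :
  C_real alpha h <-> (forall n, reg_le n alpha -> Ck n h).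
Proof.
  split.
  - intros H n Hn. apply Ck_Derive_n. intros k Hk. apply H.
    destruct alpha as [m|]; simpl in *; lia.
  - intros H k Hk. now apply (proj1 (Ck_Derive_n k h) (H k Hk)).
Qed.

(** * Periodic functions, primitives and inverse functions *)

Lemma periodic_Z {X : Type} p (g : R -> X) :
  periodic p g -> forall (k : Z) x, g (x + IZR k * p) = g x.
Proof.
  intros H.
  assert (Hn : forall (n : nat) x, g (x + INR n * p) = g x).
  { induction n as [|n IH]; intros x.
    - simpl. f_equal. ring.
    - rewrite S_INR. replace (x + (INR n + 1) * p) with ((x + INR n * p) + p) by ring.
      now rewrite H. }
  intros k x. destruct (Z_le_gt_dec 0 k) as [Hk|Hk].
  - rewrite <- (Z2Nat.id k), <- INR_IZR_INZ by easy. apply Hn.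
  - rewrite <- (Hn (Z.to_nat (- k)) (x + IZR k * p)).
    f_equal. rewrite INR_IZR_INZ, Z2Nat.id, opp_IZR by lia. ring.
Qed.

Lemma reduce_mod p x : 0 < p -> exists k : Z, 0 <= x - IZR k * p < p.
Proof.
  intros Hp. exists (Int_part (x / p)).
  destruct (base_Int_part (x / p)) as [H1 H2].
  assert (E : x = x / p * p) by (field; lra).
  set (q := x / p) in *. set (k := IZR (Int_part q)) in *.
  rewrite E. nra.
Qed.

Lemma reduce_mod_centered p x : 0 < p -> exists k : Z, Rabs (x - IZR k * p) <= p / 2.
Proof.
  intros Hp. destruct (reduce_mod p (x + p / 2) Hp) as [k Hk].
  exists k. apply Rabs_le. lra.
Qed.

Lemma periodic_forall {X : Type} p (g : R -> X) (P : X -> Prop) :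
  0 < p -> periodic p g -> (forall x, 0 <= x <= p -> P (g x)) -> forall x, P (g x).
Proof.
  intros Hp Hg H x. destruct (reduce_mod p x Hp) as [k Hk].
  replace x with ((x - IZR k * p) + IZR k * p) by ring.
  rewrite periodic_Z by easy. apply H. lra.
Qed.

Lemma continuous_pt (g : R -> R) x : continuous g x -> continuity_pt g x.
Proof. apply continuity_pt_filterlim. Qed.

Lemma positive_min (g : R -> R) a b :
  a <= b -> (forall x, continuous g x) -> (forall x, a <= x <= b -> 0 < g x) ->
  exists m, 0 < m /\ forall x, a <= x <= b -> m <= g x.
Proof.
  intros Hab Hc Hpos.
  destruct (continuity_ab_min g a b Hab) as [x [H1 H2]].
  - intros c _. apply continuous_pt, Hc.
  - exists (g x). split; [now apply Hpos|easy].
Qed.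

Lemma periodic_positive_min p (g : R -> R) :
  0 < p -> periodic p g -> (forall x, continuous g x) -> (forall x, 0 < g x) ->
  exists m, 0 < m /\ forall x, m <= g x.
Proof.
  intros Hp Hg Hc Hpos.
  destruct (positive_min g 0 p) as [m [Hm H]]; [lra|easy|auto|].
  exists m. split; [easy|].
  now apply (periodic_forall p g (fun y => m <= y)).
Qed.

Lemma periodic_bounded p (g : R -> R) :
  0 < p -> periodic p g -> (forall x, continuous g x) ->
  exists C, 0 < C /\ forall x, Rabs (g x) <= C.
Proof.
  intros Hp Hg Hc.
  destruct (continuity_ab_maj (fun x => Rabs (g x)) 0 p) as [x [H1 H2]]; [lra| |].
  - intros c _. apply continuous_pt.
    apply (continuous_comp g Rabs); [apply Hc|apply continuous_Rabs].
  - exists (Rabs (g x) + 1). split.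
    + pose proof (Rabs_pos (g x)). lra.
    + apply (periodic_forall p g (fun y => Rabs y <= Rabs (g x) + 1)); [easy|easy|].
      intros y Hy. specialize (H1 y Hy). lra.
Qed.

Lemma mvt (P h : R -> R) x y : x <= y ->
  (forall z, x <= z <= y -> is_derive P z (h z)) ->
  exists c, x <= c <= y /\ P y - P x = h c * (y - x).
Proof.
  intros Hxy H. destruct (MVT_gen P x y h) as [c [Hc E]].
  - intros z. rewrite Rmin_left, Rmax_right by easy. intros Hz. apply H. lra.
  - intros z. rewrite Rmin_left, Rmax_right by easy. intros Hz.
    apply continuous_pt, (ex_derive_continuous (K := R_AbsRing) (V := R_NormedModule)).
    exists (h z). now apply H.
  - rewrite Rmin_left, Rmax_right in Hc by easy. now exists c.
Qed.

Lemma mvt_bound (P h : R -> R) C x y : x <= y ->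
  (forall z, x <= z <= y -> is_derive P z (h z)) ->
  (forall z, x <= z <= y -> Rabs (h z) <= C) ->
  Rabs (P y - P x) <= C * (y - x).
Proof.
  intros Hxy H Hb. destruct (mvt P h x y Hxy H) as [c [Hc E]].
  rewrite E, Rabs_mult, (Rabs_right (y - x)) by lra.
  apply Rmult_le_compat_r; [lra|]. now apply Hb.
Qed.

Lemma derive_bounded_lipschitz (P h : R -> R) C :
  (forall z, is_derive P z (h z)) -> (forall z, Rabs (h z) <= C) ->
  forall x y, Rabs (P x - P y) <= C * Rabs (x - y).
Proof.
  intros H Hb.
  assert (L : forall x y, x <= y -> Rabs (P x - P y) <= C * Rabs (x - y)).
  { intros x y Hxy. rewrite (Rabs_minus_sym (P x)), (Rabs_minus_sym x), (Rabs_right (y - x)) by lra.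
    now apply (mvt_bound P h). }
  intros x y. destruct (Rle_dec x y) as [Hxy|Hxy]; [now apply L|].
  rewrite (Rabs_minus_sym (P x)), (Rabs_minus_sym x). apply L. lra.
Qed.

Lemma derive_lower_bound (P h : R -> R) m x y : x <= y ->
  (forall z, is_derive P z (h z)) -> (forall z, m <= h z) ->
  m * (y - x) <= P y - P x.
Proof.
  intros Hxy H Hb. destruct (mvt P h x y Hxy) as [c [Hc E]]; [now intros; apply H|].
  rewrite E. apply Rmult_le_compat_r; [lra|apply Hb].
Qed.

Lemma derive_zero_const (P : R -> R) : (forall z, is_derive P z 0) ->
  forall x y, P x = P y.
Proof.
  intros H x y.
  pose proof (derive_bounded_lipschitz P (fun _ => 0) 0 H) as L.
  assert (Hb : forall z : R, Rabs 0 <= 0) by (intros; rewrite Rabs_R0; lra).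
  specialize (L Hb x y). rewrite Rmult_0_l in L.
  pose proof (Rabs_pos (P x - P y)).
  assert (E : Rabs (P x - P y) = 0) by lra.
  destruct (Req_dec (P x - P y) 0) as [|N]; [lra|].
  now apply Rabs_no_R0 in N.
Qed.

Definition prim (h : R -> R) (x : R) : R := RInt h 0 x.

Lemma prim_0 h : prim h 0 = 0.
Proof. exact (RInt_point 0 h). Qed.

Lemma is_derive_prim h : (forall x, continuous h x) ->
  forall x, is_derive (prim h) x (h x).
Proof.
  intros H x. apply (is_derive_RInt h (prim h) 0 x); [|apply H].
  apply filter_forall. intros y. apply (RInt_correct (V := R_CompleteNormedModule) h 0 y).
  apply (ex_RInt_continuous (V := R_CompleteNormedModule)). intros z _. apply H.
Qed.

Lemma prim_periodic h p : periodic p h -> (forall x, continuous h x) ->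
  forall x, prim h (x + p) = prim h x + prim h p.
Proof.
  intros Hp H x.
  pose (D := fun x => prim h (x + p) - prim h x).
  assert (E : D x = D 0).
  { apply derive_zero_const. intros z. unfold D.
    replace 0 with (1 * h (z + p) - h z) by (rewrite Hp; ring).
    apply @is_derive_minus; [|now apply is_derive_prim].
    apply (is_derive_comp (prim h) (fun z => z + p)); [now apply is_derive_prim|].
    auto_derive; [easy|ring]. }
  unfold D in E. rewrite prim_0, Rplus_0_l in E. lra.
Qed.

Lemma Ck_prim n h : Ck n h -> Ck (S n) (prim h).
Proof.
  intros H. apply (Ck_S n _ h); [|easy].
  apply is_derive_prim. now apply Ck_continuous with n.
Qed.

(** Choice by [epsilon] makes this total; it is meaningful only where [y] is a value of [F]. *)
Definition inverse (F : R -> R) (y : R) : R :=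
  epsilon (inhabits 0) (fun x => F x = y).

Lemma inverse_spec (F f : R -> R) m : 0 < m ->
  (forall x, is_derive F x (f x)) -> (forall x, m <= f x) ->
  forall y, F (inverse F y) = y.
Proof.
  intros Hm HF Hf y. unfold inverse. apply epsilon_spec.
  (* As [F] grows at rate at least [m], its values at [- u] and [u] enclose [y]. *)
  pose (u := Rabs (y - F 0) / m).
  assert (Hu : 0 <= u) by (apply Rdiv_le_0_compat; [apply Rabs_pos|easy]).
  assert (Hum : m * u = Rabs (y - F 0)) by (unfold u; field; lra).
  destruct (IVT_gen F (- u) u y) as [x [_ Hx]].
  - intros z. apply continuous_pt, (ex_derive_continuous (K := R_AbsRing) (V := R_NormedModule)).
    exists (f z). apply HF.
  - pose proof (derive_lower_bound F f m (- u) 0 ltac:(lra) HF Hf).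
    pose proof (derive_lower_bound F f m 0 u ltac:(lra) HF Hf).
    pose proof (Rle_abs (y - F 0)). pose proof (Rle_abs (- (y - F 0))).
    rewrite Rabs_Ropp in *.
    rewrite Rmin_left, Rmax_right; lra.
  - now exists x.
Qed.

Lemma derive_lower_bound_abs (F f : R -> R) m :
  (forall x, is_derive F x (f x)) -> (forall x, m <= f x) ->
  forall x y, m * Rabs (x - y) <= Rabs (F x - F y).
Proof.
  intros HF Hf x y. destruct (Rle_dec x y) as [Hxy|Hxy].
  - rewrite (Rabs_minus_sym x), (Rabs_minus_sym (F x)), (Rabs_right (y - x)) by lra.
    pose proof (derive_lower_bound F f m x y Hxy HF Hf).
    pose proof (Rle_abs (F y - F x)). lra.
  - rewrite (Rabs_right (x - y)) by lra.
    pose proof (derive_lower_bound F f m y x ltac:(lra) HF Hf).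
    pose proof (Rle_abs (F x - F y)). lra.
Qed.

(** The inverse function theorem on the line, in the form suited to a reparametrization [th] given
    by $F\circ th=L$. The lower bound on [f] makes [th] continuous, and then the mean values of [f]
    converge because [f] is continuous. *)
Lemma is_derive_implicit (F f L l th : R -> R) m : 0 < m ->
  (forall x, is_derive F x (f x)) -> (forall x, continuous f x) ->
  (forall x, m <= f x) -> (forall x, is_derive L x (l x)) ->
  (forall x, F (th x) = L x) ->
  forall x, is_derive th x (l x / f (th x)).
Proof.
  intros Hm HF Hc Hf HL E x.
  assert (Hthc : continuous th x).
  { apply continuity_pt_filterlim.
    assert (HLc : continuity_pt L x).
    { apply continuous_pt, (ex_derive_continuous (K := R_AbsRing) (V := R_NormedModule)).
      exists (l x). apply HL. }
    intros eps Heps. destruct (HLc (m * eps) ltac:(nra)) as [d [Hd H]].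
    exists d. split; [easy|]. intros y Hy. specialize (H y Hy).
    simpl in *. unfold Rdist in *. rewrite <- !E in H.
    pose proof (derive_lower_bound_abs F f m HF Hf (th y) (th x)). nra. }
  apply is_derive_Reals.
  assert (HLd := proj1 (is_derive_Reals _ _ _) (HL x)).
  (* the difference quotient of [th] is that of [L] over a mean value of [f] *)
  assert (Hq : forall y, exists c, Rabs (c - th x) <= Rabs (th y - th x) /\
             L y - L x = f c * (th y - th x)).
  { intros y. rewrite <- !E. destruct (Rle_dec (th x) (th y)) as [Hle|Hle].
    - destruct (mvt F f (th x) (th y) Hle) as [c [Hc1 Hc2]]; [now intros; apply HF|].
      exists c. split; [|easy]. rewrite !Rabs_right; lra.
    - destruct (mvt F f (th y) (th x)) as [c [Hc1 Hc2]]; [lra|now intros; apply HF|].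
      exists c. split; [|lra]. rewrite !Rabs_left1; lra. }
  pose (g := fun y => proj1_sig (constructive_indefinite_description _ (Hq y))).
  assert (Hg : forall y, Rabs (g y - th x) <= Rabs (th y - th x) /\
             L y - L x = f (g y) * (th y - th x)).
  { intros y. unfold g. now destruct constructive_indefinite_description. }
  assert (Hgx : g x = th x).
  { destruct (Hg x) as [H _]. rewrite Rminus_diag, Rabs_R0 in H.
    pose proof (Rabs_pos (g x - th x)).
    destruct (Req_dec (g x - th x) 0) as [|N]; [lra|]. apply Rabs_no_R0 in N. lra. }
  assert (Hgc : continuity_pt g x).
  { apply continuous_pt in Hthc. intros eps Heps.
    destruct (Hthc eps Heps) as [d [Hd H]]. exists d. split; [easy|].
    intros y Hy. specialize (H y Hy). simpl in *. unfold Rdist in *.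
    rewrite Hgx. destruct (Hg y). lra. }
  assert (Hic : continuity_pt (fun y => / f (g y)) x).
  { apply continuity_pt_inv.
    - apply (continuity_pt_comp g f); [easy|]. apply continuous_pt, Hc.
    - specialize (Hf (g x)). lra. }
  intros eps Heps.
  (* Bounds the difference quotient [q] of [L] near [x]. The error splits into [q] times the
     variation of [1 / f], and [q - l x] divided by [f (th x)]; each is given half of [eps]. *)
  pose (B := Rabs (l x) + 1).
  assert (HB : 0 < B) by (unfold B; pose proof (Rabs_pos (l x)); lra).
  destruct (HLd (Rmin 1 (eps * m / 2))) as [d1 H1].
  { apply Rmin_pos; [lra|nra]. }
  destruct (Hic (eps / (2 * B))) as [d2 [Hd2 H2]].
  { apply Rdiv_lt_0_compat; lra. }
  assert (Hd : 0 < Rmin d1 d2) by (apply Rmin_pos; [apply cond_pos|easy]).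
  exists (mkposreal _ Hd). simpl. intros h Hh0 Hh.
  assert (Hh1 : Rabs h < d1) by (eapply Rlt_le_trans; [apply Hh|apply Rmin_l]).
  assert (Hh2 : Rabs h < d2) by (eapply Rlt_le_trans; [apply Hh|apply Rmin_r]).
  specialize (H1 h Hh0 Hh1).
  specialize (H2 (x + h)). simpl in H2. unfold Rdist in H2.
  rewrite Hgx in H2.
  assert (H2' : Rabs (/ f (g (x + h)) - / f (th x)) < eps / (2 * B)).
  { apply H2. split.
    - split; [easy|]. lra.
    - now replace (x + h - x) with h by ring. }
  clear H2. destruct (Hg (x + h)) as [_ Hgh].
  pose proof (Hf (g (x + h))) as Hf1. pose proof (Hf (th x)) as Hf2.
  set (q := (L (x + h) - L x) / h) in *.
  assert (Hq1 : (th (x + h) - th x) / h = q * / f (g (x + h))).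
  { unfold q. rewrite Hgh. field. split; lra. }
  rewrite Hq1.
  replace (q * / f (g (x + h)) - l x / f (th x)) with
    (q * (/ f (g (x + h)) - / f (th x)) + (q - l x) * / f (th x)) by (field; lra).
  assert (Hqe1 : Rabs (q - l x) < 1) by (eapply Rlt_le_trans; [apply H1|apply Rmin_l]).
  assert (Hqe2 : Rabs (q - l x) < eps * m / 2) by (eapply Rlt_le_trans; [apply H1|apply Rmin_r]).
  assert (Hqb : Rabs q <= B).
  { unfold B. replace q with ((q - l x) + l x) by ring.
    eapply Rle_trans; [apply Rabs_triang|]. lra. }
  eapply Rle_lt_trans; [apply Rabs_triang|]. rewrite !Rabs_mult.
  assert (Hi : 0 < / f (th x) <= / m).
  { split; [apply Rinv_0_lt_compat; lra|apply Rinv_le_contravar; lra]. }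
  rewrite (Rabs_right (/ f (th x))) by lra.
  assert (I1 : Rabs q * Rabs (/ f (g (x + h)) - / f (th x)) <= eps / 2).
  { replace (eps / 2) with (B * (eps / (2 * B))) by (field; lra).
    apply Rmult_le_compat; try apply Rabs_pos; lra. }
  assert (I2 : Rabs (q - l x) * / f (th x) < eps / 2).
  { replace (eps / 2) with (eps * m / 2 * / m) by (field; lra).
    pose proof (Rabs_pos (q - l x)).
    apply Rle_lt_trans with (Rabs (q - l x) * / m); [apply Rmult_le_compat_l; lra|].
    apply Rmult_lt_compat_r; [|lra]. now apply Rinv_0_lt_compat. }
  lra.
Qed.

(** The average of [1 / k] over [[x, x + dl]] is $C^1$ even when [k] is merely continuous, and the
    uniform continuity of [k] provides [dl]. The bound on [j'] is of order [1 / dl]; this does no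
    harm, as it will be divided by a multiple of the number of turns. *)
Lemma smooth_reciprocal (k : R -> R) p k0 : 0 < p -> 0 < k0 ->
  (forall x, continuous k x) -> (forall x, k0 <= k x) ->
  forall eps, 0 < eps -> exists j j' C,
    (forall x, is_derive j x (j' x)) /\
    forall x, 0 <= x <= p ->
      Rabs (1 - k x * j x) <= eps /\ Rabs (j x) <= C /\ Rabs (j' x) <= C.
Proof.
  intros Hp Hk0 Hc Hk eps Heps.
  (* The interval reaches [p + 1] because the averages look ahead by [dl <= 1]; the factor [k0] pays
     for a division by [k]. *)
  destruct (Heine_cor2 (f := k) (a := 0) (b := p + 1)) with (eps := mkposreal (eps * k0) ltac:(nra))
    as [d Hd]; [now intros; apply continuous_pt|].
  simpl in Hd.
  pose (dl := Rmin (d / 2) 1).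
  assert (Hdl : 0 < dl <= 1) by (split; [apply Rmin_pos; [pose proof (cond_pos d); lra|lra]|apply Rmin_r]).
  assert (Hdl2 : dl < d).
  { pose proof (cond_pos d). apply Rle_lt_trans with (d / 2); [apply Rmin_l|lra]. }
  assert (Hic : forall x, continuous (fun y => / k y) x).
  { intros x. apply (continuous_comp k Rinv); [apply Hc|]. apply continuous_Rinv.
    specialize (Hk x). lra. }
  assert (Hi : forall x, 0 < / k x <= / k0).
  { intros x. specialize (Hk x). split; [apply Rinv_0_lt_compat; lra|apply Rinv_le_contravar; lra]. }
  pose (Q := prim (fun y => / k y)).
  assert (HQ : forall x, is_derive Q x (/ k x)) by (now apply is_derive_prim).
  assert (Hid : 0 < / dl) by (apply Rinv_0_lt_compat; lra).
  assert (Hik0 : 0 < / k0) by (apply Rinv_0_lt_compat; lra).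
  exists (fun x => (Q (x + dl) - Q x) * / dl), (fun x => (/ k (x + dl) - / k x) * / dl),
    (/ k0 + / k0 * / dl).
  split.
  - intros x. replace ((/ k (x + dl) - / k x) * / dl) with (/ dl * (1 * / k (x + dl) - / k x)) by ring.
    apply (is_derive_ext (fun x => / dl * (Q (x + dl) - Q x))); [intros; apply Rmult_comm|].
    apply is_derive_scal. apply @is_derive_minus; [|apply HQ].
    apply (is_derive_comp Q (fun z => z + dl)); [apply HQ|].
    auto_derive; [easy|ring].
  - intros x Hx. destruct (mvt Q (fun y => / k y) x (x + dl)) as [c [Hc1 Hc2]];
      [lra|now intros; apply HQ|].
    rewrite Hc2. replace (/ k c * (x + dl - x) * / dl) with (/ k c) by (field; split; [lra|specialize (Hk c); lra]).
    pose proof (Hi c) as Hic'. split; [|split].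
    + replace (1 - k x * / k c) with ((k c - k x) * / k c) by (field; specialize (Hk c); lra).
      rewrite Rabs_mult, (Rabs_right (/ k c)) by lra.
      assert (Rabs (k c - k x) < eps * k0).
      { apply Hd; try lra. rewrite Rabs_right; lra. }
      replace eps with (eps * k0 * / k0) by (field; lra).
      apply Rmult_le_compat; try lra. apply Rabs_pos.
    + rewrite Rabs_right by lra. nra.
    + rewrite Rabs_mult, (Rabs_right (/ dl)) by lra.
      assert (Rabs (/ k (x + dl) - / k x) <= / k0).
      { pose proof (Hi x). pose proof (Hi (x + dl)). apply Rabs_le. lra. }
      nra.
Qed.

(** * The Poincare-Miranda theorem in dimension three *)

Inductive axis : Set := ax1 | ax2 | ax3.

(** Vectors are functions of the axis, so that a statement about all coordinates is one quantified
    statement. The passage to [R3] takes place only at the end. *)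
Definition vec : Type := axis -> R.

Definition mkvec (x y z : R) : vec :=
  fun i => match i with ax1 => x | ax2 => y | ax3 => z end.

Definition dist1 (u v : vec) : R :=
  Rabs (u ax1 - v ax1) + Rabs (u ax2 - v ax2) + Rabs (u ax3 - v ax3).

Definition in_box (rho : R) (u : vec) : Prop := forall i, Rabs (u i) <= rho.

Fixpoint rsum (n : nat) (F : nat -> R) : R :=
  match n with O => 0 | S m => rsum m F + F m end.

Lemma rsum_ext n F G : (forall i, (i < n)%nat -> F i = G i) -> rsum n F = rsum n G.
Proof.
  induction n as [|n IH]; simpl; intros H; [easy|].
  rewrite IH by (intros; apply H; lia). now rewrite H by lia.
Qed.

Lemma rsum_telescope n F : rsum n (fun i => F (S i) - F i) = F n - F 0%nat.
Proof. induction n as [|n IH]; simpl; [ring|]. rewrite IH. ring. Qed.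

Lemma rsum_minus n F G : rsum n (fun i => F i - G i) = rsum n F - rsum n G.
Proof. induction n as [|n IH]; simpl; [ring|]. rewrite IH. ring. Qed.

Lemma rsum_zero n F : (forall i, (i < n)%nat -> F i = 0) -> rsum n F = 0.
Proof.
  intros H. rewrite (rsum_ext n F (fun _ => 0)) by easy.
  clear H. induction n as [|n IH]; simpl; lra.
Qed.

Lemma rsum_nonzero n F : rsum n F <> 0 -> exists i, (i < n)%nat /\ F i <> 0.
Proof.
  induction n as [|n IH]; simpl; intros H; [lra|].
  destruct (Req_dec (F n) 0) as [E|E]; [|now exists n; split; [lia|]].
  destruct IH as [i [Hi Hi']]; [lra|]. exists i. split; [lia|easy].
Qed.

(* The cup product of the coboundaries of [b] and [c] on a unit square. *)
Definition cup2 (b c : nat -> nat -> R) (j k : nat) : R :=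
  (b (S j) k - b j k) * (c (S j) (S k) - c (S j) k)
  - (b j (S k) - b j k) * (c (S j) (S k) - c j (S k)).

(** Discrete Stokes in the plane: [cup2 b c] is the coboundary of [b] times the coboundary of [c],
    so the sum reduces to the boundary. Only the side where [b] is 1 contributes, and there [c]
    rises from 0 to 1. *)
Lemma cup2_sum m (b c : nat -> nat -> R) :
  (forall k, (k <= m)%nat -> b 0%nat k = 0 /\ b m k = 1) ->
  (forall j, (j <= m)%nat -> c j 0%nat = 0 /\ c j m = 1) ->
  rsum m (fun j => rsum m (fun k => cup2 b c j k)) = 1.
Proof.
  intros Hb Hc.
  pose (Ey := fun j k => b j k * (c (S j) k - c j k)).
  pose (Ez := fun j k => b j k * (c j (S k) - c j k)).
  rewrite (rsum_ext m _ (fun j => (rsum m (Ez (S j)) - rsum m (Ez j)) - (Ey j m - Ey j 0%nat))).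
  2: { intros j Hj. rewrite <- (rsum_telescope m (Ey j)), <- !rsum_minus.
       apply rsum_ext. intros k Hk. unfold cup2, Ey, Ez. ring. }
  rewrite rsum_minus, (rsum_telescope m (fun j => rsum m (Ez j))).
  rewrite (rsum_zero m (fun j => Ey j m - Ey j 0%nat)).
  2: { intros j Hj. unfold Ey.
       destruct (Hc j ltac:(lia)) as [-> ->], (Hc (S j) ltac:(lia)) as [-> ->]. ring. }
  rewrite (rsum_zero m (Ez 0%nat)).
  2: { intros k Hk. unfold Ez. destruct (Hb k ltac:(lia)) as [-> _]. ring. }
  rewrite (rsum_ext m (Ez m) (fun k => c m (S k) - c m k)).
  2: { intros k Hk. unfold Ez. destruct (Hb k ltac:(lia)) as [_ ->]. ring. }
  rewrite rsum_telescope. destruct (Hc m ltac:(lia)) as [-> ->]. ring.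
Qed.

(* The cup product of the coboundaries of [a], [b] and [c] on a unit cube: one
   signed term for each monotone path along the edges. *)
Definition cup3 (a b c : nat -> nat -> nat -> R) (i j k : nat) : R :=
  let d (h : nat -> nat -> nat -> R) i j k i' j' k' := h i' j' k' - h i j k in
    d a i j k (S i) j k * d b (S i) j k (S i) (S j) k * d c (S i) (S j) k (S i) (S j) (S k)
  - d a i j k (S i) j k * d b (S i) j k (S i) j (S k) * d c (S i) j (S k) (S i) (S j) (S k)
  - d a i j k i (S j) k * d b i (S j) k (S i) (S j) k * d c (S i) (S j) k (S i) (S j) (S k)
  + d a i j k i (S j) k * d b i (S j) k i (S j) (S k) * d c i (S j) (S k) (S i) (S j) (S k)
  + d a i j k i j (S k) * d b i j (S k) (S i) j (S k) * d c (S i) j (S k) (S i) (S j) (S k)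
  - d a i j k i j (S k) * d b i j (S k) i (S j) (S k) * d c i (S j) (S k) (S i) (S j) (S k).

(* Discrete Stokes: [cup3] is the coboundary of [a] times the [cup2] of [b] and
   [c], which vanishes on all faces of the cube [0,m]^3 but one. *)
Lemma cup3_sum m (a b c : nat -> nat -> nat -> R) :
  (forall j k, (j <= m)%nat -> (k <= m)%nat -> a 0%nat j k = 0 /\ a m j k = 1) ->
  (forall i k, (i <= m)%nat -> (k <= m)%nat -> b i 0%nat k = 0 /\ b i m k = 1) ->
  (forall i j, (i <= m)%nat -> (j <= m)%nat -> c i j 0%nat = 0 /\ c i j m = 1) ->
  rsum m (fun i => rsum m (fun j => rsum m (fun k => cup3 a b c i j k))) = 1.
Proof.
  intros Ha Hb Hc.
  pose (Fyz := fun i j k => a i j k * cup2 (b i) (c i) j k).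
  pose (Fxz := fun i j k => a i j k * cup2 (fun i k => b i j k) (fun i k => c i j k) i k).
  pose (Fxy := fun i j k => a i j k * cup2 (fun i j => b i j k) (fun i j => c i j k) i j).
  rewrite (rsum_ext m _ (fun i =>
    (rsum m (fun j => rsum m (Fyz (S i) j)) - rsum m (fun j => rsum m (Fyz i j)))
    - ((rsum m (Fxz i m) - rsum m (Fxz i 0%nat))
       - rsum m (fun j => Fxy i j m - Fxy i j 0%nat)))).
  2: { intros i Hi. rewrite <- (rsum_telescope m (fun j => rsum m (Fxz i j))), <- !rsum_minus.
       apply rsum_ext. intros j Hj. rewrite <- (rsum_telescope m (Fxy i j)), <- !rsum_minus.
       apply rsum_ext. intros k Hk. unfold cup3, Fyz, Fxz, Fxy, cup2. ring. }
  rewrite rsum_minus, (rsum_telescope m (fun i => rsum m (fun j => rsum m (Fyz i j)))).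
  rewrite (rsum_zero m (fun i => _ - _ - _)).
  2: { intros i Hi.
       assert (Hz : forall i k, (i < m)%nat -> (k < m)%nat -> Fxz i m k = 0 /\ Fxz i 0%nat k = 0).
       { clear i Hi. intros i k Hi Hk. unfold Fxz, cup2.
         destruct (Hb i k ltac:(lia) ltac:(lia)) as [-> ->].
         destruct (Hb (S i) k ltac:(lia) ltac:(lia)) as [-> ->].
         destruct (Hb i (S k) ltac:(lia) ltac:(lia)) as [-> ->]. split; ring. }
       rewrite (rsum_zero m (Fxz i m)), (rsum_zero m (Fxz i 0%nat))
         by (intros; now apply Hz).
       rewrite rsum_zero; [ring|]. intros j Hj. unfold Fxy, cup2.
       destruct (Hc (S i) j ltac:(lia) ltac:(lia)) as [-> ->].
       destruct (Hc i (S j) ltac:(lia) ltac:(lia)) as [-> ->].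
       destruct (Hc (S i) (S j) ltac:(lia) ltac:(lia)) as [-> ->]. ring. }
  rewrite (rsum_zero m (fun j => rsum m (Fyz 0%nat j))).
  2: { intros j Hj. apply rsum_zero. intros k Hk. unfold Fyz.
       destruct (Ha j k ltac:(lia) ltac:(lia)) as [-> _]. ring. }
  rewrite (rsum_ext m _ (fun j => rsum m (fun k => cup2 (b m) (c m) j k))).
  2: { intros j Hj. apply rsum_ext. intros k Hk. unfold Fyz.
       destruct (Ha j k ltac:(lia) ltac:(lia)) as [_ ->]. ring. }
  rewrite cup2_sum; [ring| |]; intros; [now apply Hb|now apply Hc].
Qed.

Definition varies (h : nat -> nat -> nat -> R) (i j k : nat) : Prop :=
  exists i' j' k', (i <= i' <= S i)%nat /\ (j <= j' <= S j)%nat /\ (k <= k' <= S k)%nat /\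
    h i' j' k' <> h i j k.

Lemma not_varies h i j k : ~ varies h i j k ->
  forall i' j' k', (i <= i' <= S i)%nat -> (j <= j' <= S j)%nat -> (k <= k' <= S k)%nat ->
    h i' j' k' = h i j k.
Proof.
  intros H i' j' k' Hi Hj Hk.
  destruct (Req_dec (h i' j' k') (h i j k)) as [|N]; [easy|].
  destruct H. now exists i', j', k'.
Qed.

(** Each of the six terms contains one increment of each of the three functions along an edge of the
    cube, so a function that is constant on the vertices makes all of them vanish. *)
Lemma cup3_varies a b c i j k : cup3 a b c i j k <> 0 ->
  varies a i j k /\ varies b i j k /\ varies c i j k.
Proof.
  intros H; repeat split; apply NNPP; intros N; apply H;
    pose proof (not_varies _ _ _ _ N) as E; unfold cup3;
    rewrite ?(E (S i) j k), ?(E i (S j) k), ?(E i j (S k)), ?(E (S i) (S j) k),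
      ?(E (S i) j (S k)), ?(E i (S j) (S k)), ?(E (S i) (S j) (S k)) by lia; ring.
Qed.

(** Applied to the indicators of positive components at the points of a grid, [cup3_sum] yields a
    small cube on which every component of [F] changes sign, so that [F] is small there. Compactness
    turns the absence of zeros into a bound which this contradicts. *)
Lemma poincare_miranda (rho L : R) (F : vec -> vec) : 0 < rho -> 0 < L ->
  (forall u v, in_box rho u -> in_box rho v -> forall i,
     Rabs (F u i - F v i) <= L * dist1 u v) ->
  (forall u i, in_box rho u -> u i = - rho -> F u i < 0) ->
  (forall u i, in_box rho u -> u i = rho -> 0 < F u i) ->
  exists u, in_box rho u /\ forall i, F u i = 0.
Proof.
  intros Hrho HL Hlip Hneg Hpos. apply NNPP. intros Hno.
  pose (size := fun u => Rmax (Rabs (F u ax1)) (Rmax (Rabs (F u ax2)) (Rabs (F u ax3)))).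
  assert (Hsize : forall u i, Rabs (F u i) <= size u).
  { intros u i. unfold size. destruct i.
    - apply Rmax_l.
    - eapply Rle_trans; [apply Rmax_l|apply Rmax_r].
    - eapply Rle_trans; [apply Rmax_r|apply Rmax_r]. }
  assert (Hsize0 : forall u, in_box rho u -> 0 < size u).
  { intros u Hu. destruct (Rlt_dec 0 (size u)) as [|N]; [easy|].
    destruct Hno. exists u. split; [easy|]. intros i.
    specialize (Hsize u i). pose proof (Rabs_pos (F u i)).
    destruct (Req_dec (F u i) 0) as [|N']; [easy|].
    apply Rabs_no_R0 in N'. lra. }
  pose (tovec := fun t : Compactness.Tn 3 R =>
    let '(x, (y, (z, _))) := t in mkvec x y z).
  (* A grid vertex within this gauge in each coordinate changes [F] by at most [3 * L * gauge t],
     and at the vertex found below [F] is at most [L * gauge t]. Together these give half of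
     [size (tovec t)], a contradiction; hence the 8. *)
  pose (gauge := fun t => Rmax (size (tovec t)) 0 / (8 * L)).
  assert (Hg : forall t, 0 < if Rlt_dec 0 (gauge t) then gauge t else 1).
  { intros t. destruct Rlt_dec; lra. }
  destruct (compactness_value 3 (- rho, (- rho, (- rho, tt))) (rho, (rho, (rho, tt)))
    (fun t => mkposreal _ (Hg t))) as [d Hd]. simpl in Hd.
  assert (Hbox : forall x y z, -rho <= x <= rho -> -rho <= y <= rho -> -rho <= z <= rho ->
    in_box rho (mkvec x y z)).
  { intros x y z Hx Hy Hz i. apply Rabs_le. now destruct i. }
  (* With more than [6 * rho / d] steps per side, three steps of length [2 * rho / INR m] add up to
     at most [d], so two vertices of a grid cube are within [d] for [dist1]. *)
  destruct (nfloor_ex (6 * rho / d)) as [n Hn].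
  { apply Rdiv_le_0_compat; [lra|apply cond_pos]. }
  pose (m := S n).
  assert (HM : 0 < INR m) by (apply lt_0_INR; unfold m; lia).
  assert (Hm : 6 * rho / INR m <= d).
  { assert (6 * rho / d < INR m) by (unfold m; rewrite S_INR; lra).
    pose proof (cond_pos d). apply Rle_div_l; [easy|].
    apply Rlt_div_l in H; lra. }
  pose (pt := fun i => - rho + 2 * rho * (INR i / INR m)).
  assert (Hpt : forall i, (i <= m)%nat -> - rho <= pt i <= rho).
  { intros i Hi. apply le_INR in Hi. pose proof (pos_INR i).
    assert (0 <= INR i / INR m <= 1).
    { split; [now apply Rdiv_le_0_compat|]. apply Rle_div_l; lra. }
    unfold pt. set (q := INR i / INR m) in *. split; nra. }
  assert (Hpt0 : pt 0%nat = - rho) by (unfold pt; change (INR 0) with 0; field; lra).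
  assert (Hptm : pt m = rho) by (unfold pt; field; lra).
  assert (HptS : forall i i', (i <= i' <= S i)%nat -> Rabs (pt i' - pt i) <= 2 * rho / INR m).
  { intros i i' Hi.
    assert (Hstep : 0 <= 2 * rho / INR m) by (apply Rdiv_le_0_compat; lra).
    assert (i' = i \/ i' = S i) as [->| ->] by lia.
    - now rewrite Rminus_diag, Rabs_R0.
    - replace (pt (S i) - pt i) with (2 * rho / INR m)
        by (unfold pt; rewrite S_INR; field; lra).
      rewrite Rabs_right; lra. }
  pose (u := fun i j k => mkvec (pt i) (pt j) (pt k)).
  assert (Hu : forall i j k, (i <= m)%nat -> (j <= m)%nat -> (k <= m)%nat -> in_box rho (u i j k)).
  { intros i j k Hi Hj Hk. apply Hbox; now apply Hpt. }
  (* The sign conditions on the faces of the box become the boundary values 0 and 1 that [cup3_sum]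
     requires. *)
  pose (sg := fun e i j k => if Rlt_dec 0 (F (u i j k) e) then 1 else 0).
  assert (Hsum : rsum m (fun i => rsum m (fun j => rsum m (fun k =>
    cup3 (sg ax1) (sg ax2) (sg ax3) i j k))) = 1).
  { apply cup3_sum; intros x y Hx Hy; unfold sg.
    - pose proof (Hneg (u 0%nat x y) ax1 (Hu _ _ _ (Nat.le_0_l m) Hx Hy) Hpt0).
      pose proof (Hpos (u m x y) ax1 (Hu _ _ _ (Nat.le_refl m) Hx Hy) Hptm).
      split; destruct Rlt_dec; lra.
    - pose proof (Hneg (u x 0%nat y) ax2 (Hu _ _ _ Hx (Nat.le_0_l m) Hy) Hpt0).
      pose proof (Hpos (u x m y) ax2 (Hu _ _ _ Hx (Nat.le_refl m) Hy) Hptm).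
      split; destruct Rlt_dec; lra.
    - pose proof (Hneg (u x y 0%nat) ax3 (Hu _ _ _ Hx Hy (Nat.le_0_l m)) Hpt0).
      pose proof (Hpos (u x y m) ax3 (Hu _ _ _ Hx Hy (Nat.le_refl m)) Hptm).
      split; destruct Rlt_dec; lra. }
  assert (Hex : exists i j k, (i < m)%nat /\ (j < m)%nat /\ (k < m)%nat /\
    cup3 (sg ax1) (sg ax2) (sg ax3) i j k <> 0).
  { destruct (rsum_nonzero m _ ltac:(rewrite Hsum; lra)) as [i [Hi Hi']].
    destruct (rsum_nonzero _ _ Hi') as [j [Hj Hj']].
    destruct (rsum_nonzero _ _ Hj') as [k [Hk Hk']]. now exists i, j, k. }
  destruct Hex as [i [j [k [Hi [Hj [Hk Hc]]]]]].
  apply cup3_varies in Hc.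
  assert (Hv : forall e, varies (sg e) i j k) by (intros e; destruct e; tauto).
  assert (Hsmall : forall e, Rabs (F (u i j k) e) <= L * d).
  { intros e. destruct (Hv e) as [i' [j' [k' [Hi' [Hj' [Hk' Hne]]]]]].
    pose proof (Hlip (u i' j' k') (u i j k) ltac:(apply Hu; lia) ltac:(apply Hu; lia) e) as HF.
    assert (HD : dist1 (u i' j' k') (u i j k) <= d).
    { unfold dist1, u. simpl.
      pose proof (HptS _ _ Hi'). pose proof (HptS _ _ Hj'). pose proof (HptS _ _ Hk').
      replace (6 * rho / INR m) with (3 * (2 * rho / INR m)) in Hm by (field; lra). lra. }
    (* As [sg e] differs at the two vertices, one value of the component is positive and the other
       is not, so each is bounded by their difference. *)
    apply Rle_trans with (Rabs (F (u i' j' k') e - F (u i j k) e)).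
    - unfold sg in Hne. unfold Rabs. repeat destruct Rcase_abs; repeat destruct Rlt_dec; lra.
    - eapply Rle_trans; [apply HF|]. apply Rmult_le_compat_l; lra. }
  apply (Hd (pt i, (pt j, (pt k, tt)))).
  { repeat split; apply Hpt; lia. }
  intros [[x [y [z []]]] [[Hx [Hy [Hz _]]] [[Hcx [Hcy [Hcz _]]] Hdt]]].
  set (t := (x, (y, (z, tt))) : Compactness.Tn 3 R) in *.
  assert (Ht : in_box rho (tovec t)) by now apply Hbox.
  assert (Hgt : gauge t = size (tovec t) / (8 * L)).
  { unfold gauge. now rewrite Rmax_left by now apply Rlt_le, Hsize0. }
  assert (Hgp : 0 < gauge t).
  { rewrite Hgt. apply Rdiv_lt_0_compat; [now apply Hsize0|lra]. }
  destruct (Rlt_dec 0 (gauge t)) as [_|]; [|easy].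
  assert (Hbig : size (tovec t) <= 4 * L * gauge t).
  { assert (Hall : forall e, Rabs (F (tovec t) e) <= 4 * L * gauge t).
    { intros e.
      pose proof (Hlip (tovec t) (u i j k) Ht ltac:(apply Hu; lia) e) as HF.
      assert (dist1 (tovec t) (u i j k) <= 3 * gauge t).
      { unfold dist1. simpl. rewrite (Rabs_minus_sym x), (Rabs_minus_sym y), (Rabs_minus_sym z). lra. }
      specialize (Hsmall e).
      replace (F (tovec t) e) with ((F (tovec t) e - F (u i j k) e) + F (u i j k) e) by ring.
      eapply Rle_trans; [apply Rabs_triang|]. nra. }
    unfold size. now repeat apply Rmax_lub. }
  rewrite Hgt in Hbig. pose proof (Hsize0 _ Ht).
  replace (4 * L * (size (tovec t) / (8 * L))) with (size (tovec t) / 2) in Hbig by (field; lra).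
  lra.
Qed.

(** * A direction transverse to a closed curve *)

Definition dot (u v : vec) : R := u ax1 * v ax1 + u ax2 * v ax2 + u ax3 * v ax3.

Definition cross (u v : vec) : vec :=
  mkvec (u ax2 * v ax3 - u ax3 * v ax2) (u ax3 * v ax1 - u ax1 * v ax3)
        (u ax1 * v ax2 - u ax2 * v ax1).

Lemma pigeonhole (f : nat -> nat) n N : (n < N)%nat ->
  (forall k, (k < N)%nat -> (f k < n)%nat) ->
  exists k l, (k < N)%nat /\ (l < N)%nat /\ k <> l /\ f k = f l.
Proof.
  intros HnN Hf. apply NNPP. intros Hno.
  assert (HD : List.NoDup (List.map f (List.seq 0 N))).
  { apply List.NoDup_map_NoDup_ForallPairs; [|apply List.seq_NoDup].
    intros k l Hk Hl E. apply List.in_seq in Hk, Hl.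
    destruct (Nat.eq_dec k l) as [|D]; [easy|]. destruct Hno.
    exists k, l. repeat split; auto; lia. }
  apply (List.NoDup_incl_length (l' := List.seq 0 n)) in HD.
  - rewrite List.length_map, !List.length_seq in HD. lia.
  - intros x Hx. apply List.in_map_iff in Hx. destruct Hx as [k [<- Hk]].
    apply List.in_seq in Hk. apply List.in_seq. specialize (Hf k). lia.
Qed.

(* The directions of a Lipschitz curve do not fill a square: [q M] pieces of the
   curve, each too short to meet two of the [M^2] directions (i/M, j/M, 1),
   cannot meet all of these when [q < M]. *)
Lemma transverse_direction (w : R -> vec) p C m : 0 < p -> 0 < C -> 0 < m ->
  (forall i, periodic p (fun x => w x i)) ->
  (forall i x y, Rabs (w x i - w y i) <= C * Rabs (x - y)) ->
  (forall x, m * m <= dot (w x) (w x)) ->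
  exists e, forall x, 0 < dot (cross (w x) e) (cross (w x) e).
Proof.
  intros Hp HC Hm Hper Hlip Hw.
  apply NNPP. intros Hno.
  assert (Hhit : forall a b, exists x, 0 <= x < p /\
    w x ax1 = a * w x ax3 /\ w x ax2 = b * w x ax3).
  { intros a b. apply NNPP. intros H. apply Hno. exists (mkvec a b 1). intros x.
    apply Rnot_le_lt. intros Hle. apply H.
    destruct (reduce_mod p x Hp) as [k Hk]. exists (x - IZR k * p).
    assert (E : forall i, w (x - IZR k * p) i = w x i).
    { intros i. rewrite <- (periodic_Z p _ (Hper i) k (x - IZR k * p)).
      f_equal. f_equal. ring. }
    split; [easy|]. rewrite !E. unfold dot, cross in Hle. simpl in Hle.
    set (w1 := w x ax1) in *. set (w2 := w x ax2) in *. set (w3 := w x ax3) in *.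
    pose proof (Rle_0_sqr (w2 * 1 - w3 * b)). pose proof (Rle_0_sqr (w3 * a - w1 * 1)).
    pose proof (Rle_0_sqr (w1 * b - w2 * a)). unfold Rsqr in *.
    assert (E1 : Rsqr (w3 * a - w1 * 1) = 0) by (unfold Rsqr; lra).
    assert (E2 : Rsqr (w2 * 1 - w3 * b) = 0) by (unfold Rsqr; lra).
    apply Rsqr_0_uniq in E1, E2. split; lra. }
  pose (hit := fun a b => proj1_sig (constructive_indefinite_description _ (Hhit a b))).
  assert (Hhit' : forall a b, 0 <= hit a b < p /\
    w (hit a b) ax1 = a * w (hit a b) ax3 /\ w (hit a b) ax2 = b * w (hit a b) ax3).
  { intros a b. unfold hit. now destruct constructive_indefinite_description. }
  clearbody hit. clear Hhit Hno.
  (* For slopes in [[0,1]] the third coordinate at a hit is at least [m / 2] in absolute value,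
     because three times its square is at least [m * m]. The slopes are therefore Lipschitz in the
     parameter of the hit. *)
  assert (Hsep : forall a b a' b', 0 <= a <= 1 -> 0 <= b <= 1 -> 0 <= a' <= 1 -> 0 <= b' <= 1 ->
    Rabs (a - a') <= 4 * C / m * Rabs (hit a b - hit a' b') /\
    Rabs (b - b') <= 4 * C / m * Rabs (hit a b - hit a' b')).
  { intros a b a' b' Ha Hb Ha' Hb'.
    destruct (Hhit' a b) as [_ [H1 H2]], (Hhit' a' b') as [_ [H1' H2']].
    set (x := hit a b) in *. set (x' := hit a' b') in *.
    pose proof (Hlip ax1 x x') as L1. pose proof (Hlip ax2 x x') as L2.
    pose proof (Hlip ax3 x x') as L3. pose proof (Hw x) as Hwx.
    unfold dot in Hwx. rewrite H1, H2 in Hwx.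
    set (D := Rabs (x - x')) in *. set (w3 := w x ax3) in *. set (w3' := w x' ax3) in *.
    assert (Hw3 : m / 2 <= Rabs w3).
    { apply Rnot_lt_le. intros Hlt.
      assert (Rabs w3 * Rabs w3 < m / 2 * (m / 2)).
      { pose proof (Rabs_pos w3). nra. }
      rewrite <- Rabs_mult, (Rabs_right (w3 * w3)) in H by (apply Rle_ge, Rle_0_sqr).
      assert (a * w3 * (a * w3) <= w3 * w3).
      { assert (0 <= (1 - a * a) * (w3 * w3)) by (apply Rmult_le_pos; [nra|apply Rle_0_sqr]).
        lra. }
      assert (b * w3 * (b * w3) <= w3 * w3).
      { assert (0 <= (1 - b * b) * (w3 * w3)) by (apply Rmult_le_pos; [nra|apply Rle_0_sqr]).
        lra. }
      assert (0 < m * m) by nra. lra. }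
    assert (Key : forall c c' y, 0 <= c' <= 1 ->
      y = c * w3 - c' * w3' -> Rabs y <= C * D -> Rabs (c - c') <= 4 * C / m * D).
    { intros c c' y Hc' Hy HyC.
      assert (E : (c - c') * w3 = y + c' * (w3' - w3)) by (rewrite Hy; ring).
      assert (Hb1 : Rabs (c - c') * Rabs w3 <= 2 * C * D).
      { rewrite <- Rabs_mult, E. eapply Rle_trans; [apply Rabs_triang|].
        rewrite Rabs_mult, (Rabs_right c'), (Rabs_minus_sym w3') by lra.
        pose proof (Rabs_pos (w3 - w3')). nra. }
      replace (4 * C / m * D) with (4 * C * D / m) by (field; lra).
      apply Rle_div_r; [easy|]. pose proof (Rabs_pos (c - c')). nra. }
    split.
    - apply (Key a a' (w x ax1 - w x' ax1)); [easy|now rewrite H1, H1'|easy].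
    - apply (Key b b' (w x ax2 - w x' ax2)); [easy|now rewrite H2, H2'|easy]. }
  assert (HCm : 0 < 4 * C / m) by (apply Rdiv_lt_0_compat; lra).
  (* With [q > 4 * C / m * p], two hits in one piece of length [p / (M * q)] have slopes closer than
     the grid step [1 / M]; and [M = q + 1] makes the directions outnumber the pieces. *)
  destruct (nfloor_ex (4 * C / m * p)) as [q0 [_ Hq]]; [nra|].
  rewrite <- S_INR in Hq. set (q := S q0) in *. set (M := S q).
  assert (HqR : 0 < INR q) by (apply lt_0_INR; unfold q; lia).
  assert (HMR : 0 < INR M) by (apply lt_0_INR; unfold M; lia).
  assert (HnR : 0 < INR (M * q)) by (rewrite mult_INR; nra).
  pose (coord := fun i => INR i / INR M).
  assert (Hco : forall i, (i < M)%nat -> 0 <= coord i <= 1).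
  { intros i Hi. pose proof (pos_INR i). apply lt_INR in Hi.
    split; [now apply Rdiv_le_0_compat|]. apply Rle_div_l; lra. }
  assert (Hco2 : forall i i', (i <> i')%nat -> / INR M <= Rabs (coord i - coord i')).
  { assert (W : forall i i', (i < i')%nat -> / INR M <= Rabs (coord i - coord i')).
    { intros i i' H. assert (H' : (S i <= i')%nat) by lia. apply le_INR in H'.
      rewrite S_INR in H'. rewrite Rabs_minus_sym.
      replace (coord i' - coord i) with ((INR i' - INR i) * / INR M) by (unfold coord; field; lra).
      pose proof (Rinv_0_lt_compat _ HMR). rewrite Rabs_right; nra. }
    intros i i' H. destruct (Nat.lt_ge_cases i i').
    - now apply W.
    - rewrite Rabs_minus_sym. apply W. lia. }
  pose (x := fun k => hit (coord (k / M)%nat) (coord (k mod M)%nat)).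
  pose (piece := fun k => Z.to_nat (Int_part (x k / p * INR (M * q)))).
  assert (Hx : forall k, 0 <= x k / p < 1).
  { intros k. destruct (Hhit' (coord (k / M)%nat) (coord (k mod M)%nat)) as [Hk _].
    fold (x k) in Hk. split; [apply Rdiv_le_0_compat; lra|]. apply Rlt_div_l; lra. }
  assert (Hpiece : forall k, INR (piece k) <= x k / p * INR (M * q) < INR (piece k) + 1).
  { intros k. unfold piece. destruct (base_Int_part (x k / p * INR (M * q))) as [H1 H2].
    specialize (Hx k). set (y := x k / p * INR (M * q)) in *.
    assert (0 <= y) by (unfold y; nra).
    assert (0 <= Int_part y)%Z.
    { apply Z.lt_succ_r. apply lt_IZR. rewrite succ_IZR. lra. }
    rewrite INR_IZR_INZ, Z2Nat.id by easy. lra. }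
  destruct (pigeonhole piece (M * q) (M * M)) as [k [l [Hk [Hl [Hkl E]]]]].
  { apply Nat.mul_lt_mono_pos_l; unfold M; lia. }
  { intros k Hk. apply INR_lt. specialize (Hpiece k). specialize (Hx k). nra. }
  assert (Hclose : Rabs (x k - x l) <= p / INR (M * q)).
  { pose proof (Hpiece k) as H1. pose proof (Hpiece l) as H2. rewrite E in H1.
    replace (x k - x l) with ((x k / p * INR (M * q) - x l / p * INR (M * q)) * (p / INR (M * q)))
      by (field; lra).
    assert (0 < p / INR (M * q)) by (now apply Rdiv_lt_0_compat).
    rewrite Rabs_mult, (Rabs_right (p / INR (M * q))) by lra.
    rewrite <- (Rmult_1_l (p / INR (M * q))) at 2.
    apply Rmult_le_compat_r; [lra|]. apply Rabs_le. lra. }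
  assert (HkM : (k / M < M)%nat /\ (k mod M < M)%nat).
  { split; [apply Nat.Div0.div_lt_upper_bound; lia|apply Nat.mod_upper_bound; unfold M; lia]. }
  assert (HlM : (l / M < M)%nat /\ (l mod M < M)%nat).
  { split; [apply Nat.Div0.div_lt_upper_bound; lia|apply Nat.mod_upper_bound; unfold M; lia]. }
  destruct (Hsep (coord (k / M)%nat) (coord (k mod M)%nat) (coord (l / M)%nat) (coord (l mod M)%nat))
    as [S1 S2]; try (apply Hco; tauto).
  fold (x k) (x l) in S1, S2.
  assert (Hlt : 4 * C / m * Rabs (x k - x l) < / INR M).
  { apply Rle_lt_trans with (4 * C / m * (p / INR (M * q))).
    - apply Rmult_le_compat_l; lra.
    - rewrite mult_INR.
      replace (4 * C / m * (p / (INR M * INR q))) with (4 * C / m * p * / INR q * / INR M)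
        by (field; lra).
      rewrite <- (Rmult_1_l (/ INR M)) at 2. apply Rmult_lt_compat_r.
      + now apply Rinv_0_lt_compat.
      + apply (Rlt_div_l (4 * C / m * p)); lra. }
  destruct (Nat.eq_dec (k / M) (l / M)) as [E1|N1].
  - destruct (Nat.eq_dec (k mod M) (l mod M)) as [E2|N2].
    + apply Hkl. rewrite (Nat.div_mod_eq k M), (Nat.div_mod_eq l M). now rewrite E1, E2.
    + specialize (Hco2 _ _ N2). lra.
  - specialize (Hco2 _ _ N1). lra.
Qed.

(** * Orthonormal frames depending on a parameter *)

Lemma dist1_pos u v : 0 <= dist1 u v.
Proof.
  unfold dist1. pose proof (Rabs_pos (u ax1 - v ax1)).
  pose proof (Rabs_pos (u ax2 - v ax2)). pose proof (Rabs_pos (u ax3 - v ax3)). lra.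
Qed.

(** The Lipschitz condition concerns the parameter [xi], not [x]. Only one period is considered, so
    that the class contains primitives such as the phase, which are not periodic. *)
Definition bounded_lipschitz (rho p : R) (h : vec -> R -> R) : Prop :=
  exists C, 0 < C /\
    (forall xi x, in_box rho xi -> 0 <= x <= p -> Rabs (h xi x) <= C) /\
    (forall xi et x, in_box rho xi -> in_box rho et -> 0 <= x <= p ->
       Rabs (h xi x - h et x) <= C * dist1 xi et).

Lemma bl_fixed rho p (g : R -> R) C :
  (forall x, Rabs (g x) <= C) -> bounded_lipschitz rho p (fun _ => g).
Proof.
  intros H. exists (Rabs C + 1). pose proof (Rabs_pos C). split; [lra|]. split.
  - intros _ x _ _. specialize (H x). pose proof (Rle_abs C). lra.
  - intros xi et x _ _ _. rewrite Rminus_diag, Rabs_R0.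
    pose proof (dist1_pos xi et). nra.
Qed.

Lemma bl_coord rho p i : bounded_lipschitz rho p (fun xi _ => xi i).
Proof.
  exists (Rabs rho + 1). pose proof (Rabs_pos rho). split; [lra|]. split.
  - intros xi x H0 _. specialize (H0 i). pose proof (Rle_abs rho). lra.
  - intros xi et x _ _ _. apply Rle_trans with (dist1 xi et).
    + unfold dist1. pose proof (Rabs_pos (xi ax1 - et ax1)).
      pose proof (Rabs_pos (xi ax2 - et ax2)). pose proof (Rabs_pos (xi ax3 - et ax3)).
      destruct i; lra.
    + pose proof (dist1_pos xi et). nra.
Qed.

Lemma bl_plus rho p h k : bounded_lipschitz rho p h -> bounded_lipschitz rho p k ->
  bounded_lipschitz rho p (fun xi x => h xi x + k xi x).
Proof.
  intros [C [HC [H1 H2]]] [D [HD [K1 K2]]]. exists (C + D). split; [lra|]. split.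
  - intros xi x Hxi Hx. eapply Rle_trans; [apply Rabs_triang|].
    specialize (H1 xi x Hxi Hx). specialize (K1 xi x Hxi Hx). lra.
  - intros xi et x Hxi Het Hx.
    replace (h xi x + k xi x - (h et x + k et x)) with
      ((h xi x - h et x) + (k xi x - k et x)) by ring.
    eapply Rle_trans; [apply Rabs_triang|].
    specialize (H2 xi et x Hxi Het Hx). specialize (K2 xi et x Hxi Het Hx). lra.
Qed.

Lemma bl_mult rho p h k : bounded_lipschitz rho p h -> bounded_lipschitz rho p k ->
  bounded_lipschitz rho p (fun xi x => h xi x * k xi x).
Proof.
  intros [C [HC [H1 H2]]] [D [HD [K1 K2]]]. exists (2 * (C * D)). split; [nra|]. split.
  - intros xi x Hxi Hx. rewrite Rabs_mult.
    specialize (H1 xi x Hxi Hx). specialize (K1 xi x Hxi Hx).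
    apply Rle_trans with (C * D); [|nra].
    apply Rmult_le_compat; try apply Rabs_pos; easy.
  - intros xi et x Hxi Het Hx.
    replace (h xi x * k xi x - h et x * k et x) with
      ((h xi x - h et x) * k xi x + h et x * (k xi x - k et x)) by ring.
    eapply Rle_trans; [apply Rabs_triang|]. rewrite !Rabs_mult.
    specialize (H2 xi et x Hxi Het Hx). specialize (K2 xi et x Hxi Het Hx).
    specialize (H1 et x Het Hx). specialize (K1 xi x Hxi Hx).
    pose proof (dist1_pos xi et) as Hd.
    assert (Rabs (h xi x - h et x) * Rabs (k xi x) <= C * dist1 xi et * D)
      by (apply Rmult_le_compat; try apply Rabs_pos; easy).
    assert (Rabs (h et x) * Rabs (k xi x - k et x) <= C * (D * dist1 xi et))
      by (apply Rmult_le_compat; try apply Rabs_pos; easy).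
    lra.
Qed.

Lemma bl_opp rho p h : bounded_lipschitz rho p h ->
  bounded_lipschitz rho p (fun xi x => - h xi x).
Proof.
  intros [C [HC [H1 H2]]]. exists C. split; [easy|]. split.
  - intros xi x Hxi Hx. rewrite Rabs_Ropp. now apply H1.
  - intros xi et x Hxi Het Hx.
    replace (- h xi x - - h et x) with (- (h xi x - h et x)) by ring.
    rewrite Rabs_Ropp. now apply H2.
Qed.

Lemma bl_inv rho p h m : 0 < m ->
  (forall xi x, in_box rho xi -> 0 <= x <= p -> m <= h xi x) ->
  bounded_lipschitz rho p h -> bounded_lipschitz rho p (fun xi x => / h xi x).
Proof.
  intros Hm Hh [C [HC [H1 H2]]]. pose proof (Rinv_0_lt_compat m Hm) as Him.
  assert (Hi : forall xi x, in_box rho xi -> 0 <= x <= p -> 0 < / h xi x <= / m).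
  { intros xi x Hxi Hx. specialize (Hh xi x Hxi Hx).
    split; [apply Rinv_0_lt_compat; lra|apply Rinv_le_contravar; lra]. }
  exists (/ m + C * / m * / m). split.
  { assert (0 < C * / m * / m) by (repeat apply Rmult_lt_0_compat; easy). lra. }
  split.
  - intros xi x Hxi Hx. specialize (Hi xi x Hxi Hx). rewrite Rabs_right by lra.
    assert (0 < C * / m * / m) by (repeat apply Rmult_lt_0_compat; easy). lra.
  - intros xi et x Hxi Het Hx.
    pose proof (Hi xi x Hxi Hx) as I1. pose proof (Hi et x Het Hx) as I2.
    pose proof (Hh xi x Hxi Hx). pose proof (Hh et x Het Hx).
    replace (/ h xi x - / h et x) with ((h xi x - h et x) * - (/ h xi x * / h et x))
      by (field; lra).
    rewrite Rabs_mult, Rabs_Ropp, (Rabs_right (/ h xi x * / h et x)) by nra.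
    specialize (H2 xi et x Hxi Het Hx). pose proof (dist1_pos xi et).
    apply Rle_trans with (C * dist1 xi et * (/ m * / m)).
    + apply Rmult_le_compat; [apply Rabs_pos|nra|easy|]. apply Rmult_le_compat; lra.
    + assert (0 <= / m * dist1 xi et) by nra. lra.
Qed.

Lemma sqrt_diff_le m x y : 0 < m -> m <= x -> m <= y ->
  Rabs (sqrt x - sqrt y) <= / sqrt m * Rabs (x - y).
Proof.
  intros Hm Hx Hy. pose proof (sqrt_lt_R0 m Hm) as Hs.
  pose proof (sqrt_le_1_alt m x Hx). pose proof (sqrt_le_1_alt m y Hy).
  rewrite <- (sqrt_sqrt x), <- (sqrt_sqrt y) at 2 by lra.
  replace (sqrt x * sqrt x - sqrt y * sqrt y) with ((sqrt x + sqrt y) * (sqrt x - sqrt y)) by ring.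
  rewrite Rabs_mult, (Rabs_right (sqrt x + sqrt y)) by lra.
  rewrite <- Rmult_assoc. rewrite <- (Rmult_1_l (Rabs (sqrt x - sqrt y))) at 1.
  apply Rmult_le_compat_r; [apply Rabs_pos|].
  rewrite Rmult_comm. apply Rle_div_r; lra.
Qed.

Lemma bl_sqrt rho p h m : 0 < m ->
  (forall xi x, in_box rho xi -> 0 <= x <= p -> m <= h xi x) ->
  bounded_lipschitz rho p h -> bounded_lipschitz rho p (fun xi x => sqrt (h xi x)).
Proof.
  intros Hm Hh [C [HC [H1 H2]]]. pose proof (sqrt_lt_R0 m Hm) as Hs.
  pose proof (Rinv_0_lt_compat _ Hs) as His. pose proof (sqrt_lt_R0 C HC) as HsC.
  exists (sqrt C + / sqrt m * C). split; [nra|]. split.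
  - intros xi x Hxi Hx. rewrite Rabs_right by (apply Rle_ge, sqrt_pos).
    apply Rle_trans with (sqrt C); [|nra]. apply sqrt_le_1_alt.
    specialize (H1 xi x Hxi Hx). pose proof (Rle_abs (h xi x)). lra.
  - intros xi et x Hxi Het Hx.
    eapply Rle_trans; [apply (sqrt_diff_le m); auto|].
    specialize (H2 xi et x Hxi Het Hx). pose proof (dist1_pos xi et).
    apply Rle_trans with (/ sqrt m * (C * dist1 xi et)); [now apply Rmult_le_compat_l; [lra|]|].
    assert (0 <= sqrt C * dist1 xi et) by nra. lra.
Qed.

(* [reg_le (S (S n)) alpha] and [Ck (S n)] together express the class
   C^(alpha-1), for infinite [alpha] as well. *)
Definition tame (alpha : regularity) (rho p : R) (h : vec -> R -> R) : Prop :=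
  (exists h', bounded_lipschitz rho p h /\ bounded_lipschitz rho p h' /\
     forall xi x, in_box rho xi -> is_derive (h xi) x (h' xi x)) /\
  (forall n, reg_le (S (S n)) alpha -> forall xi, in_box rho xi -> Ck (S n) (h xi)) /\
  (forall xi, in_box rho xi -> periodic p (h xi)).

Lemma tame_plus alpha rho p h k : tame alpha rho p h -> tame alpha rho p k ->
  tame alpha rho p (fun xi x => h xi x + k xi x).
Proof.
  intros [[h' [H1 [H2 H3]]] [H4 H5]] [[k' [K1 [K2 K3]]] [K4 K5]]. split; [|split].
  - exists (fun xi x => h' xi x + k' xi x). split; [|split].
    + now apply bl_plus.
    + now apply bl_plus.
    + intros xi x Hxi. apply @is_derive_plus; auto.
  - intros n Hn xi Hxi. apply Ck_plus; auto.
  - intros xi Hxi x. now rewrite H5, K5.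
Qed.

Lemma tame_mult alpha rho p h k : tame alpha rho p h -> tame alpha rho p k ->
  tame alpha rho p (fun xi x => h xi x * k xi x).
Proof.
  intros [[h' [H1 [H2 H3]]] [H4 H5]] [[k' [K1 [K2 K3]]] [K4 K5]]. split; [|split].
  - exists (fun xi x => h' xi x * k xi x + h xi x * k' xi x). split; [|split].
    + now apply bl_mult.
    + apply bl_plus; now apply bl_mult.
    + intros xi x Hxi. apply @is_derive_mult; auto. intros; apply Rmult_comm.
  - intros n Hn xi Hxi. apply Ck_mult; auto.
  - intros xi Hxi x. now rewrite H5, K5.
Qed.

Lemma tame_fixed alpha rho p (g g' : R -> R) C :
  (forall x, is_derive g x (g' x)) -> (forall x, Rabs (g x) <= C) ->
  (forall x, Rabs (g' x) <= C) -> periodic p g ->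
  (forall n, reg_le (S (S n)) alpha -> Ck (S n) g) -> tame alpha rho p (fun _ => g).
Proof.
  intros H1 H2 H3 H4 H5. split; [|split]; auto.
  exists (fun _ => g'). split; [|split]; [now apply bl_fixed with C..|]. intros; apply H1.
Qed.

Lemma tame_const alpha rho p c : tame alpha rho p (fun _ _ => c).
Proof.
  apply (tame_fixed alpha rho p (fun _ => c) (fun _ => 0) (Rabs c)).
  - intros x. auto_derive; [easy|ring].
  - intros x. lra.
  - intros x. rewrite Rabs_R0. apply Rabs_pos.
  - easy.
  - intros n _. apply Ck_const.
Qed.

Lemma tame_coord alpha rho p i : tame alpha rho p (fun xi _ => xi i).
Proof.
  split; [|split].
  - exists (fun _ _ => 0). split; [|split].
    + apply bl_coord.
    + apply bl_fixed with 0. intros. rewrite Rabs_R0. lra.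
    + intros. auto_derive; [easy|ring].
  - intros. apply Ck_const.
  - easy.
Qed.

Lemma tame_opp alpha rho p h : tame alpha rho p h -> tame alpha rho p (fun xi x => - h xi x).
Proof.
  intros H. assert (E : (fun xi x => - h xi x) = (fun xi x => -1 * h xi x)).
  { apply functional_extensionality; intros xi. apply functional_extensionality; intros x. ring. }
  rewrite E. apply tame_mult; [apply tame_const|easy].
Qed.

Lemma tame_minus alpha rho p h k : tame alpha rho p h -> tame alpha rho p k ->
  tame alpha rho p (fun xi x => h xi x - k xi x).
Proof. intros H K. apply tame_plus; [easy|now apply tame_opp]. Qed.

Lemma tame_inv alpha rho p h m : 0 < m ->
  (forall xi x, in_box rho xi -> m <= h xi x) ->
  tame alpha rho p h -> tame alpha rho p (fun xi x => / h xi x).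
Proof.
  intros Hm Hh [[h' [H1 [H2 H3]]] [H4 H5]]. split; [|split].
  - exists (fun xi x => - h' xi x * (/ h xi x * / h xi x)).
    assert (Hi : bounded_lipschitz rho p (fun xi x => / h xi x)) by (apply bl_inv with m; auto).
    split; [|split].
    + easy.
    + apply bl_mult; [now apply bl_opp|now apply bl_mult].
    + intros xi x Hxi. specialize (Hh xi x Hxi).
      replace (- h' xi x * (/ h xi x * / h xi x)) with (- h' xi x / h xi x ^ 2) by (field; lra).
      apply is_derive_inv; [now apply H3|lra].
  - intros n Hn xi Hxi. apply Ck_inv; auto. intros x. specialize (Hh xi x Hxi). lra.
  - intros xi Hxi x. now rewrite H5.
Qed.

Lemma tame_sqrt alpha rho p h m : 0 < m ->
  (forall xi x, in_box rho xi -> m <= h xi x) ->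
  tame alpha rho p h -> tame alpha rho p (fun xi x => sqrt (h xi x)).
Proof.
  intros Hm Hh [[h' [H1 [H2 H3]]] [H4 H5]].
  pose proof (sqrt_lt_R0 m Hm) as Hs. split; [|split].
  - exists (fun xi x => h' xi x * / (2 * sqrt (h xi x))).
    assert (Hq : bounded_lipschitz rho p (fun xi x => sqrt (h xi x))) by (apply bl_sqrt with m; auto).
    split; [|split].
    + easy.
    + apply bl_mult; [easy|]. apply bl_inv with (2 * sqrt m); [lra| |].
      * intros xi x Hxi Hx. pose proof (sqrt_le_1_alt _ _ (Hh xi x Hxi)). lra.
      * apply bl_mult; [|easy]. apply bl_fixed with 2. intros _. rewrite Rabs_right; lra.
    + intros xi x Hxi. apply is_derive_sqrt; [now apply H3|]. specialize (Hh xi x Hxi). lra.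
  - intros n Hn xi Hxi. apply Ck_sqrt; auto. intros x. specialize (Hh xi x Hxi). lra.
  - intros xi Hxi x. now rewrite H5.
Qed.

Lemma tame_dot alpha rho p (V W : vec -> R -> vec) :
  (forall i, tame alpha rho p (fun xi x => V xi x i)) ->
  (forall i, tame alpha rho p (fun xi x => W xi x i)) ->
  tame alpha rho p (fun xi x => dot (V xi x) (W xi x)).
Proof.
  intros HV HW. unfold dot.
  repeat apply tame_plus; apply (tame_mult _ _ _ (fun xi x => V xi x _)); auto.
Qed.

Lemma tame_cross alpha rho p (V W : vec -> R -> vec) :
  (forall i, tame alpha rho p (fun xi x => V xi x i)) ->
  (forall i, tame alpha rho p (fun xi x => W xi x i)) ->
  forall i, tame alpha rho p (fun xi x => cross (V xi x) (W xi x) i).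
Proof.
  intros HV HW i.
  destruct i; unfold cross; simpl; apply tame_minus;
    apply (tame_mult _ _ _ (fun xi x => V xi x _)); auto.
Qed.

(** For $0<|v|<1$ the plane through $v$ orthogonal to $v$ cuts the unit sphere in a circle of this
    radius. [frame_a] and [frame_b] are orthogonal radius vectors of that circle, built from
    $v\times e$ and thus defined when $v$ is not parallel to $e$. *)
Definition frame_r (v : vec) : R := sqrt (1 - dot v v).

Definition frame_a (e v : vec) : vec :=
  fun i => frame_r v * (cross v e i * / sqrt (dot (cross v e) (cross v e))).

Definition frame_b (e v : vec) : vec :=
  fun i => cross v (frame_a e v) i * / sqrt (dot v v).

(** Lagrange's identity, which also gives the Cauchy-Schwarz inequality below. *)
Lemma dot_cross_self u v : dot (cross u v) (cross u v) = dot u u * dot v v - dot u v * dot u v.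
Proof. unfold dot, cross. simpl. ring. Qed.

Lemma dot_pos u : 0 <= dot u u.
Proof.
  unfold dot. pose proof (Rle_0_sqr (u ax1)). pose proof (Rle_0_sqr (u ax2)).
  pose proof (Rle_0_sqr (u ax3)). unfold Rsqr in *. lra.
Qed.

Lemma frame_orthogonal e v : 0 < dot v v <= 1 -> 0 < dot (cross v e) (cross v e) ->
  frame_r v * frame_r v = 1 - dot v v /\
  dot (frame_a e v) (frame_a e v) = frame_r v * frame_r v /\
  dot (frame_b e v) (frame_b e v) = frame_r v * frame_r v /\
  dot v (frame_a e v) = 0 /\ dot v (frame_b e v) = 0 /\ dot (frame_a e v) (frame_b e v) = 0.
Proof.
  intros [Hv Hv1] Hc.
  assert (Hr : frame_r v * frame_r v = 1 - dot v v) by (apply sqrt_sqrt; lra).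
  assert (Haa : dot (frame_a e v) (frame_a e v) = frame_r v * frame_r v).
  { unfold frame_a. pose proof (sqrt_lt_R0 _ Hc) as Hs. pose proof (sqrt_sqrt _ (Rlt_le _ _ Hc)) as Hss.
    set (q := sqrt (dot (cross v e) (cross v e))) in *.
    transitivity (frame_r v * frame_r v * (dot (cross v e) (cross v e) * (/ q * / q))).
    - unfold dot. ring.
    - rewrite <- Hss. field. lra. }
  assert (Hva : dot v (frame_a e v) = 0).
  { unfold frame_a. transitivity (dot v (cross v e) *
      (frame_r v * / sqrt (dot (cross v e) (cross v e)))).
    - unfold dot. ring.
    - unfold dot, cross. simpl. ring. }
  pose proof (sqrt_lt_R0 _ Hv) as Hs. pose proof (sqrt_sqrt _ (Rlt_le _ _ Hv)) as Hss.
  repeat split; auto.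
  - unfold frame_b. set (a := frame_a e v) in *.
    transitivity (dot (cross v a) (cross v a) * (/ sqrt (dot v v) * / sqrt (dot v v))).
    + unfold dot. ring.
    + rewrite dot_cross_self, Hva, Haa, <- Hss at 1. field. lra.
  - unfold frame_b. set (a := frame_a e v) in *.
    transitivity (dot v (cross v a) * / sqrt (dot v v)); unfold dot, cross; simpl; ring.
  - unfold frame_b. set (a := frame_a e v) in *.
    transitivity (dot a (cross v a) * / sqrt (dot v v)); unfold dot, cross; simpl; ring.
Qed.

(** Half of $|u+2w|^2\geq 0$, rearranged. *)
Lemma half_dot_le u w : dot u u / 2 - dot w w <= dot (fun i => u i + w i) (fun i => u i + w i).
Proof.
  assert (Rsqr (u ax1 + 2 * w ax1) + Rsqr (u ax2 + 2 * w ax2) + Rsqr (u ax3 + 2 * w ax3) >= 0).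
  { pose proof (Rle_0_sqr (u ax1 + 2 * w ax1)). pose proof (Rle_0_sqr (u ax2 + 2 * w ax2)).
    pose proof (Rle_0_sqr (u ax3 + 2 * w ax3)). lra. }
  unfold dot, Rsqr in *. lra.
Qed.

Lemma dot_plus_le u w : dot (fun i => u i + w i) (fun i => u i + w i) <= 2 * dot u u + 2 * dot w w.
Proof.
  assert (Rsqr (u ax1 - w ax1) + Rsqr (u ax2 - w ax2) + Rsqr (u ax3 - w ax3) >= 0).
  { pose proof (Rle_0_sqr (u ax1 - w ax1)). pose proof (Rle_0_sqr (u ax2 - w ax2)).
    pose proof (Rle_0_sqr (u ax3 - w ax3)). lra. }
  unfold dot, Rsqr in *. lra.
Qed.

Lemma dot_box rho xi : in_box rho xi -> dot xi xi <= 3 * (rho * rho).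
Proof.
  intros H. assert (Hi : forall i, xi i * xi i <= rho * rho).
  { intros i. specialize (H i). pose proof (Rabs_pos (xi i)).
    rewrite <- (Rabs_right (xi i * xi i)), Rabs_mult by (apply Rle_ge, Rle_0_sqr).
    apply Rmult_le_compat; easy. }
  unfold dot. pose proof (Hi ax1). pose proof (Hi ax2). pose proof (Hi ax3). lra.
Qed.

Lemma small_square m : 0 < m -> exists r, 0 < r /\ forall s, 0 < s <= r -> s * s <= m.
Proof.
  intros Hm. exists (Rmin 1 m). split; [apply Rmin_pos; lra|].
  intros s Hs. pose proof (Rmin_l 1 m). pose proof (Rmin_r 1 m). nra.
Qed.

(** Giving up a factor 2 removes the mixed terms in $w$ and $\xi$ and leaves errors of order
    [rho * rho], which take the rest of the margin. *)
Lemma frame_nondegenerate (w : R -> vec) e m : 0 < m ->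
  (forall x, m <= dot (w x) (w x) <= 1 / 4) ->
  (forall x, m <= dot (cross (w x) e) (cross (w x) e)) ->
  exists rho0, 0 < rho0 /\ forall rho, 0 < rho <= rho0 -> forall xi x, in_box rho xi ->
    let v := fun i => w x i + xi i in
    m / 4 <= dot v v <= 3 / 4 /\ m / 4 <= dot (cross v e) (cross v e).
Proof.
  intros Hm Hw Hc.
  (* With $q=\rho^2$ and $|\xi|^2\leq 3q$, the summands ensure in turn $6q\leq 1/4$, $3q\leq m/4$
     and $3q|e|^2\leq m/4$. *)
  assert (HB : 0 < 24 + 12 / m + 12 * dot e e / m).
  { pose proof (dot_pos e). pose proof (Rinv_0_lt_compat m Hm). unfold Rdiv.
    assert (0 <= 12 * dot e e * / m) by nra. nra. }
  destruct (small_square (/ (24 + 12 / m + 12 * dot e e / m))) as [rho0 [H0 Hs]].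
  { now apply Rinv_0_lt_compat. }
  exists rho0. split; [easy|]. intros rho Hrho xi x Hxi v.
  specialize (Hs rho Hrho). set (q := rho * rho) in *.
  assert (Hq0 : 0 < q) by (unfold q; nra).
  assert (Hq : q * (24 + 12 / m + 12 * dot e e / m) <= 1).
  { replace 1 with (/ (24 + 12 / m + 12 * dot e e / m) * (24 + 12 / m + 12 * dot e e / m))
      by (field; split; [lra|]; intros E; replace (24 + 12 / m + 12 * dot e e / m) with
       ((24 * m + 12 + 12 * dot e e) / m) in HB by (field; lra); rewrite E in HB; unfold Rdiv in HB; lra).
    apply Rmult_le_compat_r; lra. }
  pose proof (dot_pos e) as He.
  assert (Hq' : q * (24 * m + 12 + 12 * dot e e) <= m).
  { replace (q * (24 * m + 12 + 12 * dot e e)) with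
      (q * (24 + 12 / m + 12 * dot e e / m) * m) by (field; lra). nra. }
  assert (A1 : 0 <= q * m) by nra. assert (A2 : 0 <= q * dot e e) by nra.
  assert (A3 : q * 24 <= 1) by (apply Rmult_le_reg_r with m; lra).
  pose proof (dot_box _ _ Hxi) as Hxx. fold q in Hxx.
  specialize (Hw x). specialize (Hc x).
  pose proof (half_dot_le (w x) xi) as L. pose proof (dot_plus_le (w x) xi) as U. fold v in L, U.
  split; [split; lra|].
  pose proof (half_dot_le (cross (w x) e) (cross xi e)) as Lc.
  assert (Ec : dot (fun i => cross (w x) e i + cross xi e i) (fun i => cross (w x) e i + cross xi e i)
    = dot (cross v e) (cross v e)) by (unfold v, dot, cross; simpl; ring).
  rewrite Ec in Lc.
  assert (dot (cross xi e) (cross xi e) <= 3 * q * dot e e).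
  { rewrite dot_cross_self. pose proof (Rle_0_sqr (dot xi e)). unfold Rsqr in *. nra. }
  lra.
Qed.

Lemma frame_tame alpha rho p e m (V : vec -> R -> vec) : 0 < m ->
  (forall i, tame alpha rho p (fun xi x => V xi x i)) ->
  (forall xi x, in_box rho xi ->
    m <= dot (V xi x) (V xi x) <= 1 - m /\ m <= dot (cross (V xi x) e) (cross (V xi x) e)) ->
  tame alpha rho p (fun xi x => frame_r (V xi x)) /\
  (forall i, tame alpha rho p (fun xi x => frame_a e (V xi x) i)) /\
  (forall i, tame alpha rho p (fun xi x => frame_b e (V xi x) i)).
Proof.
  intros Hm HV Hb. pose proof (sqrt_lt_R0 m Hm) as Hs.
  assert (Hcr : forall i, tame alpha rho p (fun xi x => cross (V xi x) e i)).
  { apply (tame_cross alpha rho p V (fun _ _ => e)); [easy|]. intros. apply tame_const. }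
  assert (Hr : tame alpha rho p (fun xi x => frame_r (V xi x))).
  { apply tame_sqrt with m; [easy| |].
    - intros xi x Hxi. destruct (Hb xi x Hxi). lra.
    - apply tame_minus; [apply tame_const|]. now apply tame_dot. }
  assert (Ha : forall i, tame alpha rho p (fun xi x => frame_a e (V xi x) i)).
  { intros i. unfold frame_a. apply tame_mult; [easy|].
    apply (tame_mult _ _ _ (fun xi x => cross (V xi x) e i)); [easy|].
    apply tame_inv with (sqrt m); [easy| |].
    - intros xi x Hxi. apply sqrt_le_1_alt. now apply Hb.
    - apply tame_sqrt with m; [easy| |].
      + intros xi x Hxi. now apply Hb.
      + now apply (tame_dot _ _ _ (fun xi x => cross (V xi x) e)). }
  split; [easy|]. split; [easy|].
  intros i. unfold frame_b.
  apply (tame_mult _ _ _ (fun xi x => cross (V xi x) (frame_a e (V xi x)) i)).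
  - now apply (tame_cross _ _ _ V (fun xi x => frame_a e (V xi x))).
  - apply tame_inv with (sqrt m); [easy| |].
    + intros xi x Hxi. apply sqrt_le_1_alt. now apply Hb.
    + apply tame_sqrt with m; [easy| |].
      * intros xi x Hxi. now apply Hb.
      * now apply tame_dot.
Qed.

(** * Winding around a spherical curve *)

Lemma Derive_periodic p h : periodic p h -> periodic p (Derive h).
Proof.
  intros H x. unfold Derive. f_equal. apply Lim_ext. intros y.
  rewrite H. now replace (x + p + y) with (x + y + p) by ring; rewrite H.
Qed.

(** Periodicity extends the bounds from one period to the whole line, still uniformly in [xi]. *)
Lemma tame_Derive alpha rho p h : 0 < p -> tame alpha rho p h ->
  bounded_lipschitz rho p h /\ bounded_lipschitz rho p (fun xi => Derive (h xi)) /\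
  (forall xi x, in_box rho xi -> is_derive (h xi) x (Derive (h xi) x)) /\
  exists C, 0 < C /\ forall xi x, in_box rho xi ->
    Rabs (h xi x) <= C /\ Rabs (Derive (h xi) x) <= C.
Proof.
  intros Hp [[h' [H1 [H2 H3]]] [_ H4]].
  assert (E : forall xi x, in_box rho xi -> Derive (h xi) x = h' xi x)
    by (intros; now apply is_derive_unique, H3).
  assert (HD : bounded_lipschitz rho p (fun xi => Derive (h xi))).
  { destruct H2 as [C [HC [B1 B2]]]. exists C. split; [easy|]. split.
    - intros. rewrite E by easy. auto.
    - intros. rewrite !E by easy. auto. }
  split; [easy|]. split; [easy|]. split.
  { intros. rewrite E by easy. now apply H3. }
  destruct H1 as [C [HC [B1 _]]], HD as [D [HD [B2 _]]].
  exists (C + D). split; [lra|]. intros xi x Hxi. split.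
  - apply (periodic_forall p (h xi) (fun y => Rabs y <= C + D)); auto.
    intros y Hy. specialize (B1 xi y Hxi Hy). lra.
  - apply (periodic_forall p (Derive (h xi)) (fun y => Rabs y <= C + D)); auto.
    + now apply Derive_periodic, H4.
    + intros y Hy. specialize (B2 xi y Hxi Hy). lra.
Qed.

Definition nrm (u : vec) : R := sqrt (dot u u).

Lemma nrm_pos u : 0 <= nrm u.
Proof. apply sqrt_pos. Qed.

Lemma nrm_sqr u : nrm u * nrm u = dot u u.
Proof. apply sqrt_sqrt, dot_pos. Qed.

Lemma dot_le_nrm u v : Rabs (dot u v) <= nrm u * nrm v.
Proof.
  apply Rsqr_incr_0_var; [|apply Rmult_le_pos; apply nrm_pos].
  rewrite <- Rsqr_abs. unfold Rsqr.
  replace (nrm u * nrm v * (nrm u * nrm v)) with (nrm u * nrm u * (nrm v * nrm v)) by ring.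
  rewrite !nrm_sqr. pose proof (dot_pos (cross u v)) as H. rewrite dot_cross_self in H. lra.
Qed.

Lemma nrm_plus_close u v : Rabs (nrm (fun i => u i + v i) - nrm v) <= nrm u.
Proof.
  assert (E : nrm (fun i => u i + v i) * nrm (fun i => u i + v i) =
    nrm u * nrm u + 2 * dot u v + nrm v * nrm v).
  { rewrite !nrm_sqr. unfold dot. ring. }
  pose proof (dot_le_nrm u v) as H. apply Rabs_le_between in H.
  pose proof (nrm_pos u). pose proof (nrm_pos v). pose proof (nrm_pos (fun i => u i + v i)).
  set (z := nrm (fun i => u i + v i)) in *. apply Rabs_le. split; nra.
Qed.

(** The factor 2 stands for $\sqrt 3$. *)
Lemma nrm_le_coords u C : (forall i, Rabs (u i) <= C) -> nrm u <= 2 * C.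
Proof.
  intros H. assert (HC : 0 <= C) by (pose proof (Rabs_pos (u ax1)); specialize (H ax1); lra).
  apply Rsqr_incr_0_var; [|lra]. unfold Rsqr. rewrite nrm_sqr.
  pose proof (dot_box C u H). nra.
Qed.

Lemma coord_le_nrm u i : Rabs (u i) <= nrm u.
Proof.
  apply Rsqr_incr_0_var; [|apply nrm_pos]. rewrite <- Rsqr_abs. unfold Rsqr. rewrite nrm_sqr.
  unfold dot. pose proof (Rle_0_sqr (u ax1)). pose proof (Rle_0_sqr (u ax2)).
  pose proof (Rle_0_sqr (u ax3)). unfold Rsqr in *. destruct i; lra.
Qed.

(** What the winding needs to know of the centre [v], the radius vectors [a], [b] and the radius
    [r], with constants uniform over the box. [C1] bounds the part of the velocity of the spherical
    curve that does not grow with the number of turns. Regularity is encoded as in [tame], with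
    [kappa] one order lower, of class $C^{\alpha-2}$. *)
Record wiggle_data (alpha : regularity) (rho p r0 k0 k1 : R) (v a b : vec -> R -> vec)
    (r : vec -> R -> R) (kappa : R -> R) (C1 : R) : Prop := {
  wd_p : 0 < p;
  wd_r0 : 0 < r0;
  wd_k0 : 0 < k0;
  wd_C1 : 0 < C1;
  wd_v : forall i, tame alpha rho p (fun xi x => v xi x i);
  wd_a : forall i, tame alpha rho p (fun xi x => a xi x i);
  wd_b : forall i, tame alpha rho p (fun xi x => b xi x i);
  wd_r : tame alpha rho p r;
  wd_r_bounds : forall xi x, in_box rho xi -> r0 <= r xi x <= 1;
  wd_frame : forall xi x, in_box rho xi ->
    r xi x * r xi x = 1 - dot (v xi x) (v xi x) /\
    dot (a xi x) (a xi x) = r xi x * r xi x /\ dot (b xi x) (b xi x) = r xi x * r xi x /\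
    dot (v xi x) (a xi x) = 0 /\ dot (v xi x) (b xi x) = 0 /\ dot (a xi x) (b xi x) = 0;
  wd_kappa : forall x, continuous kappa x;
  wd_kappa_per : periodic p kappa;
  wd_kappa_bounds : forall x, k0 <= kappa x <= k1;
  wd_kappa_Ck : forall n, reg_le (S (S n)) alpha -> Ck n kappa;
  wd_slow : forall xi x i, in_box rho xi ->
    Rabs (Derive (fun x => v xi x i) x) + Rabs (Derive (fun x => a xi x i) x)
    + Rabs (Derive (fun x => b xi x i) x) <= C1
}.
Arguments wd_p {alpha rho p r0 k0 k1 v a b r kappa C1}.
Arguments wd_r0 {alpha rho p r0 k0 k1 v a b r kappa C1}.
Arguments wd_k0 {alpha rho p r0 k0 k1 v a b r kappa C1}.
Arguments wd_C1 {alpha rho p r0 k0 k1 v a b r kappa C1}.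
Arguments wd_v {alpha rho p r0 k0 k1 v a b r kappa C1}.
Arguments wd_a {alpha rho p r0 k0 k1 v a b r kappa C1}.
Arguments wd_b {alpha rho p r0 k0 k1 v a b r kappa C1}.
Arguments wd_r {alpha rho p r0 k0 k1 v a b r kappa C1}.
Arguments wd_r_bounds {alpha rho p r0 k0 k1 v a b r kappa C1}.
Arguments wd_frame {alpha rho p r0 k0 k1 v a b r kappa C1}.
Arguments wd_kappa {alpha rho p r0 k0 k1 v a b r kappa C1}.
Arguments wd_kappa_per {alpha rho p r0 k0 k1 v a b r kappa C1}.
Arguments wd_kappa_bounds {alpha rho p r0 k0 k1 v a b r kappa C1}.
Arguments wd_kappa_Ck {alpha rho p r0 k0 k1 v a b r kappa C1}.
Arguments wd_slow {alpha rho p r0 k0 k1 v a b r kappa C1}.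

Section Wiggle.

Context {alpha : regularity} {rho p r0 k0 k1 : R} {v a b : vec -> R -> vec}
  {r : vec -> R -> R} {kappa : R -> R} {C1 : R}.
Hypothesis W : wiggle_data alpha rho p r0 k0 k1 v a b r kappa C1.

Let K := prim kappa.
Let A (xi : vec) := prim (fun x => kappa x * / r xi x).

(* The fast part of the derivative of [Gam] has norm [r Phi' = beta kappa], which
   explains the rate [kappa / r] of the phase. [ratio] will be the speed of the
   knot, and [T] its unit tangent. *)
Definition beta (N : nat) (xi : vec) : R := 2 * PI * INR N / A xi p.
Definition Phi (N : nat) (xi : vec) (x : R) : R := beta N xi * A xi x.
Definition Gam (N : nat) (xi : vec) (x : R) : vec :=
  fun i => v xi x i + cos (Phi N xi x) * a xi x i + sin (Phi N xi x) * b xi x i.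
Definition slow (N : nat) (xi : vec) (x : R) : vec :=
  fun i => Derive (fun x => v xi x i) x + cos (Phi N xi x) * Derive (fun x => a xi x i) x
    + sin (Phi N xi x) * Derive (fun x => b xi x i) x.
Definition fast (N : nat) (xi : vec) (x : R) : vec :=
  fun i => beta N xi * (kappa x * / r xi x) *
    (cos (Phi N xi x) * b xi x i - sin (Phi N xi x) * a xi x i).
Definition dGam (N : nat) (xi : vec) (x : R) : vec :=
  fun i => slow N xi x i + fast N xi x i.
Definition speed (N : nat) (xi : vec) (x : R) : R := nrm (dGam N xi x).
Definition arclen (N : nat) (xi : vec) : R -> R := prim (speed N xi).
Definition ratio (N : nat) (xi : vec) : R := arclen N xi p / K p.
(** Arc length becomes [ratio * K], so the speed becomes [ratio * kappa]; the value of [ratio] makes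
    [theta] fix both ends of the period. *)
Definition theta (N : nat) (xi : vec) (x : R) : R := inverse (arclen N xi) (ratio N xi * K x).
Definition T (N : nat) (xi : vec) (x : R) : vec := Gam N xi (theta N xi x).

Lemma K_derive x : is_derive K x (kappa x).
Proof. apply is_derive_prim, W. Qed.

Lemma K_p_pos : 0 < K p.
Proof.
  pose proof (derive_lower_bound K kappa k0 0 p (Rlt_le _ _ (wd_p W)) K_derive) as H.
  unfold K in H. rewrite prim_0 in H. fold K in H.
  pose proof (wd_p W). pose proof (wd_k0 W).
  assert (Hk : forall z, k0 <= kappa z) by (intros; apply W).
  specialize (H Hk). nra.
Qed.

Lemma K_range x : 0 <= x <= p -> 0 <= K x <= K p.
Proof.
  intros Hx. assert (Hk : forall z, 0 <= kappa z).
  { intros z. pose proof (wd_kappa_bounds W z).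
    pose proof (wd_k0 W). lra. }
  pose proof (derive_lower_bound K kappa 0 0 x ltac:(lra) K_derive Hk) as H.
  pose proof (derive_lower_bound K kappa 0 x p ltac:(lra) K_derive Hk) as H'.
  unfold K in *. rewrite prim_0 in H. lra.
Qed.

Lemma K_periodic x : K (x + p) = K x + K p.
Proof. apply prim_periodic; apply W. Qed.

Lemma tame_continuous h xi : tame alpha rho p h -> in_box rho xi ->
  forall x, continuous (h xi) x.
Proof.
  intros [[h' [_ [_ H]]] _] Hxi x.
  apply (ex_derive_continuous (K := R_AbsRing) (V := R_NormedModule)).
  exists (h' xi x). now apply H.
Qed.

Lemma rate_continuous xi : in_box rho xi -> forall x, continuous (fun x => kappa x * / r xi x) x.
Proof.
  intros Hxi x. apply (continuous_mult (K := R_AbsRing)); [apply W|].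
  apply (continuous_comp (r xi) Rinv); [apply tame_continuous; [apply W|easy]|].
  apply continuous_Rinv. pose proof (wd_r_bounds W xi x Hxi).
  pose proof (wd_r0 W). lra.
Qed.

Lemma A_derive xi x : in_box rho xi -> is_derive (A xi) x (kappa x * / r xi x).
Proof. intros Hxi. apply (is_derive_prim _ (rate_continuous xi Hxi)). Qed.

Lemma inv_r_bounds xi x : in_box rho xi -> 1 <= / r xi x <= / r0.
Proof.
  intros Hxi. pose proof (wd_r_bounds W xi x Hxi).
  pose proof (wd_r0 W). split.
  - rewrite <- Rinv_1. apply Rinv_le_contravar; lra.
  - apply Rinv_le_contravar; lra.
Qed.

Lemma kappa_pos x : 0 < kappa x.
Proof.
  pose proof (wd_kappa_bounds W x).
  pose proof (wd_k0 W). lra.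
Qed.

Lemma A_p_bounds xi : in_box rho xi -> K p <= A xi p <= K p * / r0.
Proof.
  intros Hxi. pose proof (wd_p W) as Hp. split.
  - assert (H : 0 * (p - 0) <= (A xi p - K p) - (A xi 0 - K 0)).
    { apply (derive_lower_bound (fun x => A xi x - K x) (fun x => kappa x * / r xi x - kappa x)).
      - lra.
      - intros z. apply @is_derive_minus; [now apply A_derive|apply K_derive].
      - intros z. pose proof (inv_r_bounds xi z Hxi). pose proof (kappa_pos z). nra. }
    unfold A, K in *. rewrite !prim_0 in H. lra.
  - assert (H : 0 * (p - 0) <= (/ r0 * K p - A xi p) - (/ r0 * K 0 - A xi 0)).
    { apply (derive_lower_bound (fun x => / r0 * K x - A xi x) (fun x => / r0 * kappa x - kappa x * / r xi x)).
      - lra.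
      - intros z. apply @is_derive_minus; [apply is_derive_scal, K_derive|now apply A_derive].
      - intros z. pose proof (inv_r_bounds xi z Hxi). pose proof (kappa_pos z). nra. }
    unfold A, K in *. rewrite !prim_0 in H. lra.
Qed.

Lemma A_periodic xi x : in_box rho xi -> A xi (x + p) = A xi x + A xi p.
Proof.
  intros Hxi. apply prim_periodic.
  - intros y. rewrite (wd_kappa_per W).
    destruct (wd_r W) as [_ [_ Hr]]. now rewrite Hr.
  - now apply rate_continuous.
Qed.

(** A lower bound for [beta N xi / INR N] that is uniform in [xi]. *)
Definition beta0 : R := 2 * PI * r0 / K p.

Lemma beta0_pos : 0 < beta0.
Proof.
  unfold beta0. pose proof PI_RGT_0. pose proof (wd_r0 W).
  apply Rdiv_lt_0_compat; [nra|apply K_p_pos].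
Qed.

Lemma beta_lower N xi : in_box rho xi -> INR N * beta0 <= beta N xi.
Proof.
  intros Hxi. unfold beta, beta0. pose proof (A_p_bounds xi Hxi) as [H1 H2].
  pose proof K_p_pos as HK. pose proof (wd_r0 W) as Hr.
  pose proof PI_RGT_0 as HP. pose proof (pos_INR N) as HN.
  assert (I : r0 / K p <= / A xi p).
  { replace (r0 / K p) with (/ (K p * / r0)) by (field; lra).
    apply Rinv_le_contravar; lra. }
  replace (INR N * (2 * PI * r0 / K p)) with (2 * PI * INR N * (r0 / K p)) by (field; lra).
  unfold Rdiv at 2. apply Rmult_le_compat_l; [nra|easy].
Qed.

Lemma Phi_derive N xi x : in_box rho xi ->
  is_derive (Phi N xi) x (beta N xi * (kappa x * / r xi x)).
Proof. intros Hxi. apply is_derive_scal. now apply A_derive. Qed.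

Lemma Phi_periodic N xi x : in_box rho xi -> Phi N xi (x + p) = Phi N xi x + 2 * INR N * PI.
Proof.
  intros Hxi. unfold Phi. rewrite A_periodic by easy. unfold beta.
  pose proof (A_p_bounds xi Hxi). pose proof K_p_pos. field. lra.
Qed.

Lemma Gam_derive N xi x i : in_box rho xi ->
  is_derive (fun x => Gam N xi x i) x (dGam N xi x i).
Proof.
  intros Hxi.
  pose proof (wd_p W) as Hp.
  destruct (tame_Derive _ _ _ _ Hp (wd_v W i)) as [_ [_ [Hv _]]].
  destruct (tame_Derive _ _ _ _ Hp (wd_a W i)) as [_ [_ [Ha _]]].
  destruct (tame_Derive _ _ _ _ Hp (wd_b W i)) as [_ [_ [Hb _]]].
  specialize (Hv xi x Hxi). specialize (Ha xi x Hxi). specialize (Hb xi x Hxi).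
  pose proof (Phi_derive N xi x Hxi) as HPhi.
  set (q := beta N xi * (kappa x * / r xi x)) in *.
  replace (dGam N xi x i) with
    (Derive (fun x => v xi x i) x
     + (q * - sin (Phi N xi x) * a xi x i + cos (Phi N xi x) * Derive (fun x => a xi x i) x)
     + (q * cos (Phi N xi x) * b xi x i + sin (Phi N xi x) * Derive (fun x => b xi x i) x))
    by (unfold dGam, slow, fast; fold q; ring).
  apply @is_derive_plus; [apply @is_derive_plus; [easy|]|].
  - apply (is_derive_mult (fun x => cos (Phi N xi x)) (fun x => a xi x i)); auto;
      [|intros; apply Rmult_comm].
    apply (is_derive_comp cos (Phi N xi)); [apply is_derive_cos|easy].
  - apply (is_derive_mult (fun x => sin (Phi N xi x)) (fun x => b xi x i)); auto;
      [|intros; apply Rmult_comm].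
    apply (is_derive_comp sin (Phi N xi)); [apply is_derive_sin|easy].
Qed.

Lemma Gam_periodic N xi x i : in_box rho xi -> Gam N xi (x + p) i = Gam N xi x i.
Proof.
  intros Hxi. unfold Gam. rewrite Phi_periodic, cos_period, sin_period by easy.
  destruct (wd_v W i) as [_ [_ Hv]].
  destruct (wd_a W i) as [_ [_ Ha]].
  destruct (wd_b W i) as [_ [_ Hb]].
  now rewrite (Hv xi Hxi), (Ha xi Hxi), (Hb xi Hxi).
Qed.

Lemma sin_cos_squares x : sin x * sin x + cos x * cos x = 1.
Proof. apply sin2_cos2. Qed.

Lemma Gam_unit N xi x : in_box rho xi -> dot (Gam N xi x) (Gam N xi x) = 1.
Proof.
  intros Hxi. destruct (wd_frame W xi x Hxi)
    as [H1 [H2 [H3 [H4 [H5 H6]]]]].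
  pose proof (sin_cos_squares (Phi N xi x)) as Hsc. unfold Gam.
  set (s := sin (Phi N xi x)) in *. set (c := cos (Phi N xi x)) in *.
  transitivity (dot (v xi x) (v xi x) + c * c * dot (a xi x) (a xi x) + s * s * dot (b xi x) (b xi x)
    + 2 * (c * dot (v xi x) (a xi x) + s * dot (v xi x) (b xi x) + c * s * dot (a xi x) (b xi x))).
  - unfold dot. ring.
  - rewrite H4, H5, H6, H2, H3, H1.
    transitivity (dot (v xi x) (v xi x) + (s * s + c * c) * (1 - dot (v xi x) (v xi x))); [ring|].
    rewrite Hsc. ring.
Qed.

(** The circle lies in a plane orthogonal to [v]. This is the source of the positive component of
    the tangent along the derivative of the original knot. *)
Lemma Gam_dot_v N xi x : in_box rho xi -> dot (Gam N xi x) (v xi x) = dot (v xi x) (v xi x).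
Proof.
  intros Hxi. destruct (wd_frame W xi x Hxi)
    as [_ [_ [_ [H4 [H5 _]]]]]. unfold Gam.
  transitivity (dot (v xi x) (v xi x) + cos (Phi N xi x) * dot (v xi x) (a xi x)
    + sin (Phi N xi x) * dot (v xi x) (b xi x)); [unfold dot; ring|].
  rewrite H4, H5. ring.
Qed.

Lemma beta_nonneg N xi : in_box rho xi -> 0 <= beta N xi.
Proof.
  intros Hxi. pose proof (beta_lower N xi Hxi). pose proof beta0_pos. pose proof (pos_INR N). nra.
Qed.

Lemma fast_nrm N xi x : in_box rho xi -> nrm (fast N xi x) = beta N xi * kappa x.
Proof.
  intros Hxi. destruct (wd_frame W xi x Hxi)
    as [_ [H2 [H3 [_ [_ H6]]]]].
  pose proof (sin_cos_squares (Phi N xi x)) as Hsc. pose proof (beta_nonneg N xi Hxi) as Hb.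
  pose proof (kappa_pos x) as Hk. pose proof (wd_r_bounds W xi x Hxi) as Hr.
  pose proof (wd_r0 W) as Hr0.
  unfold nrm. rewrite <- (sqrt_square (beta N xi * kappa x)) by nra. f_equal. unfold fast.
  set (s := sin (Phi N xi x)) in *. set (c := cos (Phi N xi x)) in *.
  set (q := beta N xi * (kappa x * / r xi x)).
  transitivity (q * q * (c * c * dot (b xi x) (b xi x) + s * s * dot (a xi x) (a xi x)
    - 2 * c * s * dot (a xi x) (b xi x))); [unfold dot; ring|].
  rewrite H2, H3, H6.
  transitivity (q * q * ((s * s + c * c) * (r xi x * r xi x))); [ring|].
  rewrite Hsc. unfold q. field. lra.
Qed.

Lemma slow_le N xi x i : in_box rho xi -> Rabs (slow N xi x i) <= C1.
Proof.
  intros Hxi. pose proof (wd_slow W xi x i Hxi) as H. unfold slow.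
  set (dv := Derive (fun x => v xi x i) x) in *. set (da := Derive (fun x => a xi x i) x) in *.
  set (db := Derive (fun x => b xi x i) x) in *.
  assert (Hc : Rabs (cos (Phi N xi x)) <= 1) by (apply Rabs_le, COS_bound).
  assert (Hs : Rabs (sin (Phi N xi x)) <= 1) by (apply Rabs_le, SIN_bound).
  eapply Rle_trans; [apply Rabs_triang|].
  eapply Rle_trans; [apply Rplus_le_compat_r, Rabs_triang|]. rewrite !Rabs_mult.
  pose proof (Rabs_pos da). pose proof (Rabs_pos db). nra.
Qed.

(** The error comes from the slow part alone and does not depend on [N], whereas [beta] grows with
    [N]: relatively to [beta] the speed is proportional to [kappa] up to $O(1/N)$. *)
Lemma speed_close N xi x : in_box rho xi -> Rabs (speed N xi x - beta N xi * kappa x) <= 2 * C1.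
Proof.
  intros Hxi. rewrite <- fast_nrm by easy. eapply Rle_trans; [apply nrm_plus_close|].
  apply nrm_le_coords. intros i. now apply slow_le.
Qed.

Lemma Ck_Phi n N xi : reg_le (S (S n)) alpha -> in_box rho xi -> Ck (S n) (Phi N xi).
Proof.
  intros Hn Hxi. apply Ck_scal. apply Ck_prim. apply Ck_mult; [now apply W|].
  apply Ck_inv.
  - intros x. pose proof (wd_r_bounds W xi x Hxi).
    pose proof (wd_r0 W). lra.
  - apply (Ck_le (S n)); [lia|]. destruct (wd_r W) as [_ [H _]]. now apply H.
Qed.

Lemma Ck_Gam n N xi i : reg_le (S (S n)) alpha -> in_box rho xi ->
  Ck (S n) (fun x => Gam N xi x i).
Proof.
  intros Hn Hxi. unfold Gam.
  destruct (wd_v W i) as [_ [Hv _]].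
  destruct (wd_a W i) as [_ [Ha _]].
  destruct (wd_b W i) as [_ [Hb _]].
  destruct (Ck_sin_cos (S n)) as [Hs Hc]. pose proof (Ck_Phi n N xi Hn Hxi) as HP.
  apply Ck_plus; [apply Ck_plus; [now apply Hv|]|].
  - apply Ck_mult; [now apply Ck_comp|now apply Ha].
  - apply Ck_mult; [now apply Ck_comp|now apply Hb].
Qed.

Lemma Ck_dGam n N xi i : reg_le (S (S n)) alpha -> in_box rho xi ->
  Ck n (fun x => dGam N xi x i).
Proof.
  intros Hn Hxi. destruct (Ck_Gam n N xi i Hn Hxi) as [_ H].
  replace (fun x => dGam N xi x i) with (Derive (fun x => Gam N xi x i)); [easy|].
  apply functional_extensionality. intros x. now apply is_derive_unique, Gam_derive.
Qed.

(** Makes the slow part, of norm at most [2 * C1], at most half of the fast one, of norm at least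
    [beta * k0]; the spherical curve is then immersed. *)
Definition steep (N : nat) : Prop := 4 * C1 <= INR N * beta0 * k0.

Lemma speed_lower N xi x : steep N -> in_box rho xi -> beta N xi * k0 / 2 <= speed N xi x.
Proof.
  intros HN Hxi. pose proof (speed_close N xi x Hxi) as H. apply Rabs_le_between in H.
  pose proof (beta_lower N xi Hxi). pose proof (wd_kappa_bounds W x).
  pose proof (wd_k0 W). unfold steep in HN.
  pose proof (beta_nonneg N xi Hxi). nra.
Qed.

Lemma beta_k0_lower N xi : steep N -> in_box rho xi -> 4 * C1 <= beta N xi * k0.
Proof.
  intros HN Hxi. pose proof (beta_lower N xi Hxi).
  pose proof (wd_k0 W). unfold steep in HN. nra.
Qed.

Lemma speed_lower_C1 N xi x : steep N -> in_box rho xi -> 2 * C1 <= speed N xi x.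
Proof.
  intros HN Hxi. pose proof (speed_lower N xi x HN Hxi). pose proof (beta_k0_lower N xi HN Hxi). lra.
Qed.

Lemma Ck_speed n N xi : reg_le (S (S n)) alpha -> steep N -> in_box rho xi ->
  Ck n (speed N xi).
Proof.
  intros Hn HN Hxi. unfold speed, nrm. apply Ck_sqrt.
  - intros x. pose proof (speed_lower_C1 N xi x HN Hxi) as H.
    pose proof (wd_C1 W). unfold speed in H.
    rewrite <- nrm_sqr. nra.
  - unfold dot. repeat apply Ck_plus; apply Ck_mult; now apply Ck_dGam.
Qed.

Lemma dGam_periodic N xi x i : in_box rho xi -> dGam N xi (x + p) i = dGam N xi x i.
Proof.
  intros Hxi.
  rewrite <- (is_derive_unique _ _ _ (Gam_derive N xi x i Hxi)).
  rewrite <- (is_derive_unique _ _ _ (Gam_derive N xi (x + p) i Hxi)).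
  apply (Derive_periodic p (fun x => Gam N xi x i)). intros y. now apply Gam_periodic.
Qed.

Lemma speed_periodic N xi : in_box rho xi -> periodic p (speed N xi).
Proof. intros Hxi x. unfold speed, nrm, dot. now rewrite !dGam_periodic. Qed.

(** * Reparametrization to a speed proportional to the curvature *)

Section FixedN.

Context {N : nat} {xi : vec}.
Hypothesis Halpha : reg_le 2 alpha.
Hypothesis HN : steep N.
Hypothesis Hxi : in_box rho xi.

Lemma speed_continuous x : continuous (speed N xi) x.
Proof. now apply (Ck_continuous 0), (Ck_speed 0). Qed.

Lemma speed_lower_pos x : 0 < 2 * C1 <= speed N xi x.
Proof. pose proof (wd_C1 W). pose proof (speed_lower_C1 N xi x HN Hxi). lra. Qed.

Lemma arclen_derive x : is_derive (arclen N xi) x (speed N xi x).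
Proof. apply is_derive_prim, speed_continuous. Qed.

Lemma arclen_close x : 0 <= x <= p ->
  Rabs (arclen N xi x - beta N xi * K x) <= 2 * C1 * p.
Proof.
  intros Hx.
  replace (arclen N xi x - beta N xi * K x) with
    ((arclen N xi x - beta N xi * K x) - (arclen N xi 0 - beta N xi * K 0))
    by (unfold arclen, K; rewrite !prim_0; ring).
  eapply Rle_trans.
  - apply (mvt_bound (fun x => arclen N xi x - beta N xi * K x)
      (fun x => speed N xi x - beta N xi * kappa x) (2 * C1) 0 x); [lra| |].
    + intros z _. apply @is_derive_minus; [apply arclen_derive|apply is_derive_scal, K_derive].
    + intros z _. now apply speed_close.
  - pose proof (wd_C1 W). nra.
Qed.

Lemma ratio_close : Rabs (ratio N xi - beta N xi) * K p <= 2 * C1 * p.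
Proof.
  pose proof K_p_pos as HK. pose proof (wd_p W).
  rewrite <- (Rabs_right (K p)), <- Rabs_mult by lra.
  replace ((ratio N xi - beta N xi) * K p) with (arclen N xi p - beta N xi * K p)
    by (unfold ratio; field; lra).
  apply arclen_close. lra.
Qed.

Lemma arclen_inj x y : arclen N xi x = arclen N xi y -> x = y.
Proof.
  intros E. pose proof (derive_lower_bound_abs _ _ (2 * C1) arclen_derive
    (fun z => proj2 (speed_lower_pos z)) x y) as H.
  rewrite E, Rminus_diag, Rabs_R0 in H.
  pose proof (Rabs_pos (x - y)). pose proof (speed_lower_pos 0).
  assert (E0 : Rabs (x - y) = 0) by nra.
  destruct (Req_dec (x - y) 0) as [|n]; [lra|]. now apply Rabs_no_R0 in n.
Qed.

Lemma theta_spec x : arclen N xi (theta N xi x) = ratio N xi * K x.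
Proof.
  apply (inverse_spec _ (speed N xi) (2 * C1)).
  - apply (speed_lower_pos 0).
  - apply arclen_derive.
  - intros y. apply speed_lower_pos.
Qed.

Lemma theta_0 : theta N xi 0 = 0.
Proof. apply arclen_inj. rewrite theta_spec. unfold arclen, K. rewrite !prim_0. ring. Qed.

Lemma theta_p : theta N xi p = p.
Proof. apply arclen_inj. rewrite theta_spec. unfold ratio. field. pose proof K_p_pos. lra. Qed.

Lemma theta_periodic x : theta N xi (x + p) = theta N xi x + p.
Proof.
  apply arclen_inj. rewrite theta_spec. unfold arclen at 1. rewrite prim_periodic.
  - fold (arclen N xi (theta N xi x)) (arclen N xi p). fold (arclen N xi).
    rewrite theta_spec, K_periodic. unfold ratio. field. pose proof K_p_pos. lra.
  - now apply speed_periodic.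
  - apply speed_continuous.
Qed.

Lemma ratio_pos : 0 < ratio N xi.
Proof.
  pose proof (wd_p W).
  pose proof (derive_lower_bound (arclen N xi) (speed N xi) (2 * C1) 0 p ltac:(lra)
    arclen_derive (fun z => proj2 (speed_lower_pos z))) as H'.
  unfold arclen in H'. rewrite prim_0 in H'. pose proof (speed_lower_pos 0).
  apply Rdiv_lt_0_compat; [|apply K_p_pos]. unfold arclen. nra.
Qed.

Lemma theta_derive x :
  is_derive (theta N xi) x (ratio N xi * kappa x / speed N xi (theta N xi x)).
Proof.
  apply (is_derive_implicit (arclen N xi) (speed N xi) (fun x => ratio N xi * K x)
    (fun x => ratio N xi * kappa x) (theta N xi) (2 * C1)).
  - apply (speed_lower_pos 0).
  - apply arclen_derive.
  - apply speed_continuous.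
  - intros y. apply speed_lower_pos.
  - intros y. apply is_derive_scal, K_derive.
  - apply theta_spec.
Qed.

Lemma theta_range x : 0 <= x <= p -> 0 <= theta N xi x <= p.
Proof.
  intros Hx.
  assert (Hpos : forall z, 0 <= ratio N xi * kappa z / speed N xi (theta N xi z)).
  { intros z. pose proof ratio_pos. pose proof (kappa_pos z). pose proof (speed_lower_pos (theta N xi z)).
    apply Rdiv_le_0_compat; [nra|lra]. }
  pose proof (derive_lower_bound _ _ 0 0 x ltac:(lra) theta_derive Hpos).
  pose proof (derive_lower_bound _ _ 0 x p ltac:(lra) theta_derive Hpos).
  rewrite theta_0, theta_p in *. lra.
Qed.

(** [arclen] differs from [beta * K], and [ratio * K] from [beta * K], by at most [2 * C1 * p]. So
    [beta * K] changes by at most [4 * C1 * p] between [x] and [theta x], while [K] grows at rate at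
    least [k0]. *)
Lemma theta_close x : beta N xi * k0 * Rabs (theta N xi x - x) <= 4 * C1 * p.
Proof.
  revert x. apply (periodic_forall p (fun x => theta N xi x - x)
    (fun y => beta N xi * k0 * Rabs y <= 4 * C1 * p)).
  - apply W.
  - intros x. rewrite theta_periodic. ring.
  - intros x Hx. pose proof (theta_range x Hx) as Ht.
    pose proof (arclen_close _ Ht) as H1. rewrite theta_spec in H1.
    pose proof ratio_close as H2. pose proof (K_range x Hx) as HKx.
    pose proof (beta_nonneg N xi Hxi) as Hb.
    assert (H3 : Rabs (ratio N xi * K x - beta N xi * K x) <= 2 * C1 * p).
    { replace (ratio N xi * K x - beta N xi * K x) with ((ratio N xi - beta N xi) * K x) by ring.
      rewrite Rabs_mult, (Rabs_right (K x)) by lra.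
      pose proof (Rabs_pos (ratio N xi - beta N xi)). nra. }
    assert (H4 : beta N xi * Rabs (K (theta N xi x) - K x) <= 4 * C1 * p).
    { rewrite <- (Rabs_right (beta N xi)), <- Rabs_mult by lra.
      replace (beta N xi * (K (theta N xi x) - K x)) with
        ((ratio N xi * K x - beta N xi * K x) - (ratio N xi * K x - beta N xi * K (theta N xi x))) by ring.
      unfold Rminus at 1. eapply Rle_trans; [apply Rabs_triang|]. rewrite Rabs_Ropp. lra. }
    pose proof (derive_lower_bound_abs K kappa k0 K_derive
      (fun z => proj1 (wd_kappa_bounds W z)) (theta N xi x) x) as H5.
    rewrite Rmult_assoc. nra.
Qed.

(** Bootstrap on the formula for the derivative of [theta]: if [theta] is $C^m$ with $m\leq n$ then
    so is its derivative, as [kappa] and [speed] are $C^n$. Thus [theta] is of class $C^{\alpha-1}$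
    although [kappa] is only of class $C^{\alpha-2}$. *)
Lemma Ck_theta n : reg_le (S (S n)) alpha -> Ck (S n) (theta N xi).
Proof.
  intros Hn.
  assert (H : forall m, (m <= S n)%nat -> Ck m (theta N xi)); [|now apply H].
  induction m as [|m IH]; intros Hm.
  - intros x. apply (ex_derive_continuous (K := R_AbsRing) (V := R_NormedModule)).
    eexists. apply theta_derive.
  - apply (Ck_S m _ _ theta_derive). apply Ck_div.
    + intros x. pose proof (speed_lower_pos (theta N xi x)). lra.
    + apply Ck_scal. apply (Ck_le n); [lia|]. now apply W.
    + apply Ck_comp; [|apply IH; lia]. apply (Ck_le n); [lia|]. now apply Ck_speed.
Qed.

Lemma Ck_T n i : reg_le (S (S n)) alpha -> Ck (S n) (fun x => T N xi x i).
Proof.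
  intros Hn. apply (Ck_comp (S n) (fun x => Gam N xi x i) (theta N xi)).
  - now apply Ck_Gam.
  - now apply Ck_theta.
Qed.

Lemma T_periodic i : periodic p (fun x => T N xi x i).
Proof. intros x. unfold T. rewrite theta_periodic. now apply Gam_periodic. Qed.

Lemma T_unit x : dot (T N xi x) (T N xi x) = 1.
Proof. now apply Gam_unit. Qed.

Definition dT (x : R) : vec :=
  fun i => ratio N xi * kappa x / speed N xi (theta N xi x) * dGam N xi (theta N xi x) i.

Lemma T_derive x i : is_derive (fun x => T N xi x i) x (dT x i).
Proof.
  apply (is_derive_comp (fun x => Gam N xi x i) (theta N xi)).
  - now apply Gam_derive.
  - apply theta_derive.
Qed.

Lemma dT_nrm x : nrm (dT x) = ratio N xi * kappa x.
Proof.
  pose proof (speed_lower_pos (theta N xi x)) as Hs. pose proof ratio_pos. pose proof (kappa_pos x).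
  unfold nrm. rewrite <- (sqrt_square (ratio N xi * kappa x)) by nra. f_equal. unfold dT.
  set (q := ratio N xi * kappa x / speed N xi (theta N xi x)).
  transitivity (q * q * dot (dGam N xi (theta N xi x)) (dGam N xi (theta N xi x)));
    [unfold dot; ring|].
  rewrite <- nrm_sqr. fold (speed N xi (theta N xi x)). unfold q. field. lra.
Qed.

Lemma T_continuous x i : continuous (fun x => T N xi x i) x.
Proof.
  apply (ex_derive_continuous (K := R_AbsRing) (V := R_NormedModule)).
  eexists. apply T_derive.
Qed.

End FixedN.

(** * Lipschitz dependence of the spherical curve on the parameter *)

Lemma bl_prim h : (forall xi x, in_box rho xi -> continuous (h xi) x) ->
  bounded_lipschitz rho p h -> bounded_lipschitz rho p (fun xi => prim (h xi)).
Proof.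
  intros Hc [C [HC [H1 H2]]]. pose proof (wd_p W) as Hp.
  exists (C * p). split; [nra|]. split.
  - intros xi x Hxi Hx. replace (prim (h xi) x) with (prim (h xi) x - prim (h xi) 0)
      by (rewrite prim_0; ring).
    apply Rle_trans with (C * (x - 0)); [|nra].
    apply (mvt_bound _ (h xi)); [lra| |].
    + intros z _. apply is_derive_prim. intros y. now apply Hc.
    + intros z Hz. apply H1; [easy|lra].
  - intros xi et x Hxi Het Hx. pose proof (dist1_pos xi et).
    replace (prim (h xi) x - prim (h et) x) with
      ((prim (h xi) x - prim (h et) x) - (prim (h xi) 0 - prim (h et) 0))
      by (rewrite !prim_0; ring).
    apply Rle_trans with (C * dist1 xi et * (x - 0)).
    2: { replace (C * p * dist1 xi et) with (C * dist1 xi et * p) by ring.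
         apply Rmult_le_compat_l; [nra|lra]. }
    apply (mvt_bound (fun x => prim (h xi) x - prim (h et) x) (fun x => h xi x - h et x)); [lra| |].
    + intros z _. apply @is_derive_minus; apply is_derive_prim; intros y; now apply Hc.
    + intros z Hz. apply H2; [easy|easy|lra].
Qed.

Lemma bl_freeze h : bounded_lipschitz rho p h -> bounded_lipschitz rho p (fun xi _ => h xi p).
Proof.
  intros [C [HC [H1 H2]]]. pose proof (wd_p W) as Hp. exists C. split; [easy|]. split.
  - intros. apply H1; [easy|lra].
  - intros. apply H2; [easy|easy|lra].
Qed.

Lemma bl_sin_cos h : bounded_lipschitz rho p h ->
  bounded_lipschitz rho p (fun xi x => sin (h xi x)) /\
  bounded_lipschitz rho p (fun xi x => cos (h xi x)).
Proof.
  intros [C [HC [H1 H2]]].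
  assert (Ls : forall x y, Rabs (sin x - sin y) <= 1 * Rabs (x - y)).
  { apply (derive_bounded_lipschitz sin cos); [apply is_derive_sin|].
    intros z. apply Rabs_le, COS_bound. }
  assert (Lc : forall x y, Rabs (cos x - cos y) <= 1 * Rabs (x - y)).
  { apply (derive_bounded_lipschitz cos (fun x => - sin x)); [apply is_derive_cos|].
    intros z. rewrite Rabs_Ropp. apply Rabs_le, SIN_bound. }
  split; exists (C + 1); (split; [lra|]); split.
  - intros. apply Rle_trans with 1; [apply Rabs_le, SIN_bound|lra].
  - intros xi et x Hxi Het Hx. specialize (Ls (h xi x) (h et x)). specialize (H2 xi et x Hxi Het Hx).
    pose proof (dist1_pos xi et). nra.
  - intros. apply Rle_trans with 1; [apply Rabs_le, COS_bound|lra].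
  - intros xi et x Hxi Het Hx. specialize (Lc (h xi x) (h et x)). specialize (H2 xi et x Hxi Het Hx).
    pose proof (dist1_pos xi et). nra.
Qed.

Lemma bl_kappa : bounded_lipschitz rho p (fun _ => kappa).
Proof.
  apply bl_fixed with k1. intros x. pose proof (wd_kappa_bounds W x). pose proof (kappa_pos x).
  rewrite Rabs_right; lra.
Qed.

Lemma bl_rate : bounded_lipschitz rho p (fun xi x => kappa x * / r xi x).
Proof.
  apply (bl_mult _ _ (fun _ => kappa)); [apply bl_kappa|].
  apply bl_inv with r0; [apply W| |].
  - intros. now apply W.
  - apply (tame_Derive alpha rho p r); apply W.
Qed.

Lemma bl_A : bounded_lipschitz rho p A.
Proof. apply bl_prim; [intros; now apply rate_continuous|apply bl_rate]. Qed.

Lemma bl_beta N : bounded_lipschitz rho p (fun xi _ => beta N xi).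
Proof.
  apply (bl_mult _ _ (fun _ _ => 2 * PI * INR N) (fun xi _ => / A xi p)).
  - apply bl_fixed with (Rabs (2 * PI * INR N)). intros. lra.
  - apply bl_inv with (K p); [apply K_p_pos| |].
    + intros xi x Hxi _. exact (proj1 (A_p_bounds xi Hxi)).
    + apply (bl_freeze A), bl_A.
Qed.

Lemma bl_Phi N : bounded_lipschitz rho p (Phi N).
Proof. apply (bl_mult _ _ (fun xi _ => beta N xi) A); [apply bl_beta|apply bl_A]. Qed.

Lemma bl_Gam N i : bounded_lipschitz rho p (fun xi x => Gam N xi x i).
Proof.
  pose proof (wd_p W) as Hp. destruct (bl_sin_cos _ (bl_Phi N)) as [Hs Hc].
  destruct (tame_Derive _ _ _ _ Hp (wd_v W i)) as [Hv _].
  destruct (tame_Derive _ _ _ _ Hp (wd_a W i)) as [Ha _].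
  destruct (tame_Derive _ _ _ _ Hp (wd_b W i)) as [Hb _].
  unfold Gam. repeat apply bl_plus; [easy|now apply bl_mult|now apply bl_mult].
Qed.

Lemma bl_dGam N i : bounded_lipschitz rho p (fun xi x => dGam N xi x i).
Proof.
  pose proof (wd_p W) as Hp. destruct (bl_sin_cos _ (bl_Phi N)) as [Hs Hc].
  destruct (tame_Derive _ _ _ _ Hp (wd_v W i)) as [_ [Hdv _]].
  destruct (tame_Derive _ _ _ _ Hp (wd_a W i)) as [Ha [Hda _]].
  destruct (tame_Derive _ _ _ _ Hp (wd_b W i)) as [Hb [Hdb _]].
  unfold dGam. apply bl_plus.
  - unfold slow. repeat apply bl_plus; [easy|now apply bl_mult|now apply bl_mult].
  - apply bl_mult.
    + apply bl_mult; [apply bl_beta|apply bl_rate].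
    + apply bl_plus; [now apply bl_mult|]. apply bl_opp. now apply bl_mult.
Qed.

Lemma bl_speed N : steep N -> bounded_lipschitz rho p (speed N).
Proof.
  intros HN. pose proof (wd_C1 W). apply bl_sqrt with (2 * C1 * (2 * C1)); [nra| |].
  - intros xi x Hxi _. rewrite <- nrm_sqr. pose proof (speed_lower_C1 N xi x HN Hxi) as Hs.
    unfold speed in Hs. nra.
  - unfold dot. repeat apply bl_plus; apply bl_mult; apply bl_dGam.
Qed.

(** [theta] depends on [xi] implicitly, through an equation whose two sides are Lipschitz in [xi]
    and whose left side grows in [theta] at a positive rate; so [theta] is Lipschitz in [xi], and
    [T] follows by composition. *)
Lemma bl_T N i : reg_le 2 alpha -> steep N -> bounded_lipschitz rho p (fun xi x => T N xi x i).
Proof.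
  intros Halpha HN. pose proof (wd_p W) as Hp. pose proof (wd_C1 W) as HC1.
  assert (HS : bounded_lipschitz rho p (arclen N)).
  { apply bl_prim; [|now apply bl_speed]. intros. now apply speed_continuous. }
  destruct HS as [CS [HCS [_ LS]]].
  destruct (bl_Gam N i) as [CG [HCG [BG LG]]]. destruct (bl_dGam N i) as [CD [HCD [BD _]]].
  pose proof K_p_pos as HK.
  exists (CG + CD * (CS / C1)). split.
  { assert (0 < CS / C1) by (now apply Rdiv_lt_0_compat). nra. }
  split.
  - intros xi x Hxi Hx. apply Rle_trans with CG.
    + apply BG; [easy|]. now apply theta_range.
    + assert (0 < CS / C1) by (now apply Rdiv_lt_0_compat). nra.
  - intros xi et x Hxi Het Hx. pose proof (dist1_pos xi et) as Hd.
    pose proof (theta_range Halpha HN Hxi x Hx) as Rxi.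
    pose proof (theta_range Halpha HN Het x Hx) as Ret.
    (* Changing [xi] to [et] in [arclen] and in [ratio] costs [CS * dist1 xi et] each, to be divided
       by the growth rate [2 * C1] of [arclen]. *)
    assert (Hth : Rabs (theta N xi x - theta N et x) <= CS / C1 * dist1 xi et).
    { replace (CS / C1 * dist1 xi et) with (CS * dist1 xi et / C1) by (field; lra).
      apply Rle_div_r; [easy|].
      pose proof (derive_lower_bound_abs _ _ (2 * C1) (arclen_derive Halpha HN Hxi)
        (fun z => proj2 (speed_lower_pos HN Hxi z)) (theta N xi x) (theta N et x)) as HL.
      rewrite (theta_spec Halpha HN Hxi) in HL.
      pose proof (LS xi et (theta N et x) Hxi Het Ret) as L1.
      rewrite (theta_spec Halpha HN Het) in L1.
      pose proof (LS xi et p Hxi Het ltac:(lra)) as L2.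
      pose proof (K_range x Hx) as HKx.
      assert (L3 : Rabs (ratio N xi * K x - ratio N et * K x) <= CS * dist1 xi et).
      { replace (ratio N xi * K x - ratio N et * K x) with
          ((arclen N xi p - arclen N et p) * (K x / K p)) by (unfold ratio; field; lra).
        rewrite Rabs_mult. assert (0 <= K x / K p <= 1).
        { split; [apply Rdiv_le_0_compat; lra|]. apply Rle_div_l; lra. }
        rewrite (Rabs_right (K x / K p)) by lra.
        pose proof (Rabs_pos (arclen N xi p - arclen N et p)). nra. }
      assert (L4 : Rabs (ratio N xi * K x - arclen N xi (theta N et x)) <= 2 * (CS * dist1 xi et)).
      { replace (ratio N xi * K x - arclen N xi (theta N et x)) with
          ((ratio N xi * K x - ratio N et * K x) - (arclen N xi (theta N et x) - ratio N et * K x)) by ring.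
        unfold Rminus at 1. eapply Rle_trans; [apply Rabs_triang|]. rewrite Rabs_Ropp. lra. }
      lra. }
    unfold T.
    replace (Gam N xi (theta N xi x) i - Gam N et (theta N et x) i) with
      ((Gam N xi (theta N xi x) i - Gam N xi (theta N et x) i)
       + (Gam N xi (theta N et x) i - Gam N et (theta N et x) i)) by ring.
    eapply Rle_trans; [apply Rabs_triang|].
    pose proof (LG xi et (theta N et x) Hxi Het Ret) as L5.
    assert (M : forall y z, 0 <= y <= p -> 0 <= z <= p -> y <= z ->
      Rabs (Gam N xi z i - Gam N xi y i) <= CD * (z - y)).
    { intros y z Hy Hz Hyz. apply (mvt_bound (fun x => Gam N xi x i) (fun x => dGam N xi x i)); [easy| |].
      - intros t _. now apply Gam_derive.
      - intros t Ht. apply BD; [easy|lra]. }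
    assert (L6 : Rabs (Gam N xi (theta N xi x) i - Gam N xi (theta N et x) i)
      <= CD * Rabs (theta N xi x - theta N et x)).
    { destruct (Rle_dec (theta N xi x) (theta N et x)).
      - rewrite Rabs_minus_sym, (Rabs_minus_sym (theta N xi x)), (Rabs_right (theta N et x - _)) by lra.
        now apply M.
      - rewrite (Rabs_right (theta N xi x - _)) by lra. apply M; lra. }
    nra.
Qed.

(** Here [L] may depend on [N], since Poincare-Miranda is applied with [N] fixed. *)
Lemma wiggle_lipschitz N : reg_le 2 alpha -> steep N -> exists L, 0 < L /\
  forall xi et, in_box rho xi -> in_box rho et -> forall i,
    Rabs (prim (fun x => T N xi x i) p - prim (fun x => T N et x i) p) <= L * dist1 xi et.
Proof.
  intros Halpha HN.
  assert (H : forall i, exists L, 0 < L /\ forall xi et, in_box rho xi -> in_box rho et ->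
    Rabs (prim (fun x => T N xi x i) p - prim (fun x => T N et x i) p) <= L * dist1 xi et).
  { intros i. destruct (bl_prim (fun xi x => T N xi x i)) as [L [HL [_ H]]].
    - intros. now apply T_continuous.
    - now apply bl_T.
    - exists L. split; [easy|]. intros xi et Hxi Het. apply H; [easy|easy|]. pose proof (wd_p W). lra. }
  destruct (H ax1) as [L1 [P1 H1]], (H ax2) as [L2 [P2 H2]], (H ax3) as [L3 [P3 H3]].
  exists (L1 + L2 + L3). split; [lra|]. intros xi et Hxi Het i.
  pose proof (dist1_pos xi et).
  specialize (H1 xi et Hxi Het). specialize (H2 xi et Hxi Het). specialize (H3 xi et Hxi Het).
  destruct i; nra.
Qed.

(** * Averaging over the turns *)

Lemma frame_coord_le1 xi x i : in_box rho xi -> Rabs (a xi x i) <= 1 /\ Rabs (b xi x i) <= 1.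
Proof.
  intros Hxi. destruct (wd_frame W xi x Hxi) as [_ [H2 [H3 _]]].
  pose proof (wd_r_bounds W xi x Hxi) as Hr. pose proof (wd_r0 W).
  split; (eapply Rle_trans; [apply coord_le_nrm|]); unfold nrm; rewrite ?H2, ?H3;
    rewrite sqrt_square; lra.
Qed.

Lemma Rabs_mult_le x y X Y : Rabs x <= X -> Rabs y <= Y -> Rabs (x * y) <= X * Y.
Proof. intros. rewrite Rabs_mult. apply Rmult_le_compat; auto using Rabs_pos. Qed.

Lemma Rabs_plus_le x y X Y : Rabs x <= X -> Rabs y <= Y -> Rabs (x + y) <= X + Y.
Proof. intros. eapply Rle_trans; [apply Rabs_triang|lra]. Qed.

Lemma Rabs_minus_le x y X Y : Rabs x <= X -> Rabs y <= Y -> Rabs (x - y) <= X + Y.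
Proof. intros. apply Rabs_plus_le; [easy|]. now rewrite Rabs_Ropp. Qed.

Section Average.

Context {N : nat} {xi : vec}.
Hypothesis Halpha : reg_le 2 alpha.
Hypothesis HN : steep N.
Hypothesis Hxi : in_box rho xi.

(** The derivative of [theta] times [kappa (theta x) / kappa x]. Thanks to this factor the phase
    rate of [T] involves [kappa x] instead of [kappa (theta x)], and no modulus of continuity of
    [kappa] enters the comparison. *)
Definition gain (x : R) : R := ratio N xi * kappa (theta N xi x) / speed N xi (theta N xi x).

(** Collects the errors [2 * C1] of the speed and [2 * C1 * p / K p * k1] of the ratio, over the
    lower bound [beta * k0 / 2] of the speed; [beta] is left out. *)
Definition Cgain : R := 4 * C1 * (p * k1 / K p + 1) / k0.

Lemma beta_pos : 0 < beta N xi.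
Proof.
  pose proof (beta_k0_lower N xi HN Hxi). pose proof (wd_C1 W). pose proof (wd_k0 W). nra.
Qed.

Lemma gain_close x : Rabs (1 - gain x) <= Cgain / beta N xi.
Proof.
  pose proof K_p_pos as HK. pose proof (wd_k0 W) as Hk0. pose proof (wd_C1 W) as HC1.
  pose proof (wd_p W) as Hp. pose proof beta_pos as Hb. unfold gain.
  set (y := theta N xi x). pose proof (speed_close N xi y Hxi) as H1.
  pose proof (speed_lower N xi y HN Hxi) as Hs. pose proof (speed_lower_pos HN Hxi y) as Hs0.
  pose proof (ratio_close Halpha HN Hxi) as H2. pose proof (wd_kappa_bounds W y) as Hk.
  set (s := speed N xi y) in *. set (be := beta N xi) in *. set (ra := ratio N xi) in *.
  replace (1 - ra * kappa y / s) with ((s - ra * kappa y) / s) by (field; lra).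
  unfold Rdiv at 1. rewrite Rabs_mult, (Rabs_right (/ s)) by (apply Rle_ge, Rlt_le, Rinv_0_lt_compat; lra).
  assert (H3 : Rabs (s - ra * kappa y) <= 2 * C1 + 2 * C1 * p / K p * k1).
  { replace (s - ra * kappa y) with ((s - be * kappa y) - (ra - be) * kappa y) by ring.
    apply Rabs_minus_le; [easy|]. apply Rabs_mult_le.
    - apply Rle_div_r; lra.
    - rewrite Rabs_right; lra. }
  assert (H4 : / s <= / (be * k0 / 2)) by (apply Rinv_le_contravar; nra).
  apply Rle_trans with ((2 * C1 + 2 * C1 * p / K p * k1) * / (be * k0 / 2)).
  - apply Rmult_le_compat; [apply Rabs_pos| |easy|easy].
    apply Rlt_le, Rinv_0_lt_compat; lra.
  - unfold Cgain. apply Req_le. field. lra.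
Qed.

(* The phase [om] of [T] runs at rate [om' = gain beta kappa / r], so with [j]
   close to [1 / kappa] the oscillating part of [T] is, up to small terms, the
   derivative of [M = (sin om a - cos om b) r j / beta], which is small itself. *)
Lemma average_estimate (j j' : R -> R) (e1 Cj Cr : R) (i : axis) :
  (forall x, is_derive j x (j' x)) -> 0 <= e1 <= 1 -> 0 < Cj -> 0 < Cr ->
  (forall x, 0 <= x <= p -> Rabs (1 - kappa x * j x) <= e1 /\ Rabs (j x) <= Cj /\ Rabs (j' x) <= Cj) ->
  (forall x, Rabs (Derive (r xi) x) <= Cr) -> Cgain <= beta N xi ->
  let t1 := 2 * k1 / k0 in
  let X := 4 * C1 * C1 * p / k0 + 2 * t1 * C1 * Cj + 2 * (t1 * Cr * Cj + Cj) + 4 * Cgain in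
  forall x, 0 <= x <= p ->
    Rabs (prim (fun x => T N xi x i) x - prim (fun x => v xi x i) x) <=
    p * (2 * e1 + X / beta N xi) + 4 * Cj / beta N xi.
Proof.
  intros Hj He1 HCj HCr Hjb Hdr Hbeta t1 X x Hx.
  pose proof (wd_p W) as Hp. pose proof beta_pos as Hb. pose proof (wd_k0 W) as Hk0.
  pose proof (wd_C1 W) as HC1.
  pose (th := theta N xi). pose (om := fun x => Phi N xi (th x)).
  pose (tau := fun x => ratio N xi * kappa x / speed N xi (th x)).
  pose (be := beta N xi). fold be in Hb, Hbeta |- *.
  pose (P := fun x => sin (om x) * a xi (th x) i - cos (om x) * b xi (th x) i).
  pose (Q := fun x => r xi (th x) * j x).
  pose (om' := fun x => tau x * (be * (kappa (th x) * / r xi (th x)))).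
  pose (da := fun x => Derive (fun x => a xi x i) x).
  pose (db := fun x => Derive (fun x => b xi x i) x).
  pose (P' := fun x => om' x * (cos (om x) * a xi (th x) i + sin (om x) * b xi (th x) i)
    + tau x * (sin (om x) * da (th x) - cos (om x) * db (th x))).
  pose (Q' := fun x => tau x * Derive (r xi) (th x) * j x + r xi (th x) * j' x).
  assert (Dth : forall x, is_derive th x (tau x)) by (now apply theta_derive).
  assert (Dom : forall x, is_derive om x (om' x)).
  { intros z. apply (is_derive_comp (Phi N xi) th); [now apply Phi_derive|apply Dth]. }
  assert (DP : forall x, is_derive P x (P' x)).
  { intros z. unfold P'.
    destruct (tame_Derive _ _ _ _ Hp (wd_a W i)) as [_ [_ [Ha _]]].
    destruct (tame_Derive _ _ _ _ Hp (wd_b W i)) as [_ [_ [Hb' _]]].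
    replace (om' z * _ + _) with
      ((om' z * cos (om z) * a xi (th z) i + sin (om z) * (tau z * da (th z)))
       - (om' z * - sin (om z) * b xi (th z) i + cos (om z) * (tau z * db (th z)))) by ring.
    apply @is_derive_minus.
    - apply (is_derive_mult (fun x => sin (om x)) (fun x => a xi (th x) i));
        [| |intros; apply Rmult_comm].
      + apply (is_derive_comp sin om); [apply is_derive_sin|apply Dom].
      + apply (is_derive_comp (fun x => a xi x i) th); [now apply Ha|apply Dth].
    - apply (is_derive_mult (fun x => cos (om x)) (fun x => b xi (th x) i));
        [| |intros; apply Rmult_comm].
      + apply (is_derive_comp cos om); [apply is_derive_cos|apply Dom].
      + apply (is_derive_comp (fun x => b xi x i) th); [now apply Hb'|apply Dth]. }
  assert (DQ : forall x, is_derive Q x (Q' x)).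
  { intros z. destruct (tame_Derive _ _ _ _ Hp (wd_r W)) as [_ [_ [Hr _]]].
    apply (is_derive_mult (fun x => r xi (th x)) j); [|apply Hj|intros; apply Rmult_comm].
    apply (is_derive_comp (r xi) th); [now apply Hr|apply Dth]. }
  pose (M := fun x => / be * (P x * Q x)).
  assert (DM : forall x, is_derive M x (/ be * (P' x * Q x + P x * Q' x))).
  { intros z. apply is_derive_scal. apply @is_derive_mult; auto. intros; apply Rmult_comm. }
  (* With [M] subtracted, the remaining error has a uniformly small derivative, so that the mean
     value inequality applies. *)
  pose (E := fun x => prim (fun x => T N xi x i) x - prim (fun x => v xi x i) x - M x).
  assert (DE : forall x, is_derive E x
    (T N xi x i - v xi x i - / be * (P' x * Q x + P x * Q' x))).
  { intros z. apply @is_derive_minus; [apply @is_derive_minus|apply DM].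
    - apply (is_derive_prim (fun x => T N xi x i)). intros y. now apply T_continuous.
    - apply (is_derive_prim (fun x => v xi x i)). intros y.
      apply (tame_continuous (fun xi x => v xi x i)); [apply W|easy]. }
  assert (Hsin : forall y, Rabs (sin y) <= 1) by (intros; apply Rabs_le, SIN_bound).
  assert (Hcos : forall y, Rabs (cos y) <= 1) by (intros; apply Rabs_le, COS_bound).
  assert (Hr1 : forall y, Rabs (r xi y) <= 1).
  { intros y. pose proof (wd_r_bounds W xi y Hxi). pose proof (wd_r0 W). rewrite Rabs_right; lra. }
  assert (HPb : forall y, Rabs (P y) <= 2).
  { intros y. replace 2 with (1 * 1 + 1 * 1) by ring.
    apply Rabs_minus_le; apply Rabs_mult_le; auto; now apply frame_coord_le1. }
  assert (HQb : forall y, 0 <= y <= p -> Rabs (Q y) <= Cj).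
  { intros y Hy. rewrite <- (Rmult_1_l Cj). apply Rabs_mult_le; auto. now apply Hjb. }
  assert (HMb : forall y, 0 <= y <= p -> Rabs (M y) <= Cj * 2 / be).
  { intros y Hy. unfold M. replace (Cj * 2 / be) with (/ be * (2 * Cj)) by (field; lra).
    apply Rabs_mult_le; [|apply Rabs_mult_le; auto].
    rewrite Rabs_right; [lra|]. apply Rle_ge, Rlt_le, Rinv_0_lt_compat; lra. }
  assert (Hgain : forall y, Rabs (gain y) <= 2).
  { intros y. replace (gain y) with (1 - (1 - gain y)) by ring. replace 2 with (1 + 1) by ring.
    apply Rabs_minus_le; [rewrite Rabs_R1; lra|].
    eapply Rle_trans; [apply gain_close|]. fold be. apply Rle_div_l; lra. }
  (* [tau] is the derivative of [theta], equal to [gain y] times a quotient of two values of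
     [kappa]; hence [2 * k1 / k0]. *)
  assert (Htau : forall y, Rabs (tau y) <= t1).
  { intros y. replace (tau y) with (gain y * (kappa y * / kappa (th y))).
    2: { unfold tau, gain. fold th. pose proof (kappa_pos (th y)).
         pose proof (speed_lower_pos HN Hxi (th y)). field. lra. }
    replace t1 with (2 * (k1 * / k0)) by (unfold t1; field; lra).
    apply Rabs_mult_le; [apply Hgain|]. apply Rabs_mult_le.
    - pose proof (wd_kappa_bounds W y). rewrite Rabs_right; lra.
    - pose proof (wd_kappa_bounds W (th y)).
      rewrite Rabs_right by (apply Rle_ge, Rlt_le, Rinv_0_lt_compat; lra).
      apply Rinv_le_contravar; lra. }
  assert (HE' : forall y, 0 <= y <= p ->
    Rabs (T N xi y i - v xi y i - / be * (P' y * Q y + P y * Q' y)) <= 2 * e1 + X / be).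
  { intros y Hy. destruct (Hjb y Hy) as [J1 [J2 J3]].
    pose proof (kappa_pos (th y)) as Hkt. pose proof (speed_lower_pos HN Hxi (th y)) as Hst.
    pose proof (wd_r_bounds W xi (th y) Hxi) as Hrt. pose proof (wd_r0 W) as Hr0.
    destruct (frame_coord_le1 xi (th y) i Hxi) as [Fa Fb].
    assert (Hda : Rabs (da (th y)) <= C1 /\ Rabs (db (th y)) <= C1).
    { pose proof (wd_slow W xi (th y) i Hxi) as Hsl.
      pose proof (Rabs_pos (Derive (fun x => v xi x i) (th y))).
      unfold da, db.
      pose proof (Rabs_pos (Derive (fun x => a xi x i) (th y))).
      pose proof (Rabs_pos (Derive (fun x => b xi x i) (th y))). lra. }
    set (circ := cos (om y) * a xi (th y) i + sin (om y) * b xi (th y) i).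
    (* Three sources of error: the displacement of [theta], the failure of [gain * kappa * j] to be
       1, and the derivatives of the frame, of [r] and of [j], divided by [beta]. The summands of
       [X] bound them, together with [2 * e1] for the second. *)
    assert (EQ : T N xi y i - v xi y i - / be * (P' y * Q y + P y * Q' y) =
      (v xi (th y) i - v xi y i) + circ * (1 - gain y * (kappa y * j y))
      - / be * (tau y * (sin (om y) * da (th y) - cos (om y) * db (th y)) * Q y + P y * Q' y)).
    { unfold P'. fold circ. unfold T, Gam. fold th (om y).
      transitivity ((v xi (th y) i - v xi y i) + circ * (1 - / be * om' y * Q y)
        - / be * (tau y * (sin (om y) * da (th y) - cos (om y) * db (th y)) * Q y + P y * Q' y));
        [unfold circ, om; ring|].
      do 2 f_equal. f_equal. f_equal. unfold om', Q, gain, tau. fold th. field. lra. }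
    rewrite EQ.
    replace (2 * e1 + X / be) with
      ((4 * C1 * C1 * p / k0 / be + 2 * (e1 + 2 * (Cgain / be)))
       + / be * (t1 * (1 * C1 + 1 * C1) * Cj + 2 * (t1 * Cr * Cj + 1 * Cj))) by (unfold X; field; lra).
    apply Rabs_minus_le; [apply Rabs_plus_le|].
    - destruct (tame_Derive _ _ _ _ Hp (wd_v W i)) as [_ [_ [Hv _]]].
      eapply Rle_trans.
      + apply (derive_bounded_lipschitz (fun x => v xi x i) (Derive (fun x => v xi x i)) C1).
        * intros z. now apply Hv.
        * intros z. pose proof (wd_slow W xi z i Hxi) as Hsl.
          pose proof (Rabs_pos (Derive (fun x => a xi x i) z)).
          pose proof (Rabs_pos (Derive (fun x => b xi x i) z)). lra.
      + pose proof (theta_close Halpha HN Hxi y) as Hc. fold th be in Hc.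
        replace (4 * C1 * C1 * p / k0 / be) with (C1 * (4 * C1 * p / (be * k0))) by (field; lra).
        apply Rmult_le_compat_l; [lra|]. apply Rle_div_r; [nra|]. lra.
    - apply Rabs_mult_le.
      + replace 2 with (1 * 1 + 1 * 1) by ring.
        apply Rabs_plus_le; apply Rabs_mult_le; auto.
      + replace (1 - gain y * (kappa y * j y)) with
          ((1 - kappa y * j y) + (1 - (1 - kappa y * j y)) * (1 - gain y)) by ring.
        apply Rabs_plus_le; [easy|]. apply Rabs_mult_le; [|apply gain_close].
        replace 2 with (1 + 1) by ring. apply Rabs_minus_le; [rewrite Rabs_R1; lra|lra].
    - apply Rabs_mult_le.
      + rewrite Rabs_right; [lra|]. apply Rle_ge, Rlt_le, Rinv_0_lt_compat; lra.
      + apply Rabs_plus_le.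
        * apply Rabs_mult_le; [|auto]. apply Rabs_mult_le; [auto|].
          apply Rabs_minus_le; apply Rabs_mult_le; auto; tauto.
        * apply Rabs_mult_le; [auto|]. apply Rabs_plus_le; apply Rabs_mult_le; auto.
          apply Rabs_mult_le; auto. }
  replace (prim (fun x => T N xi x i) x - prim (fun x => v xi x i) x) with
    ((E x - E 0) + (M x - M 0)) by (unfold E; rewrite !prim_0; ring).
  assert (HX : 0 <= 2 * e1 + X / be).
  { eapply Rle_trans; [apply Rabs_pos|]. apply (HE' 0). lra. }
  replace (p * (2 * e1 + X / be) + 4 * Cj / be) with
    (p * (2 * e1 + X / be) + (Cj * 2 / be + Cj * 2 / be)) by (field; lra).
  apply Rabs_plus_le.
  - apply Rle_trans with ((2 * e1 + X / be) * (x - 0)).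
    + apply (mvt_bound E (fun x => T N xi x i - v xi x i - / be * (P' x * Q x + P x * Q' x)));
        [lra|intros; apply DE|]. intros z Hz. apply HE'. lra.
    + nra.
  - apply Rabs_minus_le; apply HMb; lra.
Qed.

End Average.

(** The constants of [average_estimate] depend on [eps] through [j] but not on [xi], so that one [N]
    serves the whole box. *)
Lemma wiggle_average eps : reg_le 2 alpha -> 0 < eps -> exists N, steep N /\
  forall xi, in_box rho xi -> (forall x, Rabs (theta N xi x - x) <= eps) /\
    forall x i, 0 <= x <= p ->
      Rabs (prim (fun x => T N xi x i) x - prim (fun x => v xi x i) x) <= eps.
Proof.
  intros Halpha Heps.
  pose proof (wd_p W) as Hp. pose proof (wd_k0 W) as Hk0. pose proof (wd_C1 W) as HC1.
  pose proof beta0_pos as Hb0. pose proof K_p_pos as HK.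
  assert (Hk1 : 0 < k1) by (pose proof (wd_kappa_bounds W 0); lra).
  destruct (tame_Derive _ _ _ _ Hp (wd_r W)) as [_ [_ [_ [Cr [HCr HrC]]]]].
  (* The term [2 * p * e1] uses half of [eps]; the other half is left to the terms in [1 / beta]. *)
  pose (e1 := Rmin 1 (eps / (4 * p))).
  assert (He1 : 0 < e1 <= 1).
  { split; [apply Rmin_pos; [lra|]; apply Rdiv_lt_0_compat; lra|apply Rmin_l]. }
  assert (He1' : e1 * (4 * p) <= eps).
  { apply Rle_div_r; [lra|apply Rmin_r]. }
  destruct (smooth_reciprocal kappa p k0 Hp Hk0 (wd_kappa W)
    (fun x => proj1 (wd_kappa_bounds W x)) e1 ltac:(lra)) as [j [j' [Cj [Hj Hjb]]]].
  assert (HCj : 0 <= Cj).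
  { eapply Rle_trans; [apply Rabs_pos|]. apply (Hjb 0). lra. }
  pose (Cj' := Cj + 1).
  pose (t1 := 2 * k1 / k0).
  assert (Hg : 0 < Cgain).
  { unfold Cgain. assert (0 < p * k1 / K p) by (apply Rdiv_lt_0_compat; nra).
    apply Rdiv_lt_0_compat; [apply Rmult_lt_0_compat|]; lra. }
  assert (Ht1 : 0 < t1) by (apply Rdiv_lt_0_compat; lra).
  pose (X := 4 * C1 * C1 * p / k0 + 2 * t1 * C1 * Cj' + 2 * (t1 * Cr * Cj' + Cj') + 4 * Cgain).
  assert (HX : 0 < X).
  { unfold X. assert (0 < 4 * C1 * C1 * p / k0) by (apply Rdiv_lt_0_compat; [repeat apply Rmult_lt_0_compat|]; lra).
    assert (0 < t1 * C1 * Cj') by (apply Rmult_lt_0_compat; [apply Rmult_lt_0_compat|]; unfold Cj'; lra).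
    assert (0 < t1 * Cr * Cj') by (apply Rmult_lt_0_compat; [apply Rmult_lt_0_compat|]; unfold Cj'; lra).
    unfold Cj' in *. lra. }
  pose (Y := p * X + 4 * Cj').
  assert (HY : 0 < Y) by (unfold Y, Cj'; nra).
  (* A lower bound for [INR N * beta0], hence for [beta]. Its summands give in turn [steep], the
     hypothesis [Cgain <= beta], the bound [Y / beta <= eps / 2], and the bound [eps] on the
     displacement of [theta]. *)
  pose (B := 4 * C1 / k0 + Cgain + 2 * Y / eps + 4 * C1 * p / k0 / eps).
  assert (HB1 : 0 < 4 * C1 / k0) by (apply Rdiv_lt_0_compat; lra).
  assert (HB2 : 0 < 2 * Y / eps) by (apply Rdiv_lt_0_compat; lra).
  assert (HB3 : 0 < 4 * C1 * p / k0 / eps) by (repeat apply Rdiv_lt_0_compat; try apply Rmult_lt_0_compat; lra).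
  destruct (nfloor_ex (B / beta0)) as [n [_ Hn]]; [apply Rdiv_le_0_compat; unfold B; lra|].
  rewrite <- S_INR in Hn.
  assert (HNB : B <= INR (S n) * beta0) by (apply Rlt_le, Rlt_div_l; easy).
  exists (S n).
  assert (HN : steep (S n)).
  { unfold steep. replace (4 * C1) with (4 * C1 / k0 * k0) by (field; lra).
    apply Rmult_le_compat_r; [lra|]. unfold B in HNB. lra. }
  split; [easy|]. intros xi Hxi.
  pose proof (beta_lower (S n) xi Hxi) as Hbl. set (be := beta (S n) xi) in *.
  assert (Hbe : B <= be) by lra. unfold B in Hbe.
  split.
  - intros x. pose proof (theta_close Halpha HN Hxi x) as Hc. fold be in Hc.
    assert (H3 : 4 * C1 * p <= be * k0 * eps).
    { replace (4 * C1 * p) with (4 * C1 * p / k0 / eps * (k0 * eps)) by (field; lra).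
      rewrite (Rmult_assoc be). apply Rmult_le_compat_r; [nra|lra]. }
    apply Rmult_le_reg_l with (be * k0); [nra|lra].
  - intros x i Hx.
    eapply Rle_trans.
    + apply (average_estimate Halpha HN Hxi j j' e1 Cj' Cr i); auto; try (unfold Cj'; lra).
      * intros y Hy. destruct (Hjb y Hy) as [J1 [J2 J3]]. unfold Cj'. repeat split; lra.
      * intros y. now apply HrC.
      * fold be. lra.
    + fold be. fold t1. fold X.
      replace (p * (2 * e1 + X / be) + 4 * Cj' / be) with (e1 * (4 * p) / 2 + Y / be)
        by (unfold Y; field; lra).
      assert (Y / be <= eps / 2).
      { apply Rle_div_l; [lra|]. replace Y with (2 * Y / eps * (eps / 2)) by (field; lra).
        rewrite Rmult_comm. apply Rmult_le_compat_l; lra. }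
      lra.
Qed.

(** * Closing the curve by the choice of the parameter *)

(** As [w] has integral zero over the period, [w + xi] has integral exactly [p] times [xi]. Once the
    integral of [T] is close enough to that, its coordinates have the signs required by
    Poincare-Miranda on the faces of the box. The last clause, with [u = theta x], is [Gam_dot_v]
    after the reparametrization. *)
Lemma closed_wiggle (w : R -> vec) eps : reg_le 2 alpha -> 0 < rho -> 0 < eps ->
  (forall xi x i, v xi x i = w x i + xi i) ->
  (forall i x, continuous (fun x => w x i) x) ->
  (forall i, prim (fun x => w x i) p = 0) ->
  exists (xi : vec) (tg dtg : R -> vec) (c : R),
    in_box rho xi /\ 0 < c /\
    (forall i, periodic p (fun x => tg x i)) /\
    (forall n i, reg_le (S (S n)) alpha -> Ck (S n) (fun x => tg x i)) /\
    (forall x i, is_derive (fun x => tg x i) x (dtg x i)) /\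
    (forall x, nrm (dtg x) = c * kappa x) /\
    (forall x, dot (tg x) (tg x) = 1) /\
    (forall i, prim (fun x => tg x i) p = 0) /\
    (forall x i, 0 <= x <= p ->
       Rabs (prim (fun x => tg x i) x - prim (fun x => w x i) x) <= eps + rho * p) /\
    (forall x, exists u, Rabs (u - x) <= eps /\ dot (tg x) (v xi u) = dot (v xi u) (v xi u)).
Proof.
  intros Halpha Hrho Heps Hv Hw Hw0. pose proof (wd_p W) as Hp.
  assert (Hprim : forall xi x i, prim (fun x => v xi x i) x = prim (fun x => w x i) x + xi i * x).
  { intros xi x i.
    assert (Hc : forall y, continuous (fun x => v xi x i) y).
    { intros y. apply (continuous_ext (fun x => w x i + xi i)); [now intros; rewrite Hv|].
      apply (continuous_plus (V := R_NormedModule)); [apply Hw|apply continuous_const]. }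
    pose (D := fun x => prim (fun x => v xi x i) x - (prim (fun x => w x i) x + xi i * x)).
    assert (E : D x = D 0).
    { apply derive_zero_const. intros z. unfold D.
      replace 0 with (v xi z i - (w z i + xi i * 1)) by (rewrite Hv; ring).
      apply @is_derive_minus; [now apply (is_derive_prim (fun x => v xi x i))|].
      apply @is_derive_plus; [apply (is_derive_prim (fun x => w x i)), Hw|].
      apply is_derive_scal. apply @is_derive_id. }
    unfold D in E. rewrite !prim_0 in E. lra. }
  (* An error of [p * rho / 2] cannot change the sign of the integral on a face, where the
     coordinate is [p * rho] or its opposite. *)
  destruct (wiggle_average (Rmin eps (p * rho / 2)) Halpha) as [N [HN HA]].
  { apply Rmin_pos; [easy|nra]. }
  pose proof (Rmin_l eps (p * rho / 2)) as Hm1. pose proof (Rmin_r eps (p * rho / 2)) as Hm2.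
  set (e := Rmin eps (p * rho / 2)) in *.
  destruct (wiggle_lipschitz N Halpha HN) as [L [HL HLip]].
  assert (HF : forall xi i, in_box rho xi ->
    Rabs (prim (fun x => T N xi x i) p - xi i * p) <= p * rho / 2).
  { intros xi i Hxi. destruct (HA xi Hxi) as [_ H]. specialize (H p i ltac:(lra)).
    rewrite Hprim, Hw0 in H. replace (0 + xi i * p) with (xi i * p) in H by ring. lra. }
  destruct (poincare_miranda rho L (fun xi i => prim (fun x => T N xi x i) p)) as [xi [Hxi H0]]; auto.
  { intros xi i Hxi E. specialize (HF xi i Hxi). rewrite E in HF.
    apply Rabs_le_between in HF. nra. }
  { intros xi i Hxi E. specialize (HF xi i Hxi). rewrite E in HF.
    apply Rabs_le_between in HF. nra. }
  destruct (HA xi Hxi) as [HA1 HA2].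
  exists xi, (T N xi), (@dT N xi), (ratio N xi).
  split; [easy|]. split; [now apply ratio_pos|].
  split; [intros i; now apply T_periodic|].
  split; [intros n i Hn; now apply Ck_T|].
  split; [intros x i; now apply T_derive|].
  split; [intros x; now apply dT_nrm|].
  split; [intros x; now apply T_unit|].
  split; [easy|]. split.
  - intros x i Hx. specialize (HA2 x i Hx). rewrite Hprim in HA2.
    replace (prim (fun x => T N xi x i) x - prim (fun x => w x i) x) with
      ((prim (fun x => T N xi x i) x - (prim (fun x => w x i) x + xi i * x)) + xi i * x) by ring.
    apply Rabs_plus_le; [lra|]. apply Rabs_mult_le; [apply Hxi|]. rewrite Rabs_right; lra.
  - intros x. exists (theta N xi x). split; [specialize (HA1 x); lra|].
    now apply Gam_dot_v.
Qed.

End Wiggle.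

(** * Embeddings close to a given one *)

Lemma is_derive_continuous (h k : R -> R) : (forall x, is_derive h x (k x)) -> forall x, continuous h x.
Proof.
  intros H x. apply (ex_derive_continuous (K := R_AbsRing) (V := R_NormedModule)).
  exists (k x). apply H.
Qed.

(** The vector [e] is found once, for [w], and serves all translates [w + xi] with [xi] in a small
    box. [rho0] is fixed before [C1], so the box may still be shrunk to suit the embedding. *)
Lemma frame_wiggle_data alpha p (w w' : R -> vec) kappa :
  0 < p ->
  (forall i x, is_derive (fun x => w x i) x (w' x i)) ->
  (forall i x, continuous (fun x => w' x i) x) ->
  (forall i, periodic p (fun x => w x i)) ->
  (forall n i, reg_le (S (S n)) alpha -> Ck (S n) (fun x => w x i)) ->
  (forall x, 0 < dot (w x) (w x) <= 1 / 4) ->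
  (forall x, continuous kappa x) -> periodic p kappa -> (forall x, 0 < kappa x) ->
  (forall n, reg_le (S (S n)) alpha -> Ck n kappa) ->
  exists rho0, 0 < rho0 /\ forall rho, 0 < rho <= rho0 ->
    exists r0 k0 k1 a b r C1,
      wiggle_data alpha rho p r0 k0 k1 (fun xi x i => w x i + xi i) a b r kappa C1.
Proof.
  intros Hp Hw Hw'c Hper HCk Hdot Hkc Hkper Hkpos HkCk.
  assert (Hwc : forall i x, continuous (fun x => w x i) x).
  { intros i. apply (is_derive_continuous _ (fun x => w' x i)). intros x. apply Hw. }
  assert (Hper' : forall i, periodic p (fun x => w' x i)).
  { intros i x. rewrite <- (is_derive_unique _ _ _ (Hw i x)), <- (is_derive_unique _ _ _ (Hw i (x + p))).
    now apply (Derive_periodic p (fun x => w x i)). }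
  assert (HB : exists C, 0 < C /\ forall i x, Rabs (w x i) <= C /\ Rabs (w' x i) <= C).
  { assert (H : forall i, exists C, 0 < C /\ forall x, Rabs (w x i) <= C /\ Rabs (w' x i) <= C).
    { intros i.
      destruct (periodic_bounded p (fun x => w x i)) as [D [HD B1]]; auto.
      destruct (periodic_bounded p (fun x => w' x i)) as [D' [HD' B2]]; auto.
      exists (D + D'). split; [lra|]. intros x. specialize (B1 x). specialize (B2 x). lra. }
    destruct (H ax1) as [D1 [P1 H1]], (H ax2) as [D2 [P2 H2]], (H ax3) as [D3 [P3 H3]].
    exists (D1 + D2 + D3). split; [lra|]. intros i x.
    destruct (H1 x), (H2 x), (H3 x). destruct i; lra. }
  destruct HB as [C [HC HB]].
  assert (Hdotc : forall (u z : R -> vec), (forall i x, continuous (fun x => u x i) x) ->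
    (forall i x, continuous (fun x => z x i) x) -> forall x, continuous (fun x => dot (u x) (z x)) x).
  { intros u z Hu Hz x. apply (Ck_continuous 0). unfold dot.
    repeat apply (Ck_plus 0); apply (Ck_mult 0); simpl; auto. }
  destruct (periodic_positive_min p (fun x => dot (w x) (w x))) as [m1 [Hm1 Hwm]]; auto.
  { intros x. unfold dot. now rewrite !(Hper _ x). }
  { intros x. apply Hdot. }
  destruct (transverse_direction w p C (sqrt m1)) as [e He]; auto.
  { now apply sqrt_lt_R0. }
  { intros i. apply (derive_bounded_lipschitz _ (fun x => w' x i)); [apply Hw|apply HB]. }
  { intros x. rewrite sqrt_sqrt; [apply Hwm|lra]. }
  destruct (periodic_positive_min p (fun x => dot (cross (w x) e) (cross (w x) e))) as [m2 [Hm2 Hwm2]]; auto.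
  { intros x. unfold dot, cross. simpl. now rewrite !(Hper _ x). }
  { apply Hdotc; intros i y; apply (Ck_continuous 0); unfold cross; destruct i; simpl mkvec;
      apply Ck_minus; apply Ck_mult; try apply Ck_const; intros z; apply Hwc. }
  destruct (periodic_positive_min p kappa) as [k0 [Hk0 Hk0']]; auto.
  destruct (periodic_bounded p kappa) as [k1 [Hk1 Hk1']]; auto.
  pose (m := Rmin m1 m2).
  assert (Hm : 0 < m) by (now apply Rmin_pos).
  destruct (frame_nondegenerate w e m) as [rho0 [Hrho0 Hnd]]; auto.
  { intros x. split; [|apply Hdot]. eapply Rle_trans; [apply Rmin_l|apply Hwm]. }
  { intros x. eapply Rle_trans; [apply Rmin_r|apply Hwm2]. }
  exists rho0. split; [easy|]. intros rho Hrho.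
  pose (V := fun (xi : vec) x i => w x i + xi i).
  assert (HV : forall i, tame alpha rho p (fun xi x => V xi x i)).
  { intros i. unfold V. apply tame_plus; [|apply tame_coord].
    apply (tame_fixed _ _ _ _ (fun x => w' x i) C); auto; intros x; apply HB. }
  (* Turns the bound 3/4 on the squared norm of [V] into the bound [1 - m / 4] of [frame_tame]. *)
  assert (Hm4 : m / 4 <= 1 / 4).
  { pose proof (Hwm 0). pose proof (Hdot 0). pose proof (Rmin_l m1 m2). unfold m. lra. }
  destruct (frame_tame alpha rho p e (m / 4) V) as [Tr [Ta Tb]]; [lra|easy| |].
  { intros xi x Hxi. destruct (Hnd rho Hrho xi x Hxi) as [N1 N2].
    unfold V. split; [split; lra|easy]. }
  assert (HC1 : exists C1, 0 < C1 /\ forall xi x i, in_box rho xi ->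
    Rabs (Derive (fun x => V xi x i) x) + Rabs (Derive (fun x => frame_a e (V xi x) i) x)
    + Rabs (Derive (fun x => frame_b e (V xi x) i) x) <= C1).
  { assert (H : forall i, exists C1, 0 < C1 /\ forall xi x, in_box rho xi ->
      Rabs (Derive (fun x => V xi x i) x) + Rabs (Derive (fun x => frame_a e (V xi x) i) x)
      + Rabs (Derive (fun x => frame_b e (V xi x) i) x) <= C1).
    { intros i.
      destruct (tame_Derive _ _ _ _ Hp (HV i)) as [_ [_ [_ [D1 [P1 H1]]]]].
      destruct (tame_Derive _ _ _ _ Hp (Ta i)) as [_ [_ [_ [D2 [P2 H2]]]]].
      destruct (tame_Derive _ _ _ _ Hp (Tb i)) as [_ [_ [_ [D3 [P3 H3]]]]].
      exists (D1 + D2 + D3). split; [lra|]. intros xi x Hxi.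
      destruct (H1 xi x Hxi), (H2 xi x Hxi), (H3 xi x Hxi). lra. }
    destruct (H ax1) as [D1 [P1 H1]], (H ax2) as [D2 [P2 H2]], (H ax3) as [D3 [P3 H3]].
    exists (D1 + D2 + D3). split; [lra|]. intros xi x i Hxi.
    specialize (H1 xi x Hxi). specialize (H2 xi x Hxi). specialize (H3 xi x Hxi). destruct i; lra. }
  destruct HC1 as [C1 [HC1 Hslow]].
  (* The squared norm of [V] is at most 3/4, so the radius is at least 1/2. *)
  exists (1 / 2), k0, k1, (fun xi x => frame_a e (V xi x)), (fun xi x => frame_b e (V xi x)),
    (fun xi x => frame_r (V xi x)), C1.
  change (fun (xi : vec) x i => w x i + xi i) with V.
  constructor; auto; try lra.
  - intros xi x Hxi. destruct (Hnd rho Hrho xi x Hxi) as [N1 _].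
    pose proof (dot_pos (V xi x)). unfold frame_r. split.
    + replace (1 / 2) with (sqrt (1 / 2 * (1 / 2))) by (apply sqrt_square; lra).
      apply sqrt_le_1_alt. unfold V. lra.
    + rewrite <- sqrt_1 at 2. apply sqrt_le_1_alt. lra.
  - intros xi x Hxi. destruct (Hnd rho Hrho xi x Hxi) as [N1 N2].
    apply frame_orthogonal; unfold V; lra.
  - intros x. split; [apply Hk0'|]. specialize (Hk1' x). pose proof (Rle_abs (kappa x)). lra.
Qed.

Definition vsub (u v : vec) : vec := fun i => u i - v i.

Lemma nrm_minus_lower u v : nrm v - nrm (vsub u v) <= nrm u.
Proof.
  pose proof (nrm_plus_close (vsub u v) v) as H. apply Rabs_le_between in H.
  replace (fun i => vsub u v i + v i) with u in H; [lra|].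
  apply functional_extensionality. intros i. unfold vsub. ring.
Qed.

Lemma nrm_vsub_sym u v : nrm (vsub u v) = nrm (vsub v u).
Proof. unfold nrm. f_equal. unfold dot, vsub. ring. Qed.

Lemma nrm_plus_le u v : nrm (fun i => u i + v i) <= nrm u + nrm v.
Proof. pose proof (nrm_plus_close u v) as H. apply Rabs_le_between in H. lra. Qed.

Lemma nrm_scal c u : 0 <= c -> nrm (fun i => c * u i) = c * nrm u.
Proof.
  intros Hc. unfold nrm.
  replace (c * sqrt (dot u u)) with (sqrt (c * c) * sqrt (dot u u)) by (now rewrite sqrt_square).
  rewrite <- sqrt_mult_alt by nra.
  f_equal. unfold dot. ring.
Qed.

Lemma nrm_zero u : nrm u = 0 -> forall i, u i = 0.
Proof.
  intros H i. pose proof (coord_le_nrm u i) as Hi. rewrite H in Hi.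
  pose proof (Rabs_pos (u i)). destruct (Req_dec (u i) 0) as [|n]; [easy|].
  apply Rabs_no_R0 in n. lra.
Qed.

(** Chord lengths are positive by injectivity and Lipschitz in both parameters, so compactness of
    the pairs away from the diagonal bounds them below. Offsets up to [p / 2] suffice, as any pair
    can be brought there modulo the period. *)
Lemma embedding_separated p (f : R -> vec) C delta : 0 < p -> 0 < C -> 0 < delta ->
  (forall i, periodic p (fun x => f x i)) ->
  (forall i x y, Rabs (f x i - f y i) <= C * Rabs (x - y)) ->
  (forall x y, (forall i, f x i = f y i) -> exists k : Z, x - y = IZR k * p) ->
  exists m, 0 < m /\ forall x d, delta <= d <= p / 2 -> m <= nrm (vsub (f (x + d)) (f x)).
Proof.
  intros Hp HC Hdelta Hper Hlip Hinj.
  pose (g := fun x d => nrm (vsub (f (x + d)) (f x))).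
  assert (Hgpos : forall x d, delta <= d <= p / 2 -> 0 < g x d).
  { intros x d Hd. destruct (Rle_lt_or_eq_dec 0 (g x d) (nrm_pos _)) as [|E]; [easy|].
    destruct (Hinj (x + d) x) as [k Hk].
    { intros i. pose proof (nrm_zero _ (eq_sym E) i) as Hi. unfold vsub in Hi. lra. }
    replace (x + d - x) with d in Hk by ring.
    assert (0 < IZR k) by nra. assert (IZR k < 1) by nra.
    apply lt_IZR in H, H0. lia. }
  assert (Hglip : forall x d u v e, Rabs (x - u) <= e -> Rabs (d - v) <= e ->
    g u v - 6 * C * e <= g x d).
  { intros x d u v e Hx Hd.
    pose proof (nrm_minus_lower (vsub (f (x + d)) (f x)) (vsub (f (u + v)) (f u))) as H.
    assert (H' : nrm (vsub (vsub (f (x + d)) (f x)) (vsub (f (u + v)) (f u))) <= 2 * (3 * C * e)).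
    { apply nrm_le_coords. intros i. unfold vsub.
      replace (f (x + d) i - f x i - (f (u + v) i - f u i)) with
        ((f (x + d) i - f (u + v) i) - (f x i - f u i)) by ring.
      assert (Hs : Rabs (x + d - (u + v)) <= e + e).
      { replace (x + d - (u + v)) with ((x - u) + (d - v)) by ring.
        apply Rabs_plus_le; easy. }
      pose proof (Hlip i (x + d) (u + v)). pose proof (Hlip i x u).
      eapply Rle_trans; [apply (Rabs_minus_le _ _ (C * (e + e)) (C * e)); nra|lra]. }
    unfold g. lra. }
  (* Within this gauge of [(u, v)], [g] loses at most half of [g u v], and keeps at least [6 * C]
     times the gauge. *)
  pose (gauge := fun u v => if Rlt_dec 0 (g u v) then g u v / (12 * C) else 1).
  assert (Hgauge : forall u v, 0 < gauge u v).
  { intros u v. unfold gauge. destruct Rlt_dec; [apply Rdiv_lt_0_compat|]; lra. }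
  destruct (compactness_value_2d 0 p delta (p / 2) (fun u v => mkposreal _ (Hgauge u v)))
    as [d0 Hd0]. simpl in Hd0.
  pose proof (cond_pos d0) as Hd0p.
  exists (6 * C * d0). split; [nra|]. intros x d Hd. revert x.
  apply (periodic_forall p (fun x => g x d) (fun y => 6 * C * d0 <= y)); [easy| |].
  { intros x. unfold g, nrm, dot, vsub. replace (x + p + d) with (x + d + p) by ring.
    now rewrite !(Hper _ x), !(Hper _ (x + d)). }
  intros x Hx. apply Rnot_lt_le. intros Hlt. apply (Hd0 x d Hx Hd).
  intros [u [v [Hu [Hv [Hxu [Hdv Hle]]]]]].
  unfold gauge in *. destruct (Rlt_dec 0 (g u v)) as [Hguv|n]; [|now apply n, Hgpos].
  assert (E : g u v = 12 * C * (g u v / (12 * C))) by (field; lra).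
  pose proof (Hglip x d u v _ (Rlt_le _ _ Hxu) (Rlt_le _ _ Hdv)).
  set (q := g u v / (12 * C)) in *. nra.
Qed.

(* Near the diagonal the component of [A f + B h] along [f' x] is monotone; away
   from it [A f + B h] is too close to [(A + B) f] to have a double point. *)
Lemma cone_embedding p (f h f' h' : R -> vec) delta m A B :
  0 < p -> 0 < m ->
  (forall i x, is_derive (fun x => f x i) x (f' x i)) ->
  (forall i x, is_derive (fun x => h x i) x (h' x i)) ->
  (forall i, periodic p (fun x => f x i)) -> (forall i, periodic p (fun x => h x i)) ->
  (forall x y, Rabs (x - y) <= delta -> 0 < dot (f' y) (f' x) /\ 0 < dot (h' y) (f' x)) ->
  (forall x d, delta <= d <= p / 2 -> m <= nrm (vsub (f (x + d)) (f x))) ->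
  (forall x, nrm (vsub (h x) (f x)) <= m / 3) ->
  0 <= A -> 0 <= B -> 0 < A + B ->
  forall x y, (forall i, A * f x i + B * h x i = A * f y i + B * h y i) ->
  exists k : Z, x - y = IZR k * p.
Proof.
  intros Hp Hm Hf Hh Pf Ph Hcone Hsep Hclose HA HB HAB.
  assert (Hnear : forall x y, x < y -> y - x <= delta ->
    ~ (forall i, A * f x i + B * h x i = A * f y i + B * h y i)).
  { intros x y Hxy Hd E.
    destruct (mvt (fun z => dot (fun i => A * f z i + B * h z i) (f' x))
      (fun z => dot (fun i => A * f' z i + B * h' z i) (f' x)) x y) as [c [Hc1 Hc2]]; [lra| |].
    - intros z _.
      assert (Hi : forall i, is_derive (fun z => (A * f z i + B * h z i) * f' x i) z
        ((A * f' z i + B * h' z i) * f' x i)).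
      { intros i. rewrite (Rmult_comm _ (f' x i)).
        apply (is_derive_ext (fun z => f' x i * (A * f z i + B * h z i)));
          [intros; apply Rmult_comm|].
        apply is_derive_scal. apply @is_derive_plus; apply is_derive_scal; auto. }
      unfold dot. apply @is_derive_plus; [apply @is_derive_plus|]; apply Hi.
    - assert (E0 : dot (fun i => A * f y i + B * h y i) (f' x) - dot (fun i => A * f x i + B * h x i) (f' x) = 0).
      { unfold dot. rewrite !E. ring. }
      rewrite E0 in Hc2.
      destruct (Hcone x c) as [C1 C2]; [rewrite Rabs_left1; lra|].
      assert (EL : dot (fun i => A * f' c i + B * h' c i) (f' x) =
        A * dot (f' c) (f' x) + B * dot (h' c) (f' x)) by (unfold dot; ring).
      assert (0 < A * dot (f' c) (f' x) + B * dot (h' c) (f' x)).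
      { destruct (Rle_lt_or_eq_dec 0 A HA) as [HA'| <-]; nra. }
      nra. }
  assert (Hfar : forall x y, x < y -> y - x <= p / 2 ->
    ~ (forall i, A * f x i + B * h x i = A * f y i + B * h y i)).
  { intros x y Hxy Hd E.
    destruct (Rle_dec (y - x) delta) as [Hle|Hgt]; [now apply (Hnear x y)|].
    assert (Hs : m <= nrm (vsub (f y) (f x))).
    { replace y with (x + (y - x)) by ring. apply Hsep. lra. }
    (* At a double point, $(A+B)(f(y)-f(x))$ is $B$ times the sum of the two deviations of [h] from
       [f], of norm at most [B * (2 * m / 3)], less than [(A + B) * m]. *)
    assert (E1 : (A + B) * nrm (vsub (f y) (f x)) =
      B * nrm (fun i => vsub (h x) (f x) i + vsub (f y) (h y) i)).
    { rewrite <- !nrm_scal by lra. f_equal. apply functional_extensionality. intros i.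
      unfold vsub. specialize (E i). lra. }
    pose proof (nrm_plus_le (vsub (h x) (f x)) (vsub (f y) (h y))) as H.
    rewrite (nrm_vsub_sym (f y)) in H. pose proof (Hclose x). pose proof (Hclose y).
    nra. }
  intros x y E. destruct (reduce_mod_centered p (x - y) Hp) as [k Hk].
  exists k.
  assert (E' : forall i, A * f x i + B * h x i = A * f (y + IZR k * p) i + B * h (y + IZR k * p) i).
  { intros i. rewrite (periodic_Z p _ (Pf i)), (periodic_Z p _ (Ph i)). apply E. }
  apply Rabs_le_between in Hk.
  destruct (Rtotal_order x (y + IZR k * p)) as [Hlt|[Heq|Hgt]].
  - exfalso. apply (Hfar _ _ Hlt); [lra|easy].
  - lra.
  - exfalso. apply (Hfar _ _ Hgt); [lra|]. intros i. symmetry. apply E'.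
Qed.

(** * Linear isotopies *)

Definition to_R3 (u : vec) : R3 := vec3 (u ax1) (u ax2) (u ax3).

Definition of_R3 (q : R3) : vec := mkvec (fst (fst q)) (snd (fst q)) (snd q).

Lemma to_of_R3 q : to_R3 (of_R3 q) = q.
Proof. now destruct q as [[x y] z]. Qed.

Lemma norm_to_R3 u : norm (to_R3 u) = nrm u.
Proof. unfold to_R3. rewrite norm_R3. unfold nrm. f_equal. unfold dot. ring. Qed.

Lemma deriv_n_to_R3 n (g : R -> vec) x :
  deriv_n n (fun x => to_R3 (g x)) x = to_R3 (fun i => Derive_n (fun x => g x i) n x).
Proof. easy. Qed.

Lemma deriv_to_R3 (g g' : R -> vec) x :
  (forall i, is_derive (fun x => g x i) x (g' x i)) ->
  deriv (fun x => to_R3 (g x)) x = to_R3 (g' x).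
Proof.
  intros H. unfold deriv. rewrite deriv_n_to_R3. unfold to_R3.
  f_equal; simpl; now rewrite (is_derive_unique _ _ _ (H _)).
Qed.

Lemma C_circle_to_R3 alpha p (g : R -> vec) :
  C_circle alpha p (fun x => to_R3 (g x)) <->
  (forall i, periodic p (fun x => g x i)) /\
  (forall n i, reg_le n alpha -> Ck n (fun x => g x i)).
Proof.
  split.
  - intros [Hp [H1 [H2 H3]]]. split.
    + intros i x. specialize (Hp x).
      apply (f_equal of_R3) in Hp. apply (f_equal (fun u => u i)) in Hp. now destruct i.
    + intros n i Hn. destruct i.
      * now apply (C_real_Ck alpha (coord1 (fun x => to_R3 (g x)))).
      * now apply (C_real_Ck alpha (coord2 (fun x => to_R3 (g x)))).
      * now apply (C_real_Ck alpha (coord3 (fun x => to_R3 (g x)))).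
  - intros [Hp H]. split; [|split; [|split]].
    + intros x. unfold to_R3. now rewrite !(Hp _ x).
    + apply C_real_Ck. intros n Hn. now apply (H n ax1).
    + apply C_real_Ck. intros n Hn. now apply (H n ax2).
    + apply C_real_Ck. intros n Hn. now apply (H n ax3).
Qed.

Lemma Derive_n_periodic p h k : periodic p h -> periodic p (Derive_n h k).
Proof.
  intros H. induction k as [|k IH]; [easy|]. now apply (Derive_periodic p (Derive_n h k)).
Qed.

Lemma Ck_bounded p n h : 0 < p -> periodic p h -> Ck n h ->
  exists M, 0 < M /\ forall k x, (k <= n)%nat -> Rabs (Derive_n h k x) <= M.
Proof.
  intros Hp Hper HC. pose proof (proj1 (Ck_Derive_n n h) HC) as H. clear HC.
  induction n as [|n IH].
  - destruct (periodic_bounded p h) as [M [HM HB]]; auto.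
    { intros x. apply (H 0%nat); lia. }
    exists M. split; [easy|]. intros k x Hk. replace k with 0%nat by lia. apply HB.
  - destruct IH as [M [HM HB]]; [intros k Hk; apply H; lia|].
    destruct (periodic_bounded p (Derive_n h (S n))) as [M' [HM' HB']]; auto.
    { now apply Derive_n_periodic. }
    { intros x. now apply H. }
    exists (M + M'). split; [lra|]. intros k x Hk.
    destruct (Nat.eq_dec k (S n)) as [->|].
    + specialize (HB' x). lra.
    + specialize (HB k x ltac:(lia)). lra.
Qed.

Lemma Cnorm_le n (g : R -> R3) M :
  (forall k x, (k <= n)%nat -> norm (deriv_n k g x) <= M) -> Rbar_le (Cnorm n g) M.
Proof.
  intros H. unfold Cnorm. apply Lub_Rbar_correct.
  intros r [k [x [Hk ->]]]. now apply H.
Qed.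

(** The curves at times $t$ and $t_0$ differ by $(t-t_0)(g-f)$, and the derivatives of $g-f$ up to a
    given order are bounded by periodicity. This covers [Smooth] too, because a neighbourhood
    involves a single order [n]. *)
Lemma isotopic_linear alpha p (f g : R -> vec) : 0 < p ->
  C_circle alpha p (fun x => to_R3 (f x)) -> C_circle alpha p (fun x => to_R3 (g x)) ->
  (forall t, 0 <= t <= 1 -> Emb alpha p (fun x => to_R3 (fun i => (1 - t) * f x i + t * g x i))) ->
  isotopic alpha p (fun x => to_R3 (f x)) (fun x => to_R3 (g x)).
Proof.
  intros Hp Hf Hg HE. exists (fun t x => to_R3 (fun i => (1 - t) * f x i + t * g x i)).
  split; [easy|]. split.
  2: { split; intros x; unfold to_R3; f_equal; ring. }
  intros t0 Ht0 U [n [Hn [eps HU]]].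
  apply C_circle_to_R3 in Hf, Hg. destruct Hf as [Pf Cf], Hg as [Pg Cg].
  assert (HM : exists M, 0 < M /\ forall i k x, (k <= n)%nat ->
    Rabs (Derive_n (fun x => g x i - f x i) k x) <= M).
  { assert (H : forall i, exists M, 0 < M /\ forall k x, (k <= n)%nat ->
      Rabs (Derive_n (fun x => g x i - f x i) k x) <= M).
    { intros i. apply (Ck_bounded p); [easy| |].
      - intros x. now rewrite (Pf i), (Pg i).
      - apply (Ck_minus n (fun x => g x i) (fun x => f x i)); [now apply Cg|now apply Cf]. }
    destruct (H ax1) as [D1 [P1 H1]], (H ax2) as [D2 [P2 H2]], (H ax3) as [D3 [P3 H3]].
    exists (D1 + D2 + D3). split; [lra|]. intros i k x Hk.
    specialize (H1 k x Hk). specialize (H2 k x Hk). specialize (H3 k x Hk). destruct i; lra. }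
  destruct HM as [M [HM HB]]. pose proof (cond_pos eps) as Heps.
  (* Coordinates bounded by [Rabs (t - t0) * M] give a norm below [eps / 2], so the supremum stays
     strictly below [eps]. *)
  assert (Hd : 0 < eps / (4 * M)) by (apply Rdiv_lt_0_compat; lra).
  exists (mkposreal _ Hd). intros t Ht Htd. apply HU; [apply HE; exact Htd|].
  assert (Ht' : Rabs (t - t0) < eps / (4 * M)) by exact Ht.
  apply Rbar_le_lt_trans with (Finite (2 * (Rabs (t - t0) * M))).
  - apply Cnorm_le. intros k x Hk.
    replace (fun x => minus (to_R3 (fun i => (1 - t) * f x i + t * g x i))
      (to_R3 (fun i => (1 - t0) * f x i + t0 * g x i))) with
      (fun x => to_R3 (fun i => (t - t0) * (g x i - f x i))).
    2: { apply functional_extensionality. intros y. unfold to_R3.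
         change (vec3 ((t - t0) * (g y ax1 - f y ax1)) ((t - t0) * (g y ax2 - f y ax2))
             ((t - t0) * (g y ax3 - f y ax3)) =
           vec3 ((1 - t) * f y ax1 + t * g y ax1 - ((1 - t0) * f y ax1 + t0 * g y ax1))
             ((1 - t) * f y ax2 + t * g y ax2 - ((1 - t0) * f y ax2 + t0 * g y ax2))
             ((1 - t) * f y ax3 + t * g y ax3 - ((1 - t0) * f y ax3 + t0 * g y ax3))).
         f_equal; ring. }
    rewrite deriv_n_to_R3, norm_to_R3. apply nrm_le_coords. intros i.
    rewrite (Derive_n_scal_l (fun x => g x i - f x i)).
    apply Rabs_mult_le; [lra|]. now apply HB.
  - simpl. apply (Rmult_lt_compat_r (4 * M)) in Ht'; [|lra].
    replace (eps / (4 * M) * (4 * M)) with (pos eps) in Ht' by (field; lra).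
    pose proof (Rabs_pos (t - t0)). nra.
Qed.

(** * From the spherical curve to the knot *)

(** With $v=w(u)+\xi$, the product of [tg y] with $v$ is $|v|^2\geq\mu/2-3\rho^2$, and replacing $v$
    by [w x] costs at most $4Ce+2\rho$. The hypotheses on [rho] and [e] leave at least $\mu/4$. *)
Lemma cone_of_derivatives (w tg : R -> vec) (xi : vec) mu C rho e : 0 < mu -> 0 < C ->
  in_box rho xi -> 0 < rho <= 1 -> 5 * rho <= mu / 8 -> 2 * C * e <= mu / 16 ->
  (forall x, mu <= dot (w x) (w x) <= 1 / 4) ->
  (forall i x y, Rabs (w x i - w y i) <= C * Rabs (x - y)) ->
  (forall x, dot (tg x) (tg x) = 1) ->
  (forall x, exists u, Rabs (u - x) <= e /\
     dot (tg x) (fun i => w u i + xi i) = dot (fun i => w u i + xi i) (fun i => w u i + xi i)) ->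
  forall x y, Rabs (x - y) <= e -> 0 < dot (w y) (w x) /\ 0 < dot (tg y) (w x).
Proof.
  intros Hmu HC Hxi Hrho Hrmu HCe Hw Hlip Htg Hu x y Hxy.
  assert (Hnl : forall x y d, Rabs (x - y) <= d -> nrm (vsub (w x) (w y)) <= 2 * (C * d)).
  { intros x' y' d Hd. apply nrm_le_coords. intros i. eapply Rle_trans; [apply Hlip|].
    apply Rmult_le_compat_l; lra. }
  assert (He : 0 <= e) by (pose proof (Rabs_pos (x - y)); lra).
  split.
  - assert (E : dot (w y) (w x) = dot (w y) (w y) + dot (w y) (vsub (w x) (w y)))
      by (unfold dot, vsub; ring).
    pose proof (dot_le_nrm (w y) (vsub (w x) (w y))) as H. apply Rabs_le_between in H.
    pose proof (Hnl x y e Hxy) as H1.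
    assert (H2 : nrm (w y) <= 1).
    { unfold nrm. rewrite <- sqrt_1. apply sqrt_le_1_alt. specialize (Hw y). lra. }
    pose proof (nrm_pos (w y)). pose proof (nrm_pos (vsub (w x) (w y))).
    specialize (Hw y). nra.
  - destruct (Hu y) as [u [Hu1 Hu2]]. set (v := fun i => w u i + xi i) in *.
    assert (E : dot (tg y) (w x) = dot v v + dot (tg y) (vsub (w x) v))
      by (rewrite <- Hu2; unfold dot, vsub; ring).
    pose proof (dot_le_nrm (tg y) (vsub (w x) v)) as H. apply Rabs_le_between in H.
    assert (H1 : nrm (tg y) = 1) by (unfold nrm; rewrite Htg; apply sqrt_1).
    rewrite H1, Rmult_1_l in H.
    assert (H2 : nrm (vsub (w x) v) <= 2 * (C * (2 * e)) + 2 * rho).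
    { replace (vsub (w x) v) with (fun i => vsub (w x) (w u) i + - xi i)
        by (apply functional_extensionality; intros i; unfold vsub, v; ring).
      eapply Rle_trans; [apply nrm_plus_le|]. apply Rplus_le_compat.
      - apply Hnl. replace (x - u) with ((x - y) - (u - y)) by ring.
        replace (2 * e) with (e + e) by ring. now apply Rabs_minus_le.
      - apply nrm_le_coords. intros i. rewrite Rabs_Ropp. apply Hxi. }
    pose proof (half_dot_le (w u) xi) as H3. fold v in H3.
    pose proof (dot_box rho xi Hxi) as H4. specialize (Hw u). nra.
Qed.

(** The choices depend on one another in this order: [delta], below which the direction of the
    tangent hardly varies; [m], the separation of points of the knot at parameters at least [delta]
    apart; then [rho] and [eps]; and the number of turns last. *)
Lemma prescribed_curvature alpha p (F : R -> vec) kappa :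
  0 < p -> reg_le 2 alpha -> Emb alpha p (fun x => to_R3 (F x)) ->
  C_circle_R (reg_minus2 alpha) p kappa -> (forall x, 0 < kappa x) ->
  exists (g tg dtg : R -> vec) c, 0 < c /\
    Emb alpha p (fun x => to_R3 (g x)) /\
    isotopic alpha p (fun x => to_R3 (F x)) (fun x => to_R3 (g x)) /\
    (forall i x, is_derive (fun x => g x i) x (c * tg x i)) /\
    (forall i x, is_derive (fun x => tg x i) x (dtg x i)) /\
    (forall x, nrm (tg x) = 1) /\ (forall x, nrm (dtg x) = c * kappa x).
Proof.
  intros Hp Halpha [[HFC HFimm] HFinj] [Hkper Hkreal] Hkpos.
  pose proof HFC as HFC0. apply C_circle_to_R3 in HFC. destruct HFC as [HFper HFCk].
  pose (F' := fun x i => Derive (fun x => F x i) x).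
  pose (F'' := fun x i => Derive (fun x => F' x i) x).
  assert (HF2 : forall i, Ck 2 (fun x => F x i)) by (intros i; now apply HFCk).
  assert (DF : forall i x, is_derive (fun x => F x i) x (F' x i)).
  { intros i x. apply Derive_correct. apply (HF2 i). }
  assert (DF' : forall i x, is_derive (fun x => F' x i) x (F'' x i)).
  { intros i x. apply Derive_correct. destruct (HF2 i) as [_ [H _]]. apply H. }
  assert (CF'' : forall i x, continuous (fun x => F'' x i) x).
  { intros i. destruct (HF2 i) as [_ [_ H]]. exact H. }
  assert (PF' : forall i, periodic p (fun x => F' x i)).
  { intros i. apply (Derive_periodic p (fun x => F x i)), HFper. }
  assert (PF'' : forall i, periodic p (fun x => F'' x i)).
  { intros i. apply (Derive_periodic p (fun x => F' x i)), PF'. }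
  assert (CkF' : forall n i, reg_le (S (S n)) alpha -> Ck (S n) (fun x => F' x i)).
  { intros n i Hn. apply (HFCk (S (S n)) i Hn). }
  assert (CF' : forall i x, continuous (fun x => F' x i) x).
  { intros i. apply (is_derive_continuous _ (fun x => F'' x i)), DF'. }
  assert (HF'pos : forall x, 0 < dot (F' x) (F' x)).
  { intros x. destruct (Rle_lt_or_eq_dec 0 _ (dot_pos (F' x))) as [|E]; [easy|].
    exfalso. apply (HFimm x). rewrite (deriv_to_R3 F F') by auto.
    assert (Z : forall i, F' x i = 0).
    { apply nrm_zero. unfold nrm. rewrite <- E. apply sqrt_0. }
    unfold to_R3. now rewrite !Z. }
  assert (HB : forall G : R -> vec, (forall i, periodic p (fun x => G x i)) ->
    (forall i x, continuous (fun x => G x i) x) ->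
    exists C, 0 < C /\ forall i x, Rabs (G x i) <= C).
  { intros G HG1 HG2.
    destruct (periodic_bounded p (fun x => G x ax1)) as [D1 [P1 H1]]; auto.
    destruct (periodic_bounded p (fun x => G x ax2)) as [D2 [P2 H2]]; auto.
    destruct (periodic_bounded p (fun x => G x ax3)) as [D3 [P3 H3]]; auto.
    exists (D1 + D2 + D3). split; [lra|]. intros i x.
    specialize (H1 x). specialize (H2 x). specialize (H3 x). destruct i; lra. }
  destruct (HB F' PF' CF') as [C0 [HC0 BF']]. destruct (HB F'' PF'' CF'') as [C2 [HC2 BF'']].
  (* Gives the squared norm of [w] the bound [3 / 16], below the [1 / 4] required for the frame. *)
  pose (lam := / (4 * C0)). assert (Hlam : 0 < lam) by (apply Rinv_0_lt_compat; lra).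
  pose (f := fun x i => lam * F x i). pose (w := fun x i => lam * F' x i).
  pose (w' := fun x i => lam * F'' x i).
  assert (Df : forall i x, is_derive (fun x => f x i) x (w x i)).
  { intros i x. apply is_derive_scal, DF. }
  assert (Dw : forall i x, is_derive (fun x => w x i) x (w' x i)).
  { intros i x. apply is_derive_scal, DF'. }
  assert (Pf : forall i, periodic p (fun x => f x i)).
  { intros i x. unfold f. now rewrite (HFper i x). }
  assert (Pw : forall i, periodic p (fun x => w x i)).
  { intros i x. unfold w. now rewrite (PF' i x). }
  assert (Cw : forall i x, continuous (fun x => w x i) x).
  { intros i. apply (is_derive_continuous _ (fun x => w' x i)), Dw. }
  assert (Edot : forall x, dot (w x) (w x) = lam * lam * dot (F' x) (F' x))
    by (intros; unfold w, dot; ring).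
  assert (Hw14 : forall x, 0 < dot (w x) (w x) <= 1 / 4).
  { intros x. rewrite Edot. specialize (HF'pos x).
    split; [repeat apply Rmult_lt_0_compat; easy|].
    pose proof (dot_box C0 (F' x) (fun i => BF' i x)) as H.
    apply Rle_trans with (lam * lam * (3 * (C0 * C0))).
    - apply Rmult_le_compat_l; nra.
    - replace (lam * lam * (3 * (C0 * C0))) with (3 / 16) by (unfold lam; field; lra). lra. }
  assert (Hkc : forall n, reg_le (S (S n)) alpha -> Ck n kappa).
  { intros n Hn. apply (proj1 (C_real_Ck (reg_minus2 alpha) kappa) Hkreal).
    destruct alpha as [m|]; simpl in *; lia || easy. }
  destruct (frame_wiggle_data alpha p w w' kappa) as [rho0 [Hrho0 Hdata]]; auto.
  { intros i. apply (Ck_continuous 0). apply (Ck_scal 0 lam (fun x => F'' x i)). simpl. auto. }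
  { intros n i Hn. apply (Ck_scal (S n) lam (fun x => F' x i)). now apply CkF'. }
  { apply (Ck_continuous 0). now apply Hkc. }
  destruct (periodic_positive_min p (fun x => dot (w x) (w x))) as [mu [Hmu Hwmu]]; auto.
  { intros x. unfold dot. now rewrite !(Pw _ x). }
  { apply (Ck_continuous 0). unfold dot. repeat apply (Ck_plus 0); apply (Ck_mult 0); simpl; auto. }
  { intros x. apply Hw14. }
  pose (C := lam * C2 + lam * C0). assert (HC : 0 < C) by (unfold C; nra).
  assert (Lw : forall i x y, Rabs (w x i - w y i) <= C * Rabs (x - y)).
  { intros i. apply (derive_bounded_lipschitz _ (fun x => w' x i)); [apply Dw|].
    intros z. unfold w'. rewrite Rabs_mult, (Rabs_right lam) by lra. specialize (BF'' i z).
    unfold C. nra. }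
  assert (Lf : forall i x y, Rabs (f x i - f y i) <= C * Rabs (x - y)).
  { intros i. apply (derive_bounded_lipschitz _ (fun x => w x i)); [apply Df|].
    intros z. unfold w. rewrite Rabs_mult, (Rabs_right lam) by lra. specialize (BF' i z).
    unfold C. nra. }
  (* Exactly [2 * C * delta = mu / 16], as in [cone_of_derivatives]. *)
  pose (delta := mu / (32 * C)).
  assert (Hdelta : 0 < delta) by (apply Rdiv_lt_0_compat; lra).
  destruct (embedding_separated p f C delta) as [m [Hm Hsep]]; auto.
  { intros x y E. apply (HFinj x y). unfold to_R3.
    assert (E' : forall i, F x i = F y i) by (intros i; specialize (E i); unfold f in E; nra).
    now rewrite !E'. }
  (* [mu / 40] is for the cone condition [5 * rho <= mu / 8]. [m / (12 * p)] makes
     [rho * p <= m / 12]; with [eps <= m / 12] the coordinates of [h - f] are at most [m / 6], and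
     its norm at most [m / 3]. *)
  pose (rho := Rmin (Rmin rho0 1) (Rmin (mu / 40) (m / (12 * p)))).
  assert (Hrho : 0 < rho).
  { repeat apply Rmin_pos; try lra. apply Rdiv_lt_0_compat; lra. }
  assert (Hr1 : rho <= rho0 /\ rho <= 1).
  { split; (eapply Rle_trans; [apply Rmin_l|]); [apply Rmin_l|apply Rmin_r]. }
  assert (Hr2 : rho <= mu / 40 /\ rho <= m / (12 * p)).
  { split; (eapply Rle_trans; [apply Rmin_r|]); [apply Rmin_l|apply Rmin_r]. }
  destruct Hr1 as [Hr0 Hr1], Hr2 as [Hr2 Hr3].
  pose (eps := Rmin delta (m / 12)).
  assert (Heps : 0 < eps) by (apply Rmin_pos; lra).
  assert (Heps1 : eps <= delta) by apply Rmin_l. assert (Heps2 : eps <= m / 12) by apply Rmin_r.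
  destruct (Hdata rho (conj Hrho Hr0)) as [r0 [k0 [k1 [a [b [r [C1 W]]]]]]].
  assert (Ew : forall i x, prim (fun x => w x i) x = f x i - f 0 i).
  { intros i x.
    assert (E : prim (fun x => w x i) x - f x i = prim (fun x => w x i) 0 - f 0 i).
    { apply (derive_zero_const (fun x => prim (fun x => w x i) x - f x i)). intros z.
      replace 0 with (w z i - w z i) by ring.
      apply @is_derive_minus; [apply (is_derive_prim (fun x => w x i)), Cw|apply Df]. }
    rewrite prim_0 in E. lra. }
  destruct (closed_wiggle W w eps) as [xi [tg [dtg [c [Hxi [Hc [Ptg [Cktg [Dtg [Ndtg [Utg [Ztg [Atg Ctg]]]]]]]]]]]]];
    auto.
  { intros i. rewrite Ew. rewrite <- (Pf i 0), Rplus_0_l. ring. }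
  (* Starting at [f 0], so that [h - f] is the difference of the primitives of [tg] and [w]. *)
  pose (h := fun x i => f 0 i + prim (fun x => tg x i) x).
  assert (Ctgc : forall i x, continuous (fun x => tg x i) x).
  { intros i. apply (is_derive_continuous _ (fun x => dtg x i)). intros x. apply Dtg. }
  assert (Dh : forall i x, is_derive (fun x => h x i) x (tg x i)).
  { intros i x. unfold h. rewrite <- (Rplus_0_l (tg x i)).
    apply @is_derive_plus; [apply @is_derive_const|]. apply (is_derive_prim (fun x => tg x i)), Ctgc. }
  assert (Ph : forall i, periodic p (fun x => h x i)).
  { intros i x. unfold h. rewrite prim_periodic by auto. rewrite Ztg. ring. }
  assert (Hclose : forall x, nrm (vsub (h x) (f x)) <= m / 3).
  { intros x. replace (m / 3) with (2 * (m / 6)) by field.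
    apply nrm_le_coords. intros i. revert x.
    apply (periodic_forall p (fun x => vsub (h x) (f x) i) (fun y => Rabs y <= m / 6)); [easy| |].
    - intros x. unfold vsub. now rewrite (Ph i x), (Pf i x).
    - intros x Hx. specialize (Atg x i Hx). rewrite Ew in Atg.
      replace (vsub (h x) (f x) i) with (prim (fun x => tg x i) x - (f x i - f 0 i))
        by (unfold vsub, h; ring).
      assert (rho * p <= m / 12).
      { replace (m / 12) with (m / (12 * p) * p) by (field; lra). apply Rmult_le_compat_r; lra. }
      lra. }
  assert (Hcone : forall x y, Rabs (x - y) <= delta -> 0 < dot (w y) (w x) /\ 0 < dot (tg y) (w x)).
  { apply (cone_of_derivatives w tg xi mu C rho delta); auto; try lra.
    - replace (2 * C * delta) with (mu / 16) by (unfold delta; field; lra). lra.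
    - intros x. split; [apply Hwmu|apply Hw14].
    - intros x. destruct (Ctg x) as [u [Hu1 Hu2]]. exists u. split; [lra|easy]. }
  pose (g := fun x i => c * h x i).
  assert (Dg : forall i x, is_derive (fun x => g x i) x (c * tg x i)).
  { intros i x. apply is_derive_scal, Dh. }
  assert (Ckg : forall n i, reg_le n alpha -> Ck n (fun x => g x i)).
  { intros n i Hn. apply Ck_scal. apply (Ck_le (S (S (n - 2)))); [lia|].
    apply (Ck_S _ _ (fun x => tg x i)); [apply Dh|]. apply Cktg.
    destruct alpha as [q|]; simpl in *; lia || easy. }
  assert (HgC : C_circle alpha p (fun x => to_R3 (g x))).
  { apply C_circle_to_R3. split; [|easy]. intros i x. unfold g. now rewrite (Ph i x). }
  assert (HEmb : forall t, 0 <= t <= 1 ->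
    Emb alpha p (fun x => to_R3 (fun i => (1 - t) * F x i + t * g x i))).
  { intros t Ht.
    (* [F] is [f / lam] and [g] is [c * h], so the segment from [F] to [g] consists of nonnegative
       combinations of [f] and [h], never both coefficients zero; the two scalings need no isotopy
       of their own. *)
    pose (A := (1 - t) / lam). pose (B := t * c).
    assert (HA : 0 <= A) by (apply Rdiv_le_0_compat; lra).
    assert (HBB : 0 <= B) by (unfold B; nra).
    assert (HAB : 0 < A + B).
    { destruct (Req_dec t 1) as [->|n].
      - unfold B. lra.
      - assert (0 < A) by (apply Rdiv_lt_0_compat; lra). lra. }
    assert (Eq : forall x i, (1 - t) * F x i + t * g x i = A * f x i + B * h x i).
    { intros x i. unfold A, B, f, g. field. lra. }
    replace (fun x => to_R3 (fun i => (1 - t) * F x i + t * g x i)) with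
      (fun x => to_R3 (fun i => A * f x i + B * h x i)).
    2: { apply functional_extensionality. intros x. f_equal.
         apply functional_extensionality. intros i. symmetry. apply Eq. }
    split; [split|].
    - apply (C_circle_to_R3 alpha p (fun x i => A * f x i + B * h x i)). split.
      + intros i x. now rewrite (Pf i x), (Ph i x).
      + intros n i Hn. replace (fun x => A * f x i + B * h x i) with
          (fun x => (1 - t) * F x i + t * g x i) by (apply functional_extensionality; intros; apply Eq).
        apply Ck_plus; apply Ck_scal; [now apply HFCk|now apply Ckg].
    - intros x. rewrite (deriv_to_R3 (fun x i => A * f x i + B * h x i) (fun x i => A * w x i + B * tg x i)).
      + intros E. destruct (Hcone x x) as [Q1 Q2]; [rewrite Rminus_diag, Rabs_R0; lra|].
        apply (f_equal of_R3) in E.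
        assert (Z : forall i, A * w x i + B * tg x i = 0).
        { intros i. apply (f_equal (fun u => u i)) in E. now destruct i. }
        assert (Z' : A * dot (w x) (w x) + B * dot (tg x) (w x) = 0).
        { transitivity (dot (fun i => A * w x i + B * tg x i) (w x)); [unfold dot; ring|].
          unfold dot. rewrite !Z. ring. }
        destruct (Rle_lt_or_eq_dec 0 A HA) as [HA'|HA']; [|rewrite <- HA' in *]; nra.
      + intros i. apply @is_derive_plus; apply is_derive_scal; auto.
    - intros x y E.
      apply (cone_embedding p f h w tg delta m A B Hp Hm Df Dh Pf Ph Hcone Hsep Hclose HA HBB HAB x y).
      apply (f_equal of_R3) in E. intros i.
      apply (f_equal (fun u => u i)) in E. now destruct i. }
  exists g, tg, dtg, c. split; [easy|]. split; [|split].
  - replace g with (fun x i => (1 - 1) * F x i + 1 * g x i).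
    + apply HEmb. lra.
    + do 2 (apply functional_extensionality; intros ?). ring.
  - apply isotopic_linear; easy.
  - split; [easy|]. split; [easy|]. split; [|easy].
    intros x. unfold nrm. rewrite Utg. apply sqrt_1.
Qed.

Theorem corollary1p2 (a b : R) (alpha : regularity)
    (f : R -> R3) (kappa : R -> R)
    (hab : a < b) (halpha : reg_le 2 alpha)
    (hf : Emb alpha (b - a) f)
    (hkappa : C_circle_R (reg_minus2 alpha) (b - a) kappa)
    (hpos : forall x, 0 < kappa x) :
  exists g : R -> R3,
    Emb alpha (b - a) g /\
    isotopic alpha (b - a) f g /\
    constant_speed g /\
    (forall x, curvature g x = kappa x).
Proof.
  assert (Ef : f = fun x => to_R3 (of_R3 (f x))).
  { apply functional_extensionality. intros x. now rewrite to_of_R3. }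
  rewrite Ef in hf.
  destruct (prescribed_curvature alpha (b - a) (fun x => of_R3 (f x)) kappa)
    as [g [tg [dtg [c [Hc [HE [Hiso [Dg [Dtg [Ntg Ndtg]]]]]]]]]]; auto; [lra|].
  rewrite <- Ef in Hiso.
  assert (Hd : forall x, deriv (fun x => to_R3 (g x)) x = to_R3 (fun i => c * tg x i)).
  { intros x. apply (deriv_to_R3 g (fun x i => c * tg x i)). intros i. apply Dg. }
  assert (Hn : forall x, norm (deriv (fun x => to_R3 (g x)) x) = c).
  { intros x. rewrite Hd, norm_to_R3, nrm_scal, Ntg by lra. ring. }
  exists (fun x => to_R3 (g x)). split; [easy|]. split; [easy|]. split; [now exists c|].
  intros x. unfold curvature. rewrite Hn.
  replace (unit_tangent (fun x => to_R3 (g x))) with (fun x => to_R3 (tg x)).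
  - rewrite (deriv_to_R3 tg dtg) by auto. rewrite norm_to_R3, Ndtg. field. lra.
  - apply functional_extensionality. intros y. unfold unit_tangent. rewrite Hn, Hd.
    change (vec3 (tg y ax1) (tg y ax2) (tg y ax3) =
      vec3 (/ c * (c * tg y ax1)) (/ c * (c * tg y ax2)) (/ c * (c * tg y ax3))).
    f_equal; field; lra.
Qed.
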